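(* Let $Q$ be a quiver, $\mathcal V=(V_x)_{x\in Q_0}$ a family of vector spaces, $\mathcal F=(F_x)_{x\in Q_0}$ a family of filtrations on $\mathcal V$, and $\mathcal S\subseteq\mathcal V$ a family of subspaces. Then $\mathcal S\subseteq_Q\mathcal V$ if and only if both of the following hold: (A) $\mathrm{edim}_{Q,\mathcal F}(\mathcal S,\mathcal V)\ge 0$; (B) $\mathcal T\subset_Q\mathcal V$ for every $\mathcal T\subset_Q\mathcal S$ (where $\mathcal S$ is equipped with the induced filtrations $\mathcal F_{\mathcal S}$).
   Context: All vector spaces are finite-dimensional over $\mathbb C$. A quiver $Q=(Q_0,Q_1)$ has a finite vertex set $Q_0$ and a finite arrow set $Q_1$ (cycles and multiple arrows allowed); $a\colon x\to y$ denotes an arrow. For a family of vector spaces $\mathcal V=(V_x)_{x\in Q_0}$ put $\mathcal H_Q(\mathcal V)=\bigoplus_{a\colon x\to y\in Q_1}\mathrm{Hom}(V_x,V_y)$. We write $\mathcal S\subseteq\mathcal V$ if $\mathcal S=(S_x)_{x\in Q_0}$ with each $S_x$ a subspace of $V_x$. For $v\in\mathcal H_Q(\mathcal V)$, $v\mathcal S\subseteq\mathcal S$ means $v_aS_x\subseteq S_y$ for every arrow $a\colon x\to y$. A (complete) filtration $F$ on a vector space $V$ is a chain $\{0\}=F(0)\subseteq F(1)\subseteq\dots\subseteq F(\ell)=V$ with $\dim F(i+1)\le\dim F(i)+1$ for all $i$. A family of filtrations $\mathcal F=(F_x)$ on $\mathcal V$ consists of a filtration $F_x$ on each $V_x$.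 For $\mathcal S\subseteq\mathcal V$, the induced filtrations $\mathcal F_{\mathcal S}$ on $\mathcal S$ are given by $F_x(i)\cap S_x$. Let $B_Q(\mathcal V,\mathcal F)=\prod_x B_x$, with $B_x\subseteq \mathrm{GL}(V_x)$ the Borel subgroup preserving $F_x$. For a dimension vector $\boldsymbol\alpha=(\alpha_x)$, $\mathrm{Gr}_Q(\boldsymbol\alpha,\mathcal V)=\prod_x\mathrm{Gr}(\alpha_x,V_x)$. For $\mathcal S\subseteq\mathcal V$ with $\dim S_x=\alpha_x$, $\boldsymbol\Omega(\mathcal S,\mathcal F)$ is the closure of the $B_Q(\mathcal V,\mathcal F)$-orbit of $\mathcal S$ in $\mathrm{Gr}_Q(\boldsymbol\alpha,\mathcal V)$. We say $\mathcal S$ is $Q$-intersecting in $\mathcal V$, written $\mathcal S\subseteq_Q\mathcal V$, if for every $v\in\mathcal H_Q(\mathcal V)$ there is $\mathcal T\in\boldsymbol\Omega(\mathcal S,\mathcal F)$ with $v\mathcal T\subseteq\mathcal T$. We write $\mathcal S\subset_Q\mathcal V$ if in addition $S_x\neq V_x$ for at least one $x$. The same notions are applied to $\mathcal T\subseteq\mathcal S$ using $(\mathcal S,\mathcal F_{\mathcal S})$ in place of $(\mathcal V,\mathcal F)$. The expected dimension is $\mathrm{edim}_{Q,\mathcal F}(\mathcal S,\mathcal V)=\dim\boldsymbol\Omega(\mathcal S,\mathcal F)-\sum_{a\colon x\to y\in Q_1}\dim S_x\,(\dim V_y-\dim S_y)$. *)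

(* Defs.v *)
From HB Require Import structures.
From mathcomp Require Import all_boot all_order all_algebra.
From mathcomp Require Import boolp classical_sets.
From mathcomp Require Import mpoly.

Set Implicit Arguments.
Unset Strict Implicit.
Unset Printing Implicit Defensive.

Import Order.TTheory GRing.Theory Num.Theory.
Local Open Scope classical_set_scope.
Local Open Scope ring_scope.

Record quiver := Quiver {
  vertex : finType;
  arrow : finType;
  source : arrow -> vertex;
  target : arrow -> vertex }.

(* Only the values [fil F i] with [i <= len F] are meaningful. *)
Record filtration (K : fieldType) (U : vectType K) := Filtration {
  len : nat;
  fil : nat -> {vspace U};
  fil_first : fil 0%N = 0%VS;
  fil_last : fil len = fullv;
  fil_sub : forall i, (i < len)%N -> (fil i <= fil i.+1)%VS;
  fil_dim : forall i, (i < len)%N -> (\dim (fil i.+1) <= (\dim (fil i)).+1)%N }.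

Section InducedFiltration.
Context (K : fieldType) (U : vectType K) (F : filtration U) (S : {vspace U}).

(* F(i) :&: S, seen inside the vector space [subvs_of S]. *)
Definition induced_fil (i : nat) : {vspace subvs_of S} :=
  (linfun (vsval : subvs_of S -> U) @^-1: fil F i)%VS.

Lemma limg_vsval : limg (linfun (vsval : subvs_of S -> U)) = S.
Proof.
apply/vspaceP => v; apply/idP/idP.
  by case/memv_imgP => u _ ->; rewrite lfunE; apply: subvsP.
move=> vS; apply/memv_imgP; exists (Subvs vS); rewrite ?memvf //.
by rewrite lfunE.
Qed.

Lemma induced_filE i :
  (linfun (vsval : subvs_of S -> U) @: induced_fil i)%VS = (fil F i :&: S)%VS.
Proof.
by rewrite /induced_fil -lpreim_cap_limg lpreimK ?capvSr // limg_vsval.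
Qed.

Lemma dim_vsval_img (T : {vspace subvs_of S}) :
  \dim (linfun (vsval : subvs_of S -> U) @: T)%VS = \dim T.
Proof.
apply: limg_dim_eq; apply/eqP; rewrite -subv0; apply/subvP => u.
rewrite memv_cap memv_ker lfunE => /andP[_ /eqP u0].
by rewrite memv0; apply/eqP/subvs_inj.
Qed.

Lemma induced_first : induced_fil 0%N = 0%VS.
Proof.
apply/eqP; rewrite -dimv_eq0 -dim_vsval_img induced_filE fil_first cap0v.
by rewrite dimv0.
Qed.

Lemma induced_last : induced_fil (len F) = fullv.
Proof.
apply/vspaceP => u; rewrite memvf -memv_preim fil_last.
by rewrite memvf.
Qed.

Lemma induced_sub i :
  (i < len F)%N -> (induced_fil i <= induced_fil i.+1)%VS.
Proof.
move=> iF; apply/subvP => u; rewrite -!memv_preim.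
exact/subvP/fil_sub.
Qed.

Lemma induced_dim i :
  (i < len F)%N -> (\dim (induced_fil i.+1) <= (\dim (induced_fil i)).+1)%N.
Proof.
move=> iF; rewrite -!dim_vsval_img !induced_filE.
set A := fil F i.+1; set B := fil F i.
have BA : (B <= A)%VS by apply: fil_sub.
have := dimv_sum_cap B (A :&: S).
rewrite capvA (capv_idPl BA) => e.
have : (\dim (B + A :&: S) <= (\dim B).+1)%N.
  apply: leq_trans (fil_dim iF); apply: dimvS.
  by rewrite subv_add BA capvSl.
rewrite -(leq_add2r (\dim (B :&: S))) e addSnnS leq_add2l; exact.
Qed.

Definition induced_filtration : filtration (subvs_of S) :=
  Filtration induced_first induced_last induced_sub induced_dim.

End InducedFiltration.

Section Grassmannian.
Context (K : fieldType) (I : finType) (V : I -> vectType K).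

Definition subfamily := forall x, {vspace V x}.

Definition Gr (alpha : I -> nat) : set subfamily :=
  [set T | forall x, \dim (T x) = alpha x].

(* A frame lists, for every x, vectors spanning the x-th subspace;
   its coordinates are indexed by the finite type [frame_index]. *)
Definition frame (alpha : I -> nat) := forall x, (alpha x).-tuple (V x).

Definition frame_index (alpha : I -> nat) : finType :=
  {x : I & ('I_(alpha x) * 'I_(\dim {: V x}))%type}.

Definition frame_coord (alpha : I -> nat) (e : frame alpha)
    (k : 'I_#|frame_index alpha|) : K :=
  let: existT x (i, j) := enum_val k in
  coord (vbasis {: V x}) j (tnth (e x) i).

Definition frame_span (alpha : I -> nat) (e : frame alpha) : subfamily :=
  fun x => <<e x>>%VS.

(* Zariski topology of the variety \prod_x Gr(alpha_x, V_x), as the quotient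
   of the variety of linearly independent frames by \prod_x GL(alpha_x):
   a set of subspaces is closed iff the frames spanning its members are the
   zero locus of a set of polynomials in the coordinates. *)
Definition zariski_closed (alpha : I -> nat) (Z : set subfamily) : Prop :=
  Z `<=` Gr alpha /\
  exists P : set {mpoly K[#|frame_index alpha|]},
    forall e : frame alpha, (forall x, free (e x)) ->
      (Z (frame_span e) <-> forall p, P p -> p.@[frame_coord e] = 0).

Definition zariski_closure (alpha : I -> nat) (X : set subfamily) :
    set subfamily :=
  [set T | Gr alpha T /\
     forall Z, zariski_closed alpha Z -> X `<=` Z -> Z T].

Definition zariski_irreducible (alpha : I -> nat) (Z : set subfamily) : Prop :=
  Z !=set0 /\
  forall Z1 Z2, zariski_closed alpha Z1 -> zariski_closed alpha Z2 ->
    Z `<=` Z1 `|` Z2 -> Z `<=` Z1 \/ Z `<=` Z2.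

Definition irreducible_chain (alpha : I -> nat) (X : set subfamily) (n : nat) :
    Prop :=
  exists Z : nat -> set subfamily,
    (forall i, (i <= n)%N ->
       [/\ zariski_closed alpha (Z i), zariski_irreducible alpha (Z i)
         & Z i `<=` X]) /\
    (forall i, (i < n)%N -> Z i `<` Z i.+1).

(* Krull dimension of a closed subset X: the maximal length of a chain of
   irreducible closed subsets of X (0 if there is no maximum). *)
Definition dimension (alpha : I -> nat) (X : set subfamily) : nat :=
  xget 0%N [set d | irreducible_chain alpha X d /\
                    forall n, irreducible_chain alpha X n -> (n <= d)%N].

End Grassmannian.

Section Schubert.
Context (K : fieldType) (I : finType) (V : I -> vectType K).
Context (F : forall x, filtration (V x)).

Definition borel : set (forall x, 'End(V x)) :=
  [set g | forall x, lker (g x) = 0%VS /\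
     forall i, (i <= len (F x))%N -> (g x @: fil (F x) i <= fil (F x) i)%VS].

Definition borel_orbit (S : subfamily V) : set (subfamily V) :=
  [set T | exists2 g, borel g & forall x, T x = (g x @: S x)%VS].

Definition Omega (S : subfamily V) : set (subfamily V) :=
  zariski_closure (fun x => \dim (S x)) (borel_orbit S).

Definition dim_Omega (S : subfamily V) : nat :=
  dimension (fun x => \dim (S x)) (Omega S).

End Schubert.

Section Intersecting.
Context (K : fieldType) (Q : quiver) (V : vertex Q -> vectType K).

Definition representation :=
  forall a : arrow Q, 'Hom(V (source a), V (target a)).

Definition subrepresentation (v : representation) (T : subfamily V) : Prop :=
  forall a : arrow Q, (v a @: T (source a) <= T (target a))%VS.

Context (F : forall x, filtration (V x)).

Definition intersecting (S : subfamily V) : Prop :=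
  forall v : representation, exists2 T, Omega F S T & subrepresentation v T.

Definition strictly_intersecting (S : subfamily V) : Prop :=
  intersecting S /\ exists x, S x <> fullv.

Definition edim (S : subfamily V) : int :=
  (dim_Omega F S)%:Z -
  \sum_(a : arrow Q) (\dim (S (source a)))%:Z *
    ((\dim {: V (target a)})%:Z - (\dim (S (target a)))%:Z).

End Intersecting.

Section Restriction.
Context (K : fieldType) (I : finType) (V : I -> vectType K) (S : subfamily V).

Definition restricted_family : I -> vectType K := fun x => subvs_of (S x).

Definition restricted_filtrations (F : forall x, filtration (V x)) :
    forall x, filtration (restricted_family x) :=
  fun x => induced_filtration (F x) (S x).

(* A family T of subspaces of S, viewed as a family of subspaces of V. *)
Definition extended (T : subfamily restricted_family) : subfamily V :=
  fun x => (linfun (vsval : subvs_of (S x) -> V x) @: T x)%VS.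

End Restriction.

(* Main.v *)
(* Choose bases of the V_x adapted to the filtrations and to S. The Borel orbit
   of S becomes the affine space of filtered maps X : S -> V/S, which gives the
   dimension of Omega. As Schubert varieties are projective, S is intersecting
   iff the representations preserving some member of this cell are Zariski
   dense. The limits needed here are taken along a place of a function field.

   Density is transitive, and a dimension count shows that it forces the expected
   dimension to be nonnegative: hence (A) and (B). Conversely, let delta_w send a
   filtered map X : S -> V/S to w X - X w in H_Q(S, V/S). If delta_w is onto for
   some w, a polynomial vanishing on the representations that preserve a member
   of the cell vanishes with all its derivatives, so S is intersecting. Otherwise
   take w generic and a null vector X of delta_w: the kernel of X gives a
   subspace T of S that is intersecting in S, and since the rank of delta_w is
   maximal, X w lies to first order in the image of delta_w, which shows that
   edim(T, S) <= 0 and that delta is nowhere onto for T -> V/S. Iterating until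
   delta is injective there, edim(T, V/S) < 0. By additivity edim(T, V) < 0, so T
   violates (B) unless T = S, which violates (A). *)

Require Import Defs.
From HB Require Import structures.
From mathcomp Require Import all_boot all_order all_algebra.
From mathcomp Require Import perm boolp.
From mathcomp Require Import mpoly.
From mathcomp Require Import reals complex.
From mathcomp Require Import ring zify.

Set Implicit Arguments.
Unset Strict Implicit.
Unset Printing Implicit Defensive.

Import Order.TTheory GRing.Theory Num.Theory VectorInternalTheory.
Local Open Scope ring_scope.

(** * Polynomial functions on vector spaces *)

(** Two obstacles shape the proof. The kernel of a null vector X is not spanned by basis vectors,
    although only its Schubert position T matters. An echelon form writes it as K^T (1 + Z);
    conjugating by 1 + Z moves it to K^T but also changes w, so ranks of delta have to be compared
    at both representations. Since T runs over finitely many sets of indices, one w can be generic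
    for all of them, and stays so throughout the iteration.

    The algebraic geometry is reduced to polynomial functions with explicit degrees. Dimensions are
    compared by growth: an affine space of dimension n carries at least k^n independent functions of
    degree O(k), and at most O(k)^n. Derivatives detect vanishing because the characteristic is
    zero. Properness is a valuative argument: a maximal partial morphism to the ground field, on the
    function field of the pairs (member of the cell, representation preserving it), is a place, and
    normalising a frame by a minor of largest value makes all its entries finite. *)

Section PolynomialFunctions.
Context {K : numFieldType}.
Implicit Types (U : vectType K) (d : nat).

(** [msize] exceeds the total degree by one, so [d] bounds the degree. The bound is recorded because
    both the induction through derivatives and the counting of functions need it. *)
Definition polyd U d (f : U -> K) : Prop :=
  exists2 p : {mpoly K[dim U]}, (msize p <= d.+1)%N &
    forall u, f u = p.@[v2r u 0].

Definition polyf U (f : U -> K) : Prop := exists d, polyd d f.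

Lemma polyd_ext U d (f g : U -> K) : f =1 g -> polyd d f -> polyd d g.
Proof. by move=> fg [p sp fp]; exists p => // u; rewrite -fg. Qed.

Lemma polyd_eq U d (f g : U -> K) : polyd d f -> f =1 g -> polyd d g.
Proof. by move=> fP fg; apply: polyd_ext fP. Qed.

Lemma polyd_polyf U d (f : U -> K) : polyd d f -> polyf f.
Proof. by exists d. Qed.

Lemma polyd_le U d e (f : U -> K) : (d <= e)%N -> polyd d f -> polyd e f.
Proof. by move=> de [p sp fp]; exists p => //; apply: leq_trans sp _. Qed.

Lemma polyd_const {U} d (c : K) : polyd d (fun _ : U => c).
Proof.
exists c%:MP => [|u]; last by rewrite mevalC.
by rewrite msizeC; case: (c != 0).
Qed.

Lemma polydD U d (f g : U -> K) :
  polyd d f -> polyd d g -> polyd d (fun u => f u + g u).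
Proof.
move=> [p sp fp] [q sq gq]; exists (p + q) => [|u].
  by rewrite (leq_trans (msizeD_le _ _)) // geq_max sp.
by rewrite mevalD fp gq.
Qed.

Lemma polydM U d e (f g : U -> K) :
  polyd d f -> polyd e g -> polyd (d + e)%N (fun u => f u * g u).
Proof.
move=> [p sp fp] [q sq gq]; exists (p * q) => [|u]; last by rewrite mevalM fp gq.
have [->|p0] := eqVneq p 0; first by rewrite mul0r msize0.
have [->|q0] := eqVneq q 0; first by rewrite mulr0 msize0.
rewrite msizeM //; move: (mmeasure _ p) (mmeasure _ q) sp sq => a b; lia.
Qed.

Lemma polydZ U d c (f : U -> K) : polyd d f -> polyd d (fun u => c * f u).
Proof. by move=> fP; rewrite -[d]add0n; apply: polydM => //; apply: polyd_const. Qed.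

Lemma polydN U d (f : U -> K) : polyd d f -> polyd d (fun u => - f u).
Proof.
by move=> /(polydZ (-1)) /polyd_eq; apply=> u; rewrite mulN1r.
Qed.

Lemma polydB U d (f g : U -> K) :
  polyd d f -> polyd d g -> polyd d (fun u => f u - g u).
Proof. by move=> fP gP; apply: polydD => //; apply: polydN. Qed.

Lemma polyd_sum U d (I : Type) (r : seq I) (P : pred I) (F : I -> U -> K) :
  (forall i, polyd d (F i)) -> polyd d (fun u => \sum_(i <- r | P i) F i u).
Proof.
move=> FP; elim: r => [|i r IH].
  by apply: (polyd_eq (polyd_const d 0)) => u; rewrite big_nil.
case Pi: (P i); last by apply: (polyd_eq IH) => u; rewrite big_cons Pi.
by apply: (polyd_eq (polydD (FP i) IH)) => u; rewrite big_cons Pi.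
Qed.

Lemma polyd_prod U (I : Type) (r : seq I) (P : pred I) (F : I -> U -> K)
    (D : I -> nat) :
  (forall i, polyd (D i) (F i)) ->
  polyd (\sum_(i <- r | P i) D i)%N (fun u => \prod_(i <- r | P i) F i u).
Proof.
move=> FP; elim: r => [|i r IH].
  rewrite big_nil.
  by apply: (polyd_eq (polyd_const 0%N 1)) => u; rewrite big_nil.
rewrite big_cons; case Pi: (P i); last first.
  by apply: (polyd_eq IH) => u; rewrite big_cons Pi.
by apply: (polyd_eq (polydM (FP i) IH)) => u; rewrite big_cons Pi.
Qed.

Lemma polyd_exp U d (f : U -> K) k :
  polyd d f -> polyd (d * k)%N (fun u => f u ^+ k).
Proof.
move=> fP; elim: k => [|k IH].
  by rewrite muln0; apply: (polyd_eq (polyd_const 0%N 1)) => u; rewrite expr0.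
by rewrite mulnS; apply: (polyd_eq (polydM fP IH)) => u; rewrite exprS.
Qed.

Lemma polyd_coord U (i : 'I_(dim U)) : polyd 1 (fun u : U => v2r u 0 i).
Proof.
by exists 'X_i => [|u]; [rewrite msizeX mdeg1 | rewrite mevalXU].
Qed.

Lemma polyd_lin U (f : U -> K) :
  (forall a u v, f (a *: u + v) = a * f u + f v) -> polyd 1 f.
Proof.
move=> fL; have f0 : f 0 = 0.
  by have := fL (-1) 0 0; rewrite scaler0 addr0 mulN1r addNr.
apply: (@polyd_ext _ _ (fun u => \sum_i f (r2v (delta_mx 0 i)) * v2r u 0 i)).
  move=> u; rewrite -{2}[u]v2rK {2}(matrix_sum_delta (v2r u)) big_ord1 linear_sum.
  elim/big_rec2: _ => [//|i y x _ ->].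
  by rewrite linearZ /= fL mulrC.
by apply: polyd_sum => i; apply: polydZ; apply: polyd_coord.
Qed.

Definition polymap U1 U2 d (g : U1 -> U2) : Prop :=
  forall i, polyd d (fun u => v2r (g u) 0 i).

Lemma polyd_comp U1 U2 d e (f : U2 -> K) (g : U1 -> U2) :
  polyd d f -> polymap e g -> polyd (d * e)%N (fun u => f (g u)).
Proof.
move=> [p sp fp] gP.
(* The guard gives every summand the degree bound that [polyd_sum] demands, even for monomials
   outside the support. *)
apply: (@polyd_ext _ _ (fun u => \sum_(m <- msupp p)
   if m \in msupp p then p@_m * \prod_i v2r (g u) 0 i ^+ m i else 0)).
  move=> u; rewrite fp mevalE; apply: eq_big_seq => m mp; by rewrite mp.
apply: polyd_sum => m; case: (boolP (m \in msupp p)) => [mp|_]; last exact: polyd_const.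
apply: polydZ; apply: (@polyd_le _ (\sum_i (e * m i))%N).
  rewrite -big_distrr /= mulnC leq_mul2r -mdegE; apply/orP; right.
  by have := msize_mdeg_lt mp; lia.
by apply: polyd_prod => i; apply: polyd_exp.
Qed.

Lemma polyf_comp U1 U2 d (f : U2 -> K) (g : U1 -> U2) :
  polyf f -> polymap d g -> polyf (fun u => f (g u)).
Proof. by move=> [e fP] gP; exists (e * d)%N; apply: polyd_comp. Qed.

Lemma polymap_basis U1 U2 d (g : U1 -> U2) (I : finType) (b : I -> U2)
    (c : I -> U2 -> K) :
  (forall u, u = \sum_i c i u *: b i) ->
  (forall i, polyd d (fun u => c i (g u))) -> polymap d g.
Proof.
move=> cE cP j.
apply: (@polyd_ext _ _ (fun u => \sum_i v2r (b i) 0 j * c i (g u))).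
  move=> u; rewrite [in RHS](cE (g u)) linear_sum summxE.
  by apply: eq_bigr => i _; rewrite linearZ mxE mulrC.
by apply: polyd_sum => i; apply: polydZ.
Qed.

Lemma polymapM U d m n (g : U -> 'M[K]_(m, n)) :
  (forall i j, polyd d (fun u => g u i j)) -> polymap d g.
Proof.
move=> gP; apply: (polymap_basis (I := ('I_m * 'I_n)%type)
  (b := fun ij => delta_mx ij.1 ij.2) (c := fun ij M => M ij.1 ij.2)).
  by move=> M; rewrite {1}[M]matrix_sum_delta pair_bigA.
by case=> i j.
Qed.

Lemma polymapF U d (T : finType) m n (g : U -> {ffun T -> 'M[K]_(m, n)}) :
  (forall t i j, polyd d (fun u => g u t i j)) -> polymap d g.
Proof.
move=> gP; apply: (polymap_basis (I := (T * ('I_m * 'I_n))%type)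
  (b := fun x => [ffun t => if t == x.1 then delta_mx x.2.1 x.2.2 else 0])
  (c := fun x w => w x.1 x.2.1 x.2.2)).
  move=> w; apply/ffunP => t; apply/matrixP => i j; rewrite sum_ffunE summxE.
  rewrite (bigD1 (t, (i, j))) //= !ffunE eqxx !mxE !eqxx mulr1 big1 ?addr0 //.
  case=> s [k l] ne; rewrite !ffunE; case: eqP => /= [ts|_]; last by rewrite scaler0 mxE.
  rewrite !mxE; move: ne; rewrite -ts !xpair_eqE eqxx /= [k == i]eq_sym [l == j]eq_sym.
  by move=> /negPf ->; rewrite mulr0.
by case=> t [i j].
Qed.

Lemma polyd_mulmx U d e m n p (A : U -> 'M[K]_(m, n)) (B : U -> 'M[K]_(n, p)) :
  (forall i j, polyd d (fun u => A u i j)) ->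
  (forall i j, polyd e (fun u => B u i j)) ->
  forall i j, polyd (d + e)%N (fun u => (A u *m B u) i j).
Proof.
move=> AP BP i j.
apply: (@polyd_ext _ _ (fun u => \sum_k A u i k * B u k j)).
  by move=> u; rewrite mxE.
by apply: polyd_sum => k; apply: polydM.
Qed.

Lemma polyd_det U d n (A : U -> 'M[K]_n) :
  (forall i j, polyd d (fun u => A u i j)) ->
  polyd (n * d)%N (fun u => \det (A u)).
Proof.
move=> AP.
apply: (@polyd_ext _ _ (fun u => \sum_(s : 'S_n) (-1) ^+ s * \prod_i A u i (s i))) => //.
apply: polyd_sum => s; apply: polydZ.
have -> : (n * d = \sum_(i < n) d)%N by rewrite sum_nat_const card_ord.
by apply: polyd_prod => i.
Qed.

Lemma polyd_adj U d n (A : U -> 'M[K]_n) :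
  (forall i j, polyd d (fun u => A u i j)) ->
  forall i j, polyd (n * d)%N (fun u => (\adj (A u)) i j).
Proof.
move=> AP i j; apply: (@polyd_ext _ _ (fun u => (-1) ^+ (j + i) *
  \det (row' j (col' i (A u))))); first by move=> u; rewrite mxE.
apply: polydZ; apply: (@polyd_le _ (n.-1 * d)%N); first by rewrite leq_mul2r leq_pred orbT.
apply: polyd_det => k l.
by apply: (polyd_eq (AP (lift j k) (lift i l))) => u; rewrite !mxE.
Qed.

Lemma polyf_const {U} (c : K) : polyf (fun _ : U => c).
Proof. by exists 0%N; apply: polyd_const. Qed.

Lemma polyf_lin U (f : U -> K) :
  (forall a u v, f (a *: u + v) = a * f u + f v) -> polyf f.
Proof. by move=> /polyd_lin fP; exists 1%N. Qed.

Lemma polyf2 U (f g : U -> K) : polyf f -> polyf g ->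
  exists d, polyd d f /\ polyd d g.
Proof.
move=> [d fP] [e gP]; exists (maxn d e).
by split; [apply: polyd_le fP; apply: leq_maxl | apply: polyd_le gP; apply: leq_maxr].
Qed.

Lemma polyfD U (f g : U -> K) : polyf f -> polyf g -> polyf (fun u => f u + g u).
Proof. by move=> fP gP; have [d [? ?]] := polyf2 fP gP; exists d; apply: polydD. Qed.

Lemma polyfM U (f g : U -> K) : polyf f -> polyf g -> polyf (fun u => f u * g u).
Proof. by move=> [d fP] [e gP]; exists (d + e)%N; apply: polydM. Qed.

Lemma mmap_line n (p : {mpoly K[n]}) (c : 'I_n -> {poly K}) t :
  (mmap polyC c p).[t] = p.@[fun i => (c i).[t]].
Proof.
rewrite mevalE /mmap horner_sum; apply: eq_bigr => m _.
rewrite hornerM hornerC /mmap1 horner_prod; congr (_ * _).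
by apply: eq_bigr => i _; rewrite hornerE.
Qed.

Lemma polyf_line U (f : U -> K) u w : polyf f ->
  exists p : {poly K}, forall t, f (u + t *: w) = p.[t].
Proof.
move=> [d [p _ fp]].
exists (mmap polyC (fun i => (v2r u 0 i)%:P + (v2r w 0 i) *: 'X) p) => t.
rewrite mmap_line fp; apply: meval_eq => i.
by rewrite linearD linearZ !mxE !hornerE mulrC.
Qed.

Lemma poly_nonroot (p : {poly K}) : p != 0 -> exists t, p.[t] != 0.
Proof.
move=> p0; pose s := [seq (i%:R : K) | i <- iota 0 (size p)].
have us : uniq s.
  by rewrite map_inj_uniq ?iota_uniq // => i j /eqP; rewrite eqr_nat => /eqP.
case: (boolP (all (root p) s)) => [rs|].
  by have := max_poly_roots p0 rs us; rewrite size_map size_iota ltnn.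
by case/allPn => t _ rt; exists t.
Qed.

Lemma poly_nonroots (p q : {poly K}) t1 t2 : p.[t1] != 0 -> q.[t2] != 0 ->
  exists t, p.[t] != 0 /\ q.[t] != 0.
Proof.
move=> pt qt; have p0 : p != 0 by apply: contraNneq pt => ->; rewrite horner0.
have q0 : q != 0 by apply: contraNneq qt => ->; rewrite horner0.
have [t] := poly_nonroot (mulf_neq0 p0 q0).
by rewrite hornerM mulf_eq0 negb_or => /andP[? ?]; exists t.
Qed.

Lemma polyf_domain_line U (f g : U -> K) u w t1 t2 : polyf f -> polyf g ->
  f (u + t1 *: w) != 0 -> g (u + t2 *: w) != 0 ->
  exists t, f (u + t *: w) != 0 /\ g (u + t *: w) != 0.
Proof.
move=> /(polyf_line u w)[p fp] /(polyf_line u w)[q gq].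
rewrite fp gq => pt qt; have [t []] := poly_nonroots pt qt.
by exists t; rewrite fp gq.
Qed.

(** Nonempty open sets meet: on the line through the two witnesses only finitely many parameters are
    bad. *)
Lemma polyf_domain U (f g : U -> K) u1 u2 : polyf f -> polyf g ->
  f u1 != 0 -> g u2 != 0 -> exists u, f u != 0 /\ g u != 0.
Proof.
move=> fP gP fu gu.
have [||t ft] := @polyf_domain_line U f g u1 (u2 - u1) 0 1 fP gP.
- by rewrite scale0r addr0.
- by rewrite scale1r addrC subrK.
by exists (u1 + t *: (u2 - u1)).
Qed.

Lemma polyf_big_domain U (I : eqType) (r : seq I) (F : I -> U -> K) :
  (forall i, i \in r -> polyf (F i) /\ exists u, F i u != 0) ->
  exists u, forall i, i \in r -> F i u != 0.
Proof.
move=> FP; suff [f [fP [u fu] fF]] : exists f : U -> K,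
    [/\ polyf f, exists u, f u != 0 & forall u, f u != 0 -> forall i, i \in r -> F i u != 0].
  by exists u; apply: fF.
elim: r FP => [|i r IH] FP.
  by exists (fun _ => 1); split=> //; [apply: polyf_const | exists 0; apply: oner_neq0].
have [|f [fP [u fu] fF]] := IH; first by move=> j jr; apply: FP; rewrite inE jr orbT.
have [iP [u' iu']] := FP i (mem_head _ _).
exists (fun u => F i u * f u); split; first exact: polyfM.
  by have [v [? ?]] := polyf_domain iP fP iu' fu; exists v; rewrite mulf_neq0.
move=> v; rewrite mulf_eq0 negb_or => /andP[iv fv] j; rewrite inE => /orP[/eqP->//|].
exact: fF.
Qed.

Lemma mpoly_ring_ind n (P : {mpoly K[n]} -> Prop) :
  (forall c, P c%:MP) -> (forall i, P 'X_i) ->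
  (forall p q, P p -> P q -> P (p + q)) ->
  (forall p q, P p -> P q -> P (p * q)) -> forall p, P p.
Proof.
move=> PC PX PD PM p; rewrite [p]mpolyE.
elim/big_ind: _ => [|p1 p2|m _]; [by rewrite -mpolyC0 | exact: PD |].
rewrite -mul_mpolyC; apply: (PM) => //; rewrite mpolyXE_id.
elim/big_ind: _ => [|p1 p2|i _]; [by rewrite -mpolyC1 | exact: PM |].
elim: (m i) => [|k IH]; first by rewrite expr0 -mpolyC1.
by rewrite exprS; apply: PM.
Qed.

Lemma mmap_chain n (p : {mpoly K[n]}) (c : 'I_n -> {poly K}) :
  (mmap polyC c p)^`() = \sum_i mmap polyC c p^`M(i) * (c i)^`().
Proof.
elim/mpoly_ring_ind: p => [a|i|p q IHp IHq|p q IHp IHq].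
- rewrite mmapC derivC big1 // => i _; by rewrite mderivC mmap0 mul0r.
- rewrite (bigD1 i) //= mmapX mmap1U mderivX mnm1E eqxx.
  have -> : (U_(i) - U_(i))%MM = 0%MM :> 'X_{1..n}.
    by apply/mnmP => j; rewrite mnmBE mnm0E subnn.
  rewrite scale1r mmapX mmap11 mul1r big1 ?addr0 // => j ji.
  by rewrite mderivX mnm1E eq_sym (negPf ji) scale0r mmap0 mul0r.
- rewrite mmapD derivD IHp IHq -big_split /=; apply: eq_bigr => i _.
  by rewrite mderivD mmapD mulrDl.
- rewrite rmorphM derivM IHp IHq /= mulr_suml mulr_sumr -big_split /=.
  apply: eq_bigr => i _; rewrite mderivM mmapD !rmorphM /= mulrDl.
  by congr (_ + _); ring.
Qed.

Lemma msize_mderiv n (p : {mpoly K[n]}) i : (msize p^`M(i) <= (msize p).-1)%N.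
Proof.
rewrite msizeE; apply/bigmax_leqP_seq => m mp _.
have : (m + U_(i))%MM \in msupp p.
  rewrite mcoeff_msupp; apply: contraTneq mp => e.
  by rewrite mcoeff_msupp mcoeff_deriv e mul0rn eqxx.
by move/msize_mdeg_lt; rewrite mdegD mdeg1; lia.
Qed.

(** The coefficient of [m - U_(i)] in the i-th derivative is [m i] times that of [m], and a nonzero
    [m i] is invertible in characteristic zero. *)
Lemma mpoly_deriv_const n (p : {mpoly K[n]}) :
  (forall i, p^`M(i) = 0) -> p = (p@_0)%:MP.
Proof.
move=> p0; apply/mpolyP => m; rewrite mcoeffC.
have [->|m0] := eqVneq m 0%MM; first by rewrite mulr1.
rewrite mulr0; have [i mi] : exists i, m i != 0%N.
  apply: contrapT => h; move/eqP: m0; apply; apply/mnmP => i; rewrite mnm0E.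
  by apply: contrapT => /eqP mi; apply: h; exists i.
have := congr1 (mcoeff (m - U_(i))%MM) (p0 i).
rewrite mcoeff0 mcoeff_deriv submK ?lep1mP // => /eqP.
by rewrite mulrn_eq0 /= => /eqP.
Qed.

(* The last argument is a polynomial curve through [u] with tangent [z]. *)
Definition is_dderiv U (f : U -> K) (z : U) (g : U -> K) : Prop :=
  forall (c : K -> U) (C : 'I_(dim U) -> {poly K}) (P : {poly K}),
    (forall t i, v2r (c t) 0 i = (C i).[t]) ->
    (forall t, f (c t) = P.[t]) ->
    (forall i, (C i)^`().[0] = v2r z 0 i) -> P^`().[0] = g (c 0).

Lemma horner_inj (p q : {poly K}) : (forall t, p.[t] = q.[t]) -> p = q.
Proof.
move=> pq; apply/eqP; rewrite -subr_eq0; apply: contraT => /poly_nonroot[t].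
by rewrite hornerD hornerN pq subrr eqxx.
Qed.

Lemma polyd_dderiv U d (f : U -> K) z : polyd d.+1 f ->
  exists2 g, polyd d g & is_dderiv f z g.
Proof.
move=> [p sp fp].
exists (fun u => \sum_i v2r z 0 i * (p^`M(i)).@[v2r u 0]).
  apply: polyd_sum => i; apply: polydZ; exists p^`M(i) => //.
  by rewrite (leq_trans (msize_mderiv _ _)) //; lia.
move=> c C P cC fP Cz.
have -> : P = mmap polyC C p.
  by apply: horner_inj => t; rewrite mmap_line -fP fp; apply: meval_eq => i.
rewrite mmap_chain horner_sum; apply: eq_bigr => i _.
rewrite hornerM Cz mulrC; congr (_ * _).
by rewrite mmap_line; apply: meval_eq => j; rewrite cC.
Qed.

Lemma is_dderiv_line U (f : U -> K) z g u (P : {poly K}) : is_dderiv f z g ->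
  (forall t, f (u + t *: z) = P.[t]) -> forall t, P^`().[t] = g (u + t *: z).
Proof.
move=> fg fP t.
pose C i := (v2r (u + t *: z) 0 i)%:P + (v2r z 0 i) *: 'X.
(* Shift the parameter: the derivative at [t] becomes one at 0, where [is_dderiv] applies. *)
have := fg (fun s => u + t *: z + s *: z) C (P \Po ('X + t%:P)).
rewrite scale0r addr0 deriv_comp derivD derivX derivC addr0 mulr1.
rewrite horner_comp !hornerE => -> //.
- by move=> s i; rewrite linearD linearZ !mxE /C !hornerE mulrC.
- move=> s; rewrite horner_comp !hornerE -fP; congr f.
  by rewrite -addrA -scalerDl addrC [t + s]addrC addrC.
- by move=> i; rewrite /C derivD derivC derivZ derivX !hornerE.
Qed.

Lemma deriv0_const (P : {poly K}) : (forall t, P^`().[t] = 0) -> forall t, P.[t] = P.[0].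
Proof.
move=> P0 t; have dP : P^`() = 0.
  by apply: horner_inj => s; rewrite P0 horner0.
have /size1_polyC -> : (size P <= 1)%N.
  apply/leq_sizeP => -[//|i] _; have := coef_deriv P i.
  by rewrite dP coef0 => /eqP; rewrite eq_sym mulrn_eq0 /= => /eqP.
by rewrite !hornerC.
Qed.

(* Induction on the degree through directional derivatives. *)
Lemma polyf_vanish_ind U (E : U -> Prop) : (exists u, E u) ->
  (forall d (f : U -> K), polyd d f -> (forall u, E u -> f u = 0) ->
     forall z g, is_dderiv f z g -> polyf g -> forall u, E u -> g u = 0) ->
  forall f : U -> K, polyf f -> (forall u, E u -> f u = 0) -> forall u, f u = 0.
Proof.
move=> [u0 Eu0] step f [d fP]; elim: d f fP => [|d IH] f fP f0.
  case: fP => p sp fp u; rewrite -(f0 u0 Eu0) !fp.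
  by rewrite (msize1_polyC sp) !mevalC.
move=> u; have [P fPl] := polyf_line u0 (u - u0) (polyd_polyf fP).
have [g gP fg] := polyd_dderiv (u - u0) fP.
have g0 : forall u, g u = 0.
  by apply: IH (gP) _; apply: step (fP) f0 _ _ fg (polyd_polyf gP).
have -> : u = u0 + 1 *: (u - u0) by rewrite scale1r addrC subrK.
rewrite fPl deriv0_const; last by move=> t; rewrite (is_dderiv_line fg fPl) g0.
by rewrite -fPl scale0r addr0 f0.
Qed.

(** Induction on the degree: the partial derivatives vanish as functions, hence as polynomials, so
    [p] is a constant, and its value is 0. *)
Lemma mpoly_fun0 n (p : {mpoly K[n]}) : (forall v : 'rV[K]_n, p.@[v 0] = 0) -> p = 0.
Proof.
have [d] := ubnP (msize p); elim: d p => // d IH p sp p0.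
have dp i : p^`M(i) = 0.
  have [->|pn0] := eqVneq p 0; first by rewrite mderiv0.
  apply: IH => [|v].
    have := msize_mderiv p i; have : msize p != 0%N by rewrite msize_poly_eq0.
    by lia.
  pose c j := (v 0 j)%:P + (i == j)%:R *: 'X : {poly K}.
  have e0 : mmap polyC c p = 0.
    apply: horner_inj => t; rewrite horner0 mmap_line.
    rewrite -[RHS](p0 (\row_j (c j).[t])); apply: meval_eq => j.
    by rewrite mxE.
  have := mmap_chain p c; rewrite e0 deriv0 => /(congr1 (horner^~ 0)).
  rewrite horner0 horner_sum (bigD1 i) //= big1 ?addr0.
    rewrite /c derivD derivC derivZ derivX eqxx !hornerE mmap_line => e.
    rewrite [RHS]e; change ((p^`M(i)).@[v 0] = (p^`M(i)).@[fun k => (c k).[0]] * 1 * 1).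
    by rewrite !mulr1; apply: meval_eq => j; rewrite /c !hornerE ?mulr0 ?addr0.
  move=> j ji; rewrite /c derivD derivC derivZ derivX eq_sym (negPf ji) add0r.
  by rewrite (_ : false%:R = 0 :> K) // scale0r mulr0 horner0.
have e := mpoly_deriv_const dp; have := p0 0; rewrite e mevalC => ->.
by rewrite mpolyC0.
Qed.

Lemma r2vE U (v : 'rV[K]_(dim U)) : v2r (r2v v) = v. Proof. exact: r2vK. Qed.

Definition indep U (E : U -> Prop) (I : finType) (F : I -> U -> K) : Prop :=
  forall c : I -> K, (forall u, E u -> \sum_i c i * F i u = 0) -> forall i, c i = 0.

(** A polynomial of degree at most k has all its exponents at most k, so it lies in a space of
    dimension [k.+1 ^ dim U]; the coefficient matrix of a larger family has a nonzero left kernel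
    vector. *)
Lemma indep_card U (I : finType) (F : I -> U -> K) k :
  (forall i, polyd k (F i)) -> indep (fun _ => True) F ->
  (#|I| <= k.+1 ^ dim U)%N.
Proof.
move=> FP Fi; rewrite leqNgt; apply/negP => lt.
have {}FP i : {p : {mpoly K[dim U]} | (msize p <= k.+1)%N & forall u, F i u = p.@[v2r u 0]}.
  exact: cid2 (FP i).
pose p i := s2val (FP i).
have sp i : (msize (p i) <= k.+1)%N := s2valP (FP i).
have fp i : forall u, F i u = (p i).@[v2r u 0] := s2valP' (FP i).
pose T := {ffun 'I_(dim U) -> 'I_k.+1}.
pose mon (t : T) : 'X_{1..dim U} := [multinom (t j : nat) | j < dim U].
pose C := \matrix_(i < #|I|, t < #|T|) (p (enum_val i))@_(mon (enum_val t)).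
have /rowV0Pn[c cC c0] : kermx C != 0.
  rewrite kermx_eq0 -row_leq_rank -ltnNge (leq_ltn_trans (rank_leq_col C)) //.
  by rewrite card_ffun !card_ord.
have {}cC : c *m C = 0 by apply/sub_kermxP.
have q0 : \sum_i (c 0 i)%:MP * p (enum_val i) = 0.
  apply/mpolyP => m; rewrite mcoeff0 raddf_sum /=.
  have [mk|] := boolP [forall j, m j <= k]%N.
    pose t : T := [ffun j => inord (m j)].
    have mE : m = mon t.
      by apply/mnmP => j; rewrite mnmE ffunE inordK // ltnS (forallP mk).
    have := congr1 (fun M : 'rV_(#|T|) => M 0 (enum_rank t)) cC.
    rewrite !mxE => e; rewrite -[RHS]e; apply: eq_bigr => i _.
    by rewrite !mxE enum_rankK -mE mcoeffCM.
  rewrite negb_forall => /existsP[j]; rewrite -ltnNge => jk.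
  apply: big1 => i _; rewrite mcoeffCM memN_msupp_eq0 ?mulr0 //.
  apply: msize_mdeg_ge; apply: leq_trans (sp _) _; apply: leq_trans jk _.
  by rewrite mdegE (bigD1 j) //= leq_addr.
move/eqP: c0; apply; apply/rowP => i; rewrite mxE.
have := Fi (fun i => c 0 (enum_rank i)) _ (enum_val i); rewrite enum_valK.
apply=> u _; have := congr1 (meval (v2r u 0)) q0.
rewrite meval0 raddf_sum /= => e; rewrite -[RHS]e.
rewrite (reindex (@enum_val _ (mem I))) /=; last first.
  by exists enum_rank => x _; rewrite (enum_valK, enum_rankK).
by apply: eq_bigr => j _; rewrite enum_valK fp mevalM mevalC.
Qed.

Lemma indep_monomials U k :
  indep (fun _ : U => True)
    (fun (a : {ffun 'I_(dim U) -> 'I_k}) u => \prod_i v2r u 0 i ^+ a i).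
Proof.
move=> c c0; pose mon (t : {ffun 'I_(dim U) -> 'I_k}) : 'X_{1..dim U} :=
  [multinom (t j : nat) | j < dim U].
have mon_inj : injective mon.
  move=> s t /mnmP e; apply/ffunP => j; apply/val_inj.
  by have := e j; rewrite !mnmE.
have p0 : \sum_a (c a)%:MP * 'X_[mon a] = 0 :> {mpoly K[dim U]}.
  apply: mpoly_fun0 => v; rewrite raddf_sum /= -[RHS](c0 (r2v v) I).
  apply: eq_bigr => a _; rewrite mevalM mevalC mevalX; congr (_ * _).
  by apply: eq_bigr => i _; rewrite mnmE r2vE.
move=> a; have := congr1 (mcoeff (mon a)) p0.
rewrite mcoeff0 raddf_sum /= (bigD1 a) //= big1 ?addr0.
  by rewrite mcoeffCM mcoeffX eqxx mulr1.
by move=> b ba; rewrite mcoeffCM mcoeffX (inj_eq mon_inj) (negPf ba) mulr0.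
Qed.

Lemma growth_leq (a b D : nat) :
  (forall k, k ^ a <= (D * k).+1 ^ b)%N -> (a <= b)%N.
Proof.
move=> h; rewrite leqNgt; apply/negP => ba.
(* Take k = (D + 1)^b + 1: then k^(b + 1) <= k^a <= ((D + 1) k)^b would give k <= (D + 1)^b. *)
have h1 : ((D.+1 ^ b).+1 ^ b.+1 <= (D * (D.+1 ^ b).+1).+1 ^ b)%N.
  apply: leq_trans (h _); rewrite leq_exp2l //; last by rewrite ltnS expn_gt0.
have h2 : ((D * (D.+1 ^ b).+1).+1 ^ b <= (D.+1 * (D.+1 ^ b).+1) ^ b)%N.
  case: (b) => [|b'] //; rewrite leq_exp2r // mulSn -addn1 addnC.
  by rewrite leq_add2r.
have := leq_trans h1 h2; rewrite expnMn expnS leq_pmul2r ?expn_gt0 //.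
by rewrite ltnn.
Qed.

(** Pulled back along a dominant map, the [k ^ dim U2] monomials with exponents below k stay
    independent and have degree O(k) on [U1]; compare growth. *)
Lemma dominant_dim U1 U2 d (g : U1 -> U2) : polymap d g ->
  (forall f : U2 -> K, polyf f -> (forall u, f (g u) = 0) -> forall u, f u = 0) ->
  (dim U2 <= dim U1)%N.
Proof.
move=> gP gD; apply: (@growth_leq _ _ (dim U2 * d)%N) => k.
have mP (a : {ffun 'I_(dim U2) -> 'I_k}) :
    polyd (dim U2 * k)%N (fun u : U2 => \prod_i v2r u 0 i ^+ a i).
  apply: (@polyd_le _ (\sum_i (1 * a i))%N).
    rewrite -[X in (_ <= X * _)%N](card_ord (dim U2)) -sum_nat_const leq_sum // => i _.
    by rewrite mul1n ltnW.
  by apply: polyd_prod => i; apply: polyd_exp; apply: polyd_coord.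
have mgP (a : {ffun 'I_(dim U2) -> 'I_k}) :
    polyd (dim U2 * d * k)%N (fun u => \prod_i v2r (g u) 0 i ^+ a i).
  by rewrite mulnAC; apply: polyd_comp (mP a) gP.
have := indep_card mgP; rewrite card_ffun !card_ord; apply.
move=> c c0; apply: (@indep_monomials U2 k c) => u _; move: u.
apply: gD => [|u]; last exact: c0.
exists (dim U2 * k)%N; apply: polyd_sum => a; apply: polydZ; exact: mP.
Qed.

End PolynomialFunctions.

(** * Semicontinuity of rank *)

Section OpenConditions.
Context {K : numFieldType}.
Implicit Types U : vectType K.

Definition freef U (I : finType) (g : I -> U) : Prop :=
  forall k : I -> K, \sum_i k i *: g i = 0 -> forall i, k i = 0.

Lemma freef_free U r (g : 'I_r -> U) :
  freef g <-> free [tuple g i | i < r].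
Proof.
have e (k : 'I_r -> K) : \sum_i k i *: [tuple g i | i < r]`_i = \sum_i k i *: g i.
  by apply: eq_bigr => i _; rewrite -tnth_nth tnth_mktuple.
split=> [fg|/freeP fg k k0]; last by apply: fg; rewrite e.
by apply/freeP => k; rewrite e; apply: fg.
Qed.

Lemma freef_dim U r (g : 'I_r -> U) (A : {vspace U}) :
  freef g -> (forall i, g i \in A) -> (r <= \dim A)%N.
Proof.
move=> /freef_free; rewrite /free => /eqP fg gA.
have -> : r = \dim <<[tuple g i | i < r]>>.
  by rewrite fg size_tuple.
apply: dimvS; apply/span_subvP => v /tnthP[i ->].
by rewrite tnth_mktuple.
Qed.

Lemma unit_minor_row_free r n (G : 'M[K]_(r, n)) (f : 'I_r -> 'I_n) :
  \det (colsub f G) != 0 -> row_free G.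
Proof.
rewrite -unitfE => uG; apply/row_freeP.
exists (colsub f 1%:M *m invmx (colsub f G)).
by rewrite mulmxA mulmx_colsub mulmx1 mulmxV // unitmxE.
Qed.

Lemma row_free_unit_minor r n (G : 'M[K]_(r, n)) : row_free G ->
  exists f : 'I_r -> 'I_n, \det (colsub f G) != 0.
Proof.
move=> fG; have fGT : row_full G^T by rewrite /row_full mxrank_tr.
exists (fullrankfun fGT); rewrite -unitfE -unitmxE -unitmx_tr trmx_mxsub.
exact: fullrowsub_unit.
Qed.

Lemma freef_row_free U r (g : 'I_r -> U) :
  freef g <-> row_free (\matrix_(i < r) v2r (g i)).
Proof.
set G := \matrix_(i < r) _.
have e (c : 'rV_r) : c *m G = v2r (\sum_i c 0 i *: g i).
  rewrite linear_sum mulmx_sum_row; apply: eq_bigr => i _.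
  by rewrite linearZ rowK.
split=> [fg|fG k k0 i].
  apply: inj_row_free => c cG; apply/rowP => i; rewrite mxE.
  by move: i; apply: fg; apply: v2r_inj; rewrite linear0 -e.
suff : \row_i k i = 0 by move/rowP => /(_ i); rewrite !mxE.
apply: (row_free_inj fG); rewrite /= mul0mx e.
under eq_bigr do rewrite mxE.
by rewrite k0 linear0.
Qed.

(** Independence is witnessed by a nonzero maximal minor, which is polynomial in [u]. *)
Lemma freef_open U1 U2 d r (g : U1 -> 'I_r -> U2) u0 :
  (forall i, polymap d (g^~ i)) -> freef (g u0) ->
  exists f, [/\ polyf f, f u0 != 0 & forall u, f u != 0 -> freef (g u)].
Proof.
move=> gP /freef_row_free /row_free_unit_minor[s s0].
exists (fun u => \det (colsub s (\matrix_(i < r) v2r (g u i)))); split=> // [|u].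
  exists (r * d)%N; apply: polyd_det => i j.
  by apply: (polyd_eq (gP i (s j))) => u; rewrite !mxE.
by move/unit_minor_row_free => h; apply/freef_row_free.
Qed.

Lemma limg_freef U1 U2 (f : 'Hom(U1, U2)) (A : {vspace U1}) :
  exists x : 'I_(\dim (f @: A)) -> U1,
    (forall i, x i \in A) /\ freef (fun i => f (x i)).
Proof.
pose b := vbasis (f @: A).
have bx i : {x | x \in A & tnth b i = f x}.
  by apply: cid2; apply/memv_imgP/vbasis_mem/mem_tnth.
exists (fun i => s2val (bx i)); split=> [i|]; first exact: s2valP (bx i).
apply/freef_free; rewrite (_ : mktuple _ = b) ?(basis_free (vbasisP _)) //.
by apply: eq_from_tnth => i; rewrite tnth_mktuple -(s2valP' (bx i)).
Qed.

Lemma dim_limg_open U U1 U2 d (L : U -> 'Hom(U1, U2)) (A : {vspace U1}) u0 :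
  (forall x, polymap d (fun u => L u x)) ->
  exists f, [/\ polyf f, f u0 != 0 &
    forall u, f u != 0 -> (\dim (L u0 @: A) <= \dim (L u @: A))%N].
Proof.
move=> LP; have [x [xA xf]] := limg_freef (L u0) A.
have [f [fP f0 fF]] := freef_open (g := fun u i => L u (x i)) (fun i => LP (x i)) xf.
exists f; split=> // u /fF xfu; apply: freef_dim xfu _ => i.
exact: memv_img.
Qed.

Lemma polymap_affine U1 (a b : U1) : polymap 1 (fun t : K^o => a + t *: b).
Proof.
move=> i; apply: (@polyd_ext _ _ _ (fun t : K^o => v2r a 0 i + v2r b 0 i * t)).
  by move=> t; rewrite linearD linearZ !mxE mulrC.
apply: polydD; first exact: polyd_const.
by apply: polydZ; apply: polyd_lin => c u v.
Qed.

(* If the rank of [L + t L'] on [A] is maximal at [t = 0], then [L' X] for a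
   null vector [X] of [L] cannot leave the image: otherwise
   [(L + t L') (X / t) = L' X] would raise the rank for small [t]. *)
Lemma rank_max_first_order U1 U2 (L L' : 'Hom(U1, U2)) (A : {vspace U1}) x0 :
  (forall t, \dim ((L + t *: L') @: A) <= \dim (L @: A))%N ->
  x0 \in A -> L x0 = 0 -> L' x0 \in (L @: A)%VS.
Proof.
move=> maxL x0A Lx0; apply: contraT => nim.
have [x [xA xf]] := limg_freef L A; set r := \dim (L @: A) in maxL x xA xf.
(* Index 0 carries the null vector, whose image will be rescaled by 1/t; the other vectors lift a
   basis of the image of [L]. *)
pose y (o : 'I_r.+1) := if unlift ord0 o is Some i then x i else x0.
pose g (t : K^o) (o : 'I_r.+1) :=
  (if o == ord0 then L' x0 else L (y o)) + t *: (if o == ord0 then 0 else L' (y o)).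
have gP o : polymap 1 (g^~ o) by apply: polymap_affine.
have g0 : freef (g 0).
  move=> k; rewrite big_ord_recl /g eqxx scale0r addr0.
  under eq_bigr => i _ do rewrite eq_sym (negPf (neq_lift _ _)) scale0r addr0 /y liftK.
  move=> k0; have k00 : k ord0 = 0.
    apply: contraNeq nim => k00.
    have -> : L' x0 = - (k ord0)^-1 *: \sum_(i < r) k (lift ord0 i) *: L (x i).
      move/eqP: k0; rewrite addr_eq0 => /eqP e.
      by rewrite scaleNr -scalerN -e scalerA mulVf ?scale1r.
    by apply: memvZ; apply: memv_suml => i _; apply: memvZ; apply: memv_img.
  move: k0; rewrite k00 scale0r add0r => /(xf (fun i => k (lift ord0 i))) k1 o.
  by case: (unliftP ord0 o) => [i ->|->].
have [f [fP f0 fF]] := freef_open gP g0.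
have idP : polyf (id : K^o -> K) by apply: polyf_lin.
have [t [ft t0]] := polyf_domain fP idP f0 (oner_neq0 K : id (1 : K^o) != 0).
have := maxL t; suff : (r < \dim ((L + t *: L') @: A))%N by rewrite ltnNge => /negP.
apply: (freef_dim (fF t ft)) => o.
have LtE z : (L + t *: L') z = L z + t *: L' z by rewrite add_lfunE scale_lfunE.
rewrite /g; case: (unliftP ord0 o) => [i ->|->].
  rewrite eq_sym (negPf (neq_lift _ _)) /y liftK -LtE; exact: memv_img.
rewrite eqxx scaler0 addr0.
have -> : L' x0 = t^-1 *: (L + t *: L') x0.
  by rewrite LtE Lx0 add0r scalerA mulVf ?scale1r.
by apply: memvZ; apply: memv_img.
Qed.

End OpenConditions.

(** * Coordinate subspaces *)

Section Masks.
Context {K : numFieldType} (U : vectType K) (T : finType).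
Variables (crd : T -> U -> K) (bas : T -> U).
Hypothesis crd_lin : forall t a u v, crd t (a *: u + v) = a * crd t u + crd t v.
Hypothesis crd_bas : forall s t, crd s (bas t) = (s == t)%:R.
Hypothesis crdE : forall u, u = \sum_t crd t u *: bas t.

Definition maskv (P : pred T) : {vspace U} := <<[tuple bas (@enum_val _ P i) | i < #|P|]>>%VS.

Let crd_sum t I (r : seq I) (F : I -> U) :
  crd t (\sum_(i <- r) F i) = \sum_(i <- r) crd t (F i).
Proof.
have c0 : crd t 0 = 0.
  by have := crd_lin t (-1) 0 0; rewrite scaler0 addr0 mulN1r addNr.
elim: r => [|i r IH]; first by rewrite !big_nil.
by rewrite !big_cons -IH -[F i in LHS]scale1r crd_lin mul1r.
Qed.

Let crdZ t a u : crd t (a *: u) = a * crd t u.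
Proof.
have c0 : crd t 0 = 0.
  by have := crd_lin t (-1) 0 0; rewrite scaler0 addr0 mulN1r addNr.
by rewrite -[a *: u]addr0 crd_lin c0 addr0.
Qed.

Lemma mem_maskv P u : u \in maskv P <-> (forall t, ~~ P t -> crd t u = 0).
Proof.
split=> [/coord_span -> t Pt|u0].
  rewrite crd_sum big1 // => i _; rewrite crdZ -tnth_nth tnth_mktuple crd_bas.
  case: eqP => [tE|_]; last by rewrite mulr0.
  by case/negP: Pt; rewrite tE; apply: enum_valP.
rewrite [u]crdE; apply: memv_suml => t _.
case: (boolP (P t)) => [Pt|/u0 ->]; last by rewrite scale0r mem0v.
apply: memvZ; apply: memv_span; have tP : t \in P by [].
apply/tnthP; exists (enum_rank_in tP t).
by rewrite tnth_mktuple enum_rankK_in.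
Qed.

Lemma dim_maskv P : \dim (maskv P) = #|P|.
Proof.
have /freef_free /eqP -> : freef (fun i : 'I_(#|P|) => bas (@enum_val _ P i)).
  move=> k k0 i; have := congr1 (crd (enum_val i)) k0.
  rewrite crd_sum (bigD1 i) //= crdZ crd_bas eqxx mulr1 big1 ?addr0.
    by move->; have := crdZ (enum_val i) 0 0; rewrite scale0r mul0r.
  move=> j ji; rewrite crdZ crd_bas (inj_eq enum_val_inj) eq_sym (negPf ji).
  by rewrite mulr0.
by rewrite size_tuple.
Qed.

End Masks.

(** * Representations in coordinates: stability, density and the map delta *)

Section Model.
Context {K : numFieldType} {Q : quiver} {m : nat}.
Variables (col : 'I_m -> vertex Q) (ht : 'I_m -> nat).
Implicit Types (A B S T : {set 'I_m}) (X : 'M[K]_m).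
Local Notation repr := {ffun arrow Q -> 'M[K]_m}.
Implicit Types w u : repr.

Definition pj A : 'M[K]_m := \matrix_(i, j) ((i == j) && (i \in A))%:R.

Lemma pjlE A n (M : 'M_(m, n)) i j : (pj A *m M) i j = (i \in A)%:R * M i j.
Proof.
rewrite mxE (bigD1 i) //= mxE eqxx /= big1 ?addr0 // => k ki.
by rewrite mxE eq_sym (negPf ki) mul0r.
Qed.

Lemma pjrE A n (M : 'M_(n, m)) i j : (M *m pj A) i j = M i j * (j \in A)%:R.
Proof.
rewrite mxE (bigD1 j) //= mxE eqxx /= big1 ?addr0 // => k kj.
by rewrite mxE (negPf kj) mulr0.
Qed.

Lemma pjI A B : pj A *m pj B = pj (A :&: B).
Proof.
apply/matrixP => i j; rewrite pjlE !mxE inE.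
by case: eqVneq => [->|_]; rewrite ?mulr0 // -natrM mulnb.
Qed.

Lemma pj_sub A B : A \subset B -> pj A *m pj B = pj A.
Proof. by move=> AB; rewrite pjI (setIidPl AB). Qed.

Lemma pj_subr A B : A \subset B -> pj B *m pj A = pj A.
Proof. by move=> AB; rewrite pjI (setIidPr AB). Qed.

Lemma pj0 : pj set0 = 0.
Proof. by apply/matrixP => i j; rewrite !mxE inE andbF. Qed.

Lemma pj_disj A B : [disjoint A & B] -> pj A *m pj B = 0.
Proof. by rewrite pjI => /disjoint_setI0 ->; rewrite pj0. Qed.

Lemma pjU A B : [disjoint A & B] -> pj (A :|: B) = pj A + pj B.
Proof.
move=> dAB; apply/matrixP => i j; rewrite !mxE inE.
have := disjointFr dAB (x := i).
by case: eqP; case: (i \in A); case: (i \in B) => //= _ h;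
   rewrite ?addr0 ?add0r //; have := h isT.
Qed.

Lemma pjD A B : A \subset B -> pj B = pj A + pj (B :\: A).
Proof.
move=> AB; rewrite -pjU ?setDE; last by rewrite -setDE disjoints_subset setCD subsetUr.
by rewrite -setDE -{1}(setID B A) setUC (setIidPr AB) setUC.
Qed.

Definition ev x : 'M[K]_m := pj [set i | col i == x].

(** A representation is stored as arbitrary square matrices, so that all of them share one vector
    space; only the block from the colour of the source to that of the target is meaningful. *)
Definition rp w a : 'M[K]_m :=
  \matrix_(i, j) (((col i == source a) && (col j == target a))%:R * w a i j).

Lemma rpE w a : rp w a = ev (source a) *m w a *m ev (target a).
Proof. by apply/matrixP => i j; rewrite pjrE pjlE !mxE !inE -mulnb natrM mulrAC. Qed.

Lemma rp_ev w a : ev (source a) *m rp w a *m ev (target a) = rp w a.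
Proof. by rewrite rpE !mulmxA pjI setIid -mulmxA pjI setIid. Qed.

(* Let [K^A] be the span of the basis vectors with index in [A], graded by [col]
   and filtered by [ht]. Acting on row vectors, the elements of [Rv A B] are the
   graded maps from [K^A] to [K^B] that preserve the filtrations, and those of
   [Hv A B] are the representations H_Q(K^A, K^B). *)
Definition Rm A B : pred ('I_m * 'I_m) :=
  fun ij => [&& ij.1 \in A, ij.2 \in B, col ij.1 == col ij.2 & (ht ij.2 <= ht ij.1)%N].

Definition Hm A B : pred (arrow Q * ('I_m * 'I_m)) := fun x =>
  [&& x.2.1 \in A, x.2.2 \in B, col x.2.1 == source x.1 & col x.2.2 == target x.1].

Definition Rv A B : {vspace 'M[K]_m} :=
  maskv (fun ij => delta_mx ij.1 ij.2) (Rm A B).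

Definition Mv (P : pred (arrow Q * ('I_m * 'I_m))) : {vspace repr} :=
  maskv (fun x => [ffun a => if a == x.1 then delta_mx x.2.1 x.2.2 else 0] : repr) P.

Definition Hv A B := Mv (Hm A B).

Lemma mem_Rv A B X : X \in Rv A B <-> (forall i j, X i j != 0 -> Rm A B (i, j)).
Proof.
have h : X \in Rv A B <-> (forall ij, ~~ Rm A B ij -> X ij.1 ij.2 = 0).
  apply: (@mem_maskv _ _ _ (fun ij (X : 'M[K]_m) => X ij.1 ij.2)).
  - by move=> t a u v; rewrite !mxE.
  - by move=> [i j] [k l] /=; rewrite !mxE xpair_eqE.
  by move=> u; rewrite {1}[u]matrix_sum_delta pair_bigA.
rewrite h; split=> [X0 i j|X0 [i j] /= nR].
  by apply: contraNT => /X0 /= ->.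
by apply/eqP; apply: contraNT nR; apply: X0.
Qed.

Lemma dim_Rv A B : \dim (Rv A B) = #|Rm A B|.
Proof.
apply: (@dim_maskv _ _ _ (fun ij (X : 'M[K]_m) => X ij.1 ij.2)).
  by move=> t a u v; rewrite !mxE.
by move=> [i j] [k l] /=; rewrite !mxE xpair_eqE.
Qed.

Let Ycrd (x : arrow Q * ('I_m * 'I_m)) w := w x.1 x.2.1 x.2.2.
Let Ybas (x : arrow Q * ('I_m * 'I_m)) : repr :=
  [ffun a => if a == x.1 then delta_mx x.2.1 x.2.2 else 0].
Let Ycrd_lin x a u w : Ycrd x (a *: u + w) = a * Ycrd x u + Ycrd x w.
Proof. by rewrite /Ycrd !ffunE !mxE. Qed.
Let Ycrd_bas x y : Ycrd x (Ybas y) = (x == y)%:R.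
Proof.
case: x y => [a [i j]] [b [k l]]; rewrite /Ycrd /Ybas !ffunE /= !xpair_eqE.
by case: eqP => _ /=; rewrite !mxE.
Qed.
Let YcrdE u : u = \sum_x Ycrd x u *: Ybas x.
Proof.
apply/ffunP => a; apply/matrixP => i j; rewrite sum_ffunE summxE.
rewrite (bigD1 (a, (i, j))) //= big1 ?addr0 => [|x ne].
  by rewrite !ffunE eqxx !mxE !eqxx mulr1.
have := Ycrd_bas (a, (i, j)) x; rewrite eq_sym (negPf ne) /Ycrd /= => e.
by rewrite !ffunE mxE; move: e; rewrite ffunE => ->; rewrite mulr0.
Qed.

Lemma mem_Mv P w : w \in Mv P <-> (forall x, ~~ P x -> w x.1 x.2.1 x.2.2 = 0).
Proof. exact: (mem_maskv Ycrd_lin Ycrd_bas YcrdE). Qed.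

Lemma dim_Mv P : \dim (Mv P) = #|P|.
Proof. exact: (dim_maskv Ycrd_lin Ycrd_bas). Qed.

Lemma mem_Hv A B w : w \in Hv A B <-> (forall a, rp w a = w a /\ pj A *m w a *m pj B = w a).
Proof.
rewrite mem_Mv; split=> [w0 a|h [a [i j]]] /=.
  split; apply/matrixP => i j; rewrite ?pjrE ?pjlE ?mxE; have := w0 (a, (i, j));
  rewrite /Hm /= => h.
    case: (col i =P source a) h => //= _ => [|->]; rewrite ?andbF ?mulr0 //.
    by case: (col j =P target a) => //= _ => [|->]; rewrite ?andbF ?mul1r ?mulr0.
  case: (i \in A) h => /= => [|->]; rewrite ?mulr0 ?mul0r //.
  by case: (j \in B) => /= => [|->]; rewrite ?mulr1 ?mul1r ?mulr0 ?mul0r.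
have [h1 h2] := h a; rewrite /Hm /=.
have e1 : (pj A *m w a *m pj B) i j = w a i j by rewrite h2.
have e2 : rp w a i j = w a i j by rewrite h1.
move: e1 e2; rewrite pjrE pjlE mxE.
case: (i \in A) => /= [|<-]; rewrite ?mul0r // mul1r.
case: (j \in B) => /= [_|<-]; rewrite ?mulr0 //.
by case: (_ == _); case: (_ == _) => //= <-; rewrite mul0r.
Qed.

Lemma Rv_l A B X : X \in Rv A B -> pj A *m X = X.
Proof.
move=> /mem_Rv XR; apply/matrixP => i j; rewrite pjlE.
have [->|/XR/and4P[/= -> _ _ _]] := eqVneq (X i j) 0; by rewrite ?mulr0 ?mul1r.
Qed.

Lemma Rv_r A B X : X \in Rv A B -> X *m pj B = X.
Proof.
move=> /mem_Rv XR; apply/matrixP => i j; rewrite pjrE.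
have [->|/XR/and4P[/= _ -> _ _]] := eqVneq (X i j) 0; by rewrite ?mul0r ?mulr1.
Qed.

Lemma Rv_ev A B X x : X \in Rv A B -> ev x *m X = X *m ev x.
Proof.
move=> /mem_Rv XR; apply/matrixP => i j; rewrite pjlE pjrE !inE.
have [->|/XR/and4P[/= _ _ /eqP-> _]] := eqVneq (X i j) 0; first by rewrite mulr0 mul0r.
by rewrite mulrC.
Qed.

Lemma pj_ev A x : ev x *m pj A = pj A *m ev x.
Proof. by rewrite !pjI setIC. Qed.

Lemma ev_block A B x y M :
  ev x *m (pj A *m M *m pj B) *m ev y = pj A *m (ev x *m M *m ev y) *m pj B.
Proof. by rewrite !mulmxA pj_ev -!mulmxA -pj_ev. Qed.

Lemma Rv_sub A B A' B' X : A \subset A' -> B \subset B' ->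
  X \in Rv A B -> X \in Rv A' B'.
Proof.
move=> /subsetP AA /subsetP BB /mem_Rv XR; apply/mem_Rv => i j /XR/and4P[/= iA jB c h].
by apply/and4P; split=> //=; [apply: AA | apply: BB].
Qed.

Lemma Rv_mul A B C X Z : X \in Rv A B -> Z \in Rv B C -> X *m Z \in Rv A C.
Proof.
move=> /mem_Rv XR /mem_Rv ZR; apply/mem_Rv => i j; rewrite mxE => s0.
have [k] : exists k, X i k * Z k j != 0.
  apply: contrapT => h; move/eqP: s0; apply; apply: big1 => k _.
  by apply/eqP; apply: contrapT => /negP h'; apply: h; exists k.
rewrite mulf_eq0 negb_or => /andP[/XR/and4P[/= iA _ /eqP c1 h1] /ZR/and4P[/= _ jC /eqP c2 h2]].
by apply/and4P; split=> //=; [rewrite c1 c2 | apply: leq_trans h2 h1].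
Qed.

Lemma Rv_pj A B A' B' X : X \in Rv A B -> pj A' *m X *m pj B' \in Rv (A :&: A') (B :&: B').
Proof.
move=> /mem_Rv XR; apply/mem_Rv => i j; rewrite pjrE pjlE !mulf_eq0 !negb_or.
case/andP=> /andP[iA' /XR/and4P[/= iA jB c h]] jB'.
move: iA' jB'; rewrite !pnatr_eq0 !eqb0 !negbK => iA' jB'.
by apply/and4P; split=> //=; rewrite inE ?iA ?jB.
Qed.

Lemma Rv_nil A B X : [disjoint A & B] -> X \in Rv A B -> X *m X = 0.
Proof.
move=> dAB XR; rewrite -{1}(Rv_r XR) -{2}(Rv_l XR) !mulmxA -[X *m _ *m _]mulmxA.
by rewrite pj_disj ?mulmx0 ?mul0mx // disjoint_sym.
Qed.

(** Conjugation by the unipotent element 1 + X, whose inverse is 1 - X because X has square zero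
    when its blocks are disjoint. *)
Definition cj X w : repr := [ffun a => (1%:M + X) *m w a *m (1%:M - X)].

Lemma cj_rp A B X w a : X \in Rv A B ->
  rp (cj X w) a = (1%:M + X) *m rp w a *m (1%:M - X).
Proof.
move=> XR; rewrite !rpE ffunE.
have evD x : ev x *m (1%:M + X) = (1%:M + X) *m ev x.
  by rewrite mulmxDl mulmxDr mulmx1 mul1mx (Rv_ev _ XR).
have evB x : (1%:M - X) *m ev x = ev x *m (1%:M - X).
  by rewrite mulmxBl mulmxBr mulmx1 mul1mx (Rv_ev _ XR).
by rewrite !mulmxA evD -!mulmxA evB.
Qed.

Lemma unip_mul A B X : [disjoint A & B] -> X \in Rv A B ->
  (1%:M + X) *m (1%:M - X) = 1%:M /\ (1%:M - X) *m (1%:M + X) = 1%:M.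
Proof.
move=> dAB XR; have XX := Rv_nil dAB XR.
rewrite !mulmxDl !mulmxDr !mulmxN !mulNmx !mulmx1 !mul1mx XX oppr0 !addr0.
by split; rewrite ?subrK ?addrK.
Qed.

Lemma cjK A B X w : [disjoint A & B] -> X \in Rv A B -> cj (- X) (cj X w) = w.
Proof.
move=> dAB XR; apply/ffunP => a; rewrite !ffunE opprK.
have [e1 e2] := unip_mul dAB XR.
by rewrite !mulmxA e2 mul1mx -mulmxA e2 mulmx1.
Qed.

Lemma cjNK A B X w : [disjoint A & B] -> X \in Rv A B -> cj X (cj (- X) w) = w.
Proof. by move=> dAB XR; rewrite -{1}[X]opprK (cjK _ dAB) // memvN. Qed.

(** With [B = A :\: T], this is stability of K^T under the compression of [u] to K^A. *)
Definition inP T B u := forall a, pj T *m rp u a *m pj B = 0.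

(* Some member [K^T (1 + X)] of the big cell in [K^A] is stable under [w]. *)
Definition cond T A w : Prop := exists2 X, X \in Rv T (A :\: T) &
  forall a, (pj T + X) *m rp w a *m (pj (A :\: T) - X) = 0.

Lemma disjD T A : [disjoint T & A :\: T].
Proof. by rewrite disjoints_subset setCD subsetUr. Qed.

(** [pj T + X] spans the member and [pj (A :\: T) - X] cuts it out. They equal pj T (1 + X) and (1 -
    X) pj (A - T), so the condition is about the conjugate of [w]. *)
Lemma cond_cj T A w X : X \in Rv T (A :\: T) ->
  (forall a, (pj T + X) *m rp w a *m (pj (A :\: T) - X) = 0) <->
  inP T (A :\: T) (cj X w).
Proof.
move=> XR; suff e a : (pj T + X) *m rp w a *m (pj (A :\: T) - X) =
    pj T *m rp (cj X w) a *m pj (A :\: T).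
  by split=> h a; have := h a; rewrite e.
rewrite (cj_rp _ _ XR) !mulmxA -[RHS]mulmxA.
by rewrite mulmxDr mulmx1 (Rv_l XR) mulmxBl mul1mx (Rv_r XR).
Qed.

(* The representations satisfying [cond T A] are Zariski dense. *)
Definition dense T A : Prop := forall f : repr -> K, polyf f ->
  (forall w, cond T A w -> f w = 0) -> forall w, f w = 0.

(** The delta of the overview, as a coboundary between two representations: for [X] in [Rv A B] only
    the diagonal blocks of [w] on K^A and on K^B enter. As matrices act on rows, [rp w a *m X]
    applies [w] first. *)
Definition dlt A B w X : repr :=
  [ffun a => pj A *m (rp w a *m X - X *m rp w a) *m pj B].

Lemma rp_lin a c u w : rp (c *: u + w) a = c *: rp u a + rp w a.
Proof. by rewrite !rpE !ffunE mulmxDr mulmxDl -scalemxAr -scalemxAl. Qed.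

Lemma dlt_linX A B w c X Z : dlt A B w (c *: X + Z) = c *: dlt A B w X + dlt A B w Z.
Proof.
apply/ffunP => a; rewrite !ffunE [rp _ _ *m _]mulmxDr [(_ + _) *m rp _ _]mulmxDl.
rewrite -scalemxAr -scalemxAl.
by rewrite opprD addrACA -scalerBr [in LHS]mulmxDr [in LHS]mulmxDl -scalemxAr -scalemxAl.
Qed.

Lemma dlt_linw A B c u w X : dlt A B (c *: u + w) X = c *: dlt A B u X + dlt A B w X.
Proof.
apply/ffunP => a; rewrite !ffunE rp_lin [(_ + _) *m X]mulmxDl [X *m _]mulmxDr.
rewrite -scalemxAr -scalemxAl.
by rewrite opprD addrACA -scalerBr [in LHS]mulmxDr [in LHS]mulmxDl -scalemxAr -scalemxAl.
Qed.

HB.instance Definition _ A B w := GRing.isLinear.Build K _ _ _ (dlt A B w)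
  (dlt_linX A B w).

Definition dl A B w : 'Hom('M[K]_m, repr) := linfun (dlt A B w).

Lemma dlE A B w X : dl A B w X = dlt A B w X. Proof. exact: lfunE. Qed.

Lemma dlt_Hv A B w X : X \in Rv A B -> dlt A B w X \in Hv A B.
Proof.
move=> XR; apply/mem_Hv => a; rewrite {1}rpE !ffunE; split; last first.
  by rewrite !mulmxA pjI setIid -mulmxA pjI setIid.
have e1 : ev (source a) *m (rp w a *m X) *m ev (target a) = rp w a *m X.
  by rewrite -!mulmxA -(Rv_ev _ XR) !mulmxA rp_ev.
have e2 : ev (source a) *m (X *m rp w a) *m ev (target a) = X *m rp w a.
  by rewrite !mulmxA (Rv_ev _ XR) -!mulmxA [ev _ *m (_ *m _)]mulmxA rp_ev.
set D := rp w a *m X - X *m rp w a.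
have eD : ev (source a) *m D *m ev (target a) = D by rewrite mulmxBr mulmxBl e1 e2.
by rewrite !mulmxA pj_ev -!mulmxA -pj_ev -[in RHS]eD !mulmxA.
Qed.

Lemma polymap_dl A B X : polymap 1 (fun w => dl A B w X).
Proof.
apply: polymapF => a i j; apply: polyd_lin => c u v.
by rewrite !dlE dlt_linw !ffunE !mxE.
Qed.

Definition rk A B w := \dim (dl A B w @: Rv A B).

Definition nowhere_surj A B : Prop := forall w, (rk A B w < #|Hm A B|)%N.

Lemma limg_dl_Hv A B w : (dl A B w @: Rv A B <= Hv A B)%VS.
Proof. by apply/subvP => _ /memv_imgP[X XR ->]; rewrite dlE; apply: dlt_Hv. Qed.

Lemma rk_surj A B w : (#|Hm A B| <= rk A B w)%N ->
  forall phi, phi \in Hv A B -> exists2 X, X \in Rv A B & phi = dlt A B w X.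
Proof.
move=> h phi phiH; have : (dl A B w @: Rv A B)%VS = Hv A B.
  by apply/eqP; rewrite eqEdim limg_dl_Hv dim_Mv.
move=> e; move: phiH; rewrite -e => /memv_imgP[X XR ->]; exists X => //.
exact: dlE.
Qed.

Lemma inj_rk A B w : (forall X, X \in Rv A B -> dlt A B w X = 0 -> X = 0) ->
  rk A B w = #|Rm A B|.
Proof.
move=> h; rewrite -dim_Rv; apply: limg_dim_eq; apply/eqP.
rewrite -subv0; apply/subvP => X; rewrite memv_cap memv_ker dlE => /andP[XR /eqP X0].
by rewrite memv0; apply/eqP; apply: h.
Qed.

Lemma rk_inj A B w : (#|Rm A B| <= rk A B w)%N ->
  forall X, X \in Rv A B -> dlt A B w X = 0 -> X = 0.
Proof.
move=> h X XR X0; have := limg_ker_dim (dl A B w) (Rv A B).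
rewrite -/(rk A B w) dim_Rv => e; have /eqP : \dim (Rv A B :&: lker (dl A B w)) = 0%N.
  by apply/eqP; rewrite -leqn0 -(leq_add2r (rk A B w)) e.
rewrite dimv_eq0 => /eqP k0; apply/eqP; rewrite -memv0 -k0 memv_cap XR.
by rewrite memv_ker dlE X0 eqxx.
Qed.

Lemma rk_le_Rm A B w : (rk A B w <= #|Rm A B|)%N.
Proof. by rewrite -dim_Rv /rk -(limg_ker_dim (dl A B w) (Rv A B)) leq_addl. Qed.

Lemma rk_open A B w0 : exists f : repr -> K, [/\ polyf f, f w0 != 0 &
  forall w, f w != 0 -> (rk A B w0 <= rk A B w)%N].
Proof. exact: dim_limg_open (polymap_dl A B). Qed.

(** The linear projection onto the representations satisfying [inP T B]; composing with it extends a
    polynomial function on that subspace to all representations. *)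
Definition trP T B : repr -> repr := fun u =>
  [ffun a => \matrix_(i, j) if Hm T B (a, (i, j)) then 0 else u a i j].

Lemma trPE T B u a i j : trP T B u a i j = if Hm T B (a, (i, j)) then 0 else u a i j.
Proof. by rewrite ffunE mxE. Qed.

Lemma inP_Hm T B u : inP T B u <-> (forall x, Hm T B x -> u x.1 x.2.1 x.2.2 = 0).
Proof.
split=> [h [a [i j]] /and4P[/= iT jB ci cj]|h a].
  have := congr1 (fun M : 'M_m => M i j) (h a).
  by rewrite pjrE pjlE !mxE iT jB ci cj /= mulr1 !mul1r.
apply/matrixP => i j; rewrite pjrE pjlE !mxE.
have := h (a, (i, j)); rewrite /Hm /=.
case: (i \in T) => //=; rewrite ?mul0r //; case: (j \in B); rewrite ?mulr0 //=.
case: (_ == _); rewrite ?mul0r ?mulr0 ?mul0r //=.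
by case: (_ == _) => /= [->|]; rewrite ?mul0r ?mulr0 ?mul0r.
Qed.

Lemma inP_trP T B u : inP T B (trP T B u).
Proof. by apply/inP_Hm => -[a [i j]] /= h; rewrite trPE h. Qed.

Lemma trP_id T B u : inP T B u -> trP T B u = u.
Proof.
move=> /inP_Hm h; apply/ffunP => a; apply/matrixP => i j; rewrite trPE.
by case: ifP => // /h /= ->.
Qed.

Lemma polymap_trP T B : polymap 1 (trP T B).
Proof.
apply: polymapF => a i j.
case H : (Hm T B (a, (i, j))); last first.
  by apply: polyd_lin => c u v; rewrite !trPE H !ffunE !mxE.
by apply: (polyd_eq (polyd_const 1 0)) => u; rewrite trPE H.
Qed.

Lemma polymap_cj X : polymap 1 (cj X).
Proof.
apply: polymapF => a i j; apply: polyd_lin => c u v.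
rewrite !ffunE (mulmxDr (1%:M + X)) (mulmxDl _ _ (1%:M - X)).
by rewrite -scalemxAr -scalemxAl !mxE.
Qed.

Lemma rp_trP_l T B S u a : [disjoint S & B] -> rp (trP T B u) a *m pj S = rp u a *m pj S.
Proof.
move=> dSB; apply/matrixP => i j; rewrite !pjrE [LHS]/= !mxE trPE /Hm /=.
case jS: (j \in S); rewrite ?mulr0 //; have -> /= := disjointFr dSB jS.
by rewrite andbF.
Qed.

Lemma rp_trP_r T B S u a : [disjoint S & T] -> pj S *m rp (trP T B u) a = pj S *m rp u a.
Proof.
move=> dST; apply/matrixP => i j; rewrite !pjlE [LHS]/= !mxE trPE /Hm /=.
by case iS: (i \in S); rewrite ?mul0r //; have -> /= := disjointFr dST iS.
Qed.

Lemma dlt_trP T B w X : [disjoint T & B] -> X \in Rv T B ->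
  dlt T B (trP T B w) X = dlt T B w X.
Proof.
move=> dTB XR; apply/ffunP => a; rewrite !ffunE; congr (_ *m _ *m _); congr (_ - _).
  by rewrite -(Rv_l XR) !mulmxA rp_trP_l.
by rewrite -(Rv_r XR) -!mulmxA rp_trP_r // disjoint_sym.
Qed.

Lemma cond0 T A : cond T A 0.
Proof.
exists 0; first exact: mem0v.
by move=> a; rewrite !rpE ffunE mulmx0 mul0mx mulmx0 mul0mx.
Qed.

Lemma cond_cjN T A X u : X \in Rv T (A :\: T) -> inP T (A :\: T) u ->
  cond T A (cj (- X) u).
Proof.
move=> XR uP; exists X => //; apply/(cond_cj _ XR).
by rewrite (cjNK _ (disjD T A) XR).
Qed.

(** Density makes (X, u) -> (1 - X) u (1 + X) dominant, where u ranges over the representations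
    preserving K^T. These have codimension [#|Hm T B|], so the parameters X must make up for it. *)
Lemma dense_card T A : dense T A -> (#|Hm T (A :\: T)| <= #|Rm T (A :\: T)|)%N.
Proof.
set B := A :\: T => TA.
pose P := Mv (fun x => ~~ Hm T B x).
pose U1 : vectType K := (subvs_of (Rv T B) * subvs_of P)%type.
pose g (y : U1) : repr := cj (- vsval y.1) (vsval y.2).
have gP : polymap 3 g.
  apply: polymapF => a i j.
  have lX s i' j' : polyd 1 (fun y : U1 => (1%:M + s *: vsval y.1) i' j').
    apply: (@polyd_ext _ _ _ (fun y : U1 => 1%:M i' j' + s * vsval y.1 i' j')).
      by move=> y; rewrite !mxE.
    apply: polydD; first exact: polyd_const.
    by apply: polydZ; apply: polyd_lin => c u v; rewrite !mxE.
  have lu i' j' : polyd 1 (fun y : U1 => vsval y.2 a i' j').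
    by apply: polyd_lin => c u v; rewrite /= !ffunE !mxE.
  apply: (polyd_eq (polyd_mulmx (polyd_mulmx (lX (-1)) lu) (lX 1) i j)) => y.
  by rewrite !ffunE scaleN1r scale1r opprK.
have := dominant_dim gP; rewrite -!dimvf.
have -> : \dim {: repr} = #|{: arrow Q * ('I_m * 'I_m)}|.
  have <- : \dim (Mv predT) = #|{: arrow Q * ('I_m * 'I_m)}| by rewrite dim_Mv; apply: eq_card.
  by congr (\dim _); apply/esym/vspaceP => w; rewrite memvf; apply/mem_Mv.
have -> : \dim {: U1} = (#|Rm T B| + #|predC (Hm T B)|)%N.
  rewrite -dim_Rv -[X in (_ + X)%N]/(#|fun x => ~~ Hm T B x|).
  by rewrite -dim_Mv dimvf.
rewrite -(cardC (Hm T B)) leq_add2r; apply.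
move=> f fP f0; apply: TA => // w [X XR] /(cond_cj w XR) uP.
pose Xs := vsproj (Rv T B) X; pose us := vsproj P (cj X w).
rewrite -(f0 (Xs, us)) /g /= !vsprojK ?(cjK _ (disjD T A) XR) //.
by apply/mem_Mv => x; rewrite negbK; move: x; apply/inP_Hm.
Qed.

(* If [E = K^T (1 + Z)] and [K^S] are stable under [w], then [E (1 + X)], which
   is the graph of [Z + p_T X + Z X], is stable under [(1 - X) w (1 + X)]. *)
Lemma cond_trans T S A X w : T \subset S -> S \subset A ->
  X \in Rv S (A :\: S) -> inP S (A :\: S) w -> cond T S w ->
  cond T A (cj (- X) w).
Proof.
move=> TS SA XR wP [Z ZR Zw].
have ST_AT : S :\: T \subset A :\: T by apply: finset.setSD.
have AS_AT : A :\: S \subset A :\: T by apply: finset.setDS.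
pose X' := Z + pj T *m X + Z *m X.
have TXR : pj T *m X \in Rv T (A :\: T).
  have := Rv_pj T (A :\: S) XR; rewrite -mulmxA (Rv_r XR).
  by apply: Rv_sub; rewrite ?finset.subsetIr // finset.setIid.
have ZXR : Z *m X \in Rv T (A :\: T).
  by apply: Rv_mul (Rv_sub (subxx _) _ ZR) (Rv_sub (subxx _) AS_AT XR); apply: finset.subsetDl.
have X'R : X' \in Rv T (A :\: T).
  by rewrite !memvD //; apply: Rv_sub (subxx _) ST_AT ZR.
exists X' => // a.
have NXR : - X \in Rv S (A :\: S) by rewrite memvN.
rewrite (cj_rp _ _ NXR) opprK.
have [XI _] := unip_mul (disjD S A) XR.
have e1 : pj T + X' = (pj T + Z) *m (1%:M + X).
  by rewrite mulmxDr mulmx1 mulmxDl /X' !addrA.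
have pjTZ : (pj T + Z) *m pj S = pj T + Z.
  by rewrite mulmxDl (pj_sub TS) -(Rv_r ZR) -mulmxA pj_sub // finset.subsetDl.
set F := pj (A :\: T) - X'.
have pjF : pj A *m ((1%:M + X) *m F) = (1%:M + X) *m F.
  rewrite mulmxDl mul1mx mulmxDr /F [pj A *m (_ - _)]mulmxBr pj_subr ?finset.subsetDl //.
  by rewrite -(Rv_l X'R) -(Rv_l XR) !mulmxA !pj_subr // (subset_trans TS SA).
(* After the shear by 1 + X, the equations [F] of the graph restrict on K^S to those of E. Then [e3]
   uses that [w] maps K^S into itself. *)
have e2 : pj S *m ((1%:M + X) *m F) = (pj (S :\: T) - Z) *m (1%:M + X).
  have XX' : X *m X' = 0.
    rewrite -(Rv_r XR) -(Rv_l X'R) -mulmxA (mulmxA (pj _)) pj_disj ?mul0mx ?mulmx0 //.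
    by rewrite disjoint_sym; apply: disjointWl TS _; apply: disjD.
  have XAT : X *m pj (A :\: T) = X by rewrite -(Rv_r XR) -mulmxA pj_sub.
  have SAT : pj S *m pj (A :\: T) = pj (S :\: T).
    by rewrite pjI finset.setIDA (finset.setIidPl SA).
  have SX' : pj S *m X' = X' by rewrite -(Rv_l X'R) mulmxA pj_subr.
  have STX : pj (S :\: T) *m X = X - pj T *m X.
    by rewrite -{2}(Rv_l XR) (pjD TS) mulmxDl addrC addKr.
  rewrite mulmxDl mul1mx mulmxDr [X *m F]mulmxBr XAT XX' subr0 (Rv_l XR).
  rewrite /F mulmxBr SAT SX' mulmxDr mulmx1 mulmxBl STX /X'.
  move: (pj (S :\: T)) (pj T *m X) (Z *m X) => P TX ZX.
  by apply/matrixP => i j; rewrite !mxE; ring.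
have e3 : pj S *m rp w a *m ((1%:M + X) *m F) = pj S *m rp w a *m (pj (S :\: T) - Z) *m (1%:M + X).
  move: e2 pjF; move: (_ *m F) => G e2 pjF.
  rewrite -pjF (pjD SA) mulmxDl mulmxDr [X in _ + X]mulmxA wP mul0mx addr0.
  by rewrite e2 !mulmxA.
rewrite e1 !mulmxA -[(pj T + Z) *m _ *m _]mulmxA XI mulmx1.
rewrite -mulmxA -pjTZ -!mulmxA [pj S *m (rp w a *m _)]mulmxA e3 !mulmxA pjTZ.
by rewrite Zw mul0mx.
Qed.

Lemma cond_trP T S A w : T \subset S -> cond T S w -> cond T S (trP S (A :\: S) w).
Proof.
move=> TS [Z ZR Zw]; exists Z => // a.
have dS : [disjoint S & A :\: S] by apply: disjD.
have pjTZ : (pj T + Z) *m pj S = pj T + Z.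
  by rewrite mulmxDl (pj_sub TS) -(Rv_r ZR) -mulmxA pj_sub // finset.subsetDl.
have pjZ : pj S *m (pj (S :\: T) - Z) = pj (S :\: T) - Z.
  by rewrite mulmxBr pj_subr ?finset.subsetDl // -(Rv_l ZR) mulmxA pj_subr.
by rewrite -pjZ !mulmxA -[_ *m rp _ _ *m _]mulmxA rp_trP_l // !mulmxA -mulmxA pjZ.
Qed.

(** Conjugate so that K^S itself is stable. The block from K^S to its complement can then be
    projected away without affecting [cond T S], so density of T in S applies to [q], and
    [cond_trans] shows that its hypothesis holds. *)
Lemma dense_trans T S A : T \subset S -> S \subset A ->
  dense T S -> dense S A -> dense T A.
Proof.
move=> TS SA dTS dSA f fP f0; apply: dSA => // w [X XR] /(cond_cj w XR) uP.
rewrite -(cjK w (disjD S A) XR) -(trP_id uP).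
pose q u := f (cj (- X) (trP S (A :\: S) u)).
suff : q (cj X w) = 0 by [].
apply: (dTS q) => [|u Tu].
  rewrite /q; apply: (polyf_comp (f := fun w => f (cj (- X) w)) _ (polymap_trP S (A :\: S))).
  exact: polyf_comp fP (polymap_cj (- X)).
by apply: f0; apply: cond_trans (cond_trP _ TS Tu) => //; apply: inP_trP.
Qed.

Lemma dense_refl A : dense A A.
Proof.
move=> f _ f0 w; apply: f0; exists 0 => [|a]; first exact: mem0v.
by rewrite finset.setDv pj0 subr0 mulmx0.
Qed.

(** The products of [X] and [X1] vanish, so 1 - (X + t X1) factors as (1 - X)(1 - t X1) and the
    curve is an explicit cubic in t. *)
Lemma cj_tangent T A X u u1 X1 t : X \in Rv T (A :\: T) -> X1 \in Rv T (A :\: T) ->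
  cj (- (X + t *: X1)) (u + t *: u1) =
  cj (- X) (u + t *: [ffun a => u1 a + u a *m X1 - X1 *m u a]
    + t ^+ 2 *: [ffun a => u1 a *m X1 - X1 *m u1 a - X1 *m u a *m X1]
    + t ^+ 3 *: [ffun a => - (X1 *m u1 a *m X1)]).
Proof.
move=> XR X1R; apply/ffunP => a; rewrite !ffunE.
have XX1 : X *m X1 = 0.
  rewrite -(Rv_r XR) -(Rv_l X1R) -mulmxA (mulmxA (pj _)) pj_disj ?mul0mx ?mulmx0 //.
  by rewrite disjoint_sym disjD.
have -> : 1%:M - (X + t *: X1) = (1%:M - X) *m (1%:M - t *: X1).
  by rewrite mulmxBl mul1mx mulmxBr mulmx1 -scalemxAr XX1 scaler0 subr0 opprD addrA addrAC.
have X1X : X1 *m X = 0.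
  rewrite -(Rv_r X1R) -(Rv_l XR) -mulmxA (mulmxA (pj _)) pj_disj ?mul0mx ?mulmx0 //.
  by rewrite disjoint_sym disjD.
have -> : 1%:M - - (X + t *: X1) = (1%:M + t *: X1) *m (1%:M + X).
  by rewrite opprK mulmxDl mul1mx mulmxDr mulmx1 -scalemxAl X1X scaler0 addr0 addrA.
rewrite opprK -!mulmxA; congr (_ *m _); rewrite !mulmxA; congr (_ *m _).
have cjE c (x : 'M[K]_m) : (1%:M - c *: X1) *m x *m (1%:M + c *: X1) =
    x + c *: (x *m X1) - c *: (X1 *m x) - (c ^+ 2) *: (X1 *m x *m X1).
  rewrite mulmxBl mul1mx mulmxDr mulmx1 mulmxBl -!scalemxAl -!scalemxAr scalerA.
  by apply/matrixP => i j; rewrite !mxE; ring.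
rewrite cjE mulmxDl mulmxDr mulmxDl -!scalemxAr -!scalemxAl.
by apply/matrixP => i j; rewrite !mxE; ring.
Qed.

Lemma cj_lin X c u w : cj X (c *: u + w) = c *: cj X u + cj X w.
Proof.
apply/ffunP => a; rewrite !ffunE (mulmxDr (1%:M + X)) (mulmxDl _ _ (1%:M - X)).
by rewrite -scalemxAr -scalemxAl.
Qed.

Lemma inP_lin T B c u w : inP T B u -> inP T B w -> inP T B (c *: u + w).
Proof.
move=> uP wP a; rewrite rp_lin mulmxDr mulmxDl -scalemxAr -scalemxAl uP wP.
by rewrite scaler0 addr0.
Qed.

(* If [delta^u] is surjective, the set of stable representations contains
   curves with arbitrary tangent through the conjugates of [u], so all the
   derivatives of a function vanishing on this set vanish there as well. *)
Lemma surj_dense T A w0 :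
  (#|Hm T (A :\: T)| <= rk T (A :\: T) w0)%N -> dense T A.
Proof.
set B := A :\: T => surj0.
apply: polyf_vanish_ind; first by exists 0; apply: cond0.
move=> d f fP f0 z g fg gP w [X XR] /(cond_cj w XR) uP; set u := cj X w in uP.
have dTB : [disjoint T & B] by apply: disjD.
(* [h] extends u -> g (cj (- X) u) beyond the representations preserving K^T. If it were nonzero at
   [u], it would be nonzero at some point where delta is onto. *)
pose h u' := g (cj (- X) (trP T B u')).
have hP : polyf h.
  apply: (polyf_comp (f := fun w => g (cj (- X) w)) _ (polymap_trP T B)).
  exact: polyf_comp gP (polymap_cj (- X)).
have hu : h u = g w by rewrite /h trP_id // (cjK _ dTB XR).
apply/eqP; apply: contraT; rewrite -hu => hu0.
have [fo [foP fo0 foF]] := rk_open T B w0.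
have [u' [/foF ru' hu']] := polyf_domain foP hP fo0 hu0.
case/negP: hu'; apply/eqP; rewrite /h; set u2 := trP T B u'.
have u2P : inP T B u2 by apply: inP_trP.
(* The component of the tangent [z] that breaks the stability of K^T; surjectivity of delta produces
   it by varying [X]. *)
pose phi : repr := [ffun a => pj T *m rp (cj X z) a *m pj B].
have phiH : phi \in Hv T B.
  apply/mem_Hv => a; rewrite rpE !ffunE; split; last first.
    by rewrite !mulmxA pjI finset.setIid -mulmxA pjI finset.setIid.
  rewrite !mulmxA pj_ev -!mulmxA -pj_ev !mulmxA.
  by rewrite -[_ *m ev _ *m rp _ _]mulmxA -[_ *m (_ *m _) *m ev _]mulmxA rp_ev.
have [X1 X1R phiE] := rk_surj (leq_trans surj0 ru') phiH.
(* Chosen so that the linear coefficient in [cj_tangent] is [z]; the choice of [X1] makes the block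
   of [u1] from K^T to K^B vanish. *)
pose u1 : repr := [ffun a => cj X z a - u2 a *m X1 + X1 *m u2 a].
have u1P : inP T B u1.
  move=> a; have := congr1 (fun y : repr => y a) phiE.
  rewrite -(dlt_trP _ dTB X1R) -/u2 !ffunE.
  have -> : rp u1 a = rp (cj X z) a - (rp u2 a *m X1 - X1 *m rp u2 a).
    have e1 : ev (source a) *m (u2 a *m X1) *m ev (target a) = rp u2 a *m X1.
      by rewrite rpE -!mulmxA -(Rv_ev _ X1R).
    have e2 : ev (source a) *m (X1 *m u2 a) *m ev (target a) = X1 *m rp u2 a.
      by rewrite rpE !mulmxA (Rv_ev _ X1R).
    rewrite -e1 -e2 !rpE [u1 a]ffunE.
    by rewrite -mulmxBl -mulmxBr -mulmxBl -mulmxBr opprB addrA addrAC.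
  by move=> e; rewrite mulmxBr mulmxBl e subrr.
pose c t := cj (- (X + t *: X1)) (u2 + t *: u1).
have cE t : c t = cj (- X) u2 + t *: z
    + t ^+ 2 *: cj (- X) [ffun a => u1 a *m X1 - X1 *m u1 a - X1 *m u2 a *m X1]
    + t ^+ 3 *: cj (- X) [ffun a => - (X1 *m u1 a *m X1)].
  rewrite /c (cj_tangent _ _ _ XR X1R).
  have -> : [ffun a => u1 a + u2 a *m X1 - X1 *m u2 a] = cj X z.
    by apply/ffunP => a; rewrite !ffunE; apply/matrixP => i j; rewrite !mxE; ring.
  by rewrite addrC cj_lin addrC; congr (_ + _); rewrite addrC cj_lin addrC; congr (_ + _);
    rewrite addrC cj_lin addrC (cjK _ dTB XR).
have c0 : c 0 = cj (- X) u2 by rewrite cE !expr0n !scale0r !addr0.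
rewrite -c0.
pose C i : {poly K} := (v2r (cj (- X) u2) 0 i)%:P + (v2r z 0 i) *: 'X
    + (v2r (cj (- X) [ffun a => u1 a *m X1 - X1 *m u1 a - X1 *m u2 a *m X1]) 0 i) *: 'X^2
    + (v2r (cj (- X) [ffun a => - (X1 *m u1 a *m X1)]) 0 i) *: 'X^3.
have -> // : g (c 0) = (0 : {poly K})^`().[0].
  apply/esym; apply: (fg c C) => [t i|t|i].
  - rewrite cE !linearD !linearZ !mxE /C !hornerD !hornerZ !hornerXn hornerX hornerC.
    by congr (_ + _ + _ + _); apply: mulrC.
  - rewrite horner0; apply: f0; apply: cond_cjN; first by rewrite memvD ?memvZ.
    by rewrite addrC; apply: inP_lin.
  - rewrite /C !derivD !derivZ !derivXn derivX derivC add0r.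
    by rewrite !hornerD !hornerZ !hornerMn !hornerXn hornerC; ring.
by rewrite deriv0 horner0.
Qed.

(** * Leading positions and echelon forms *)

Definition kS S : {vspace 'rV[K]_m} := maskv (fun i => delta_mx 0 i) (mem S).

Let rcrd (i : 'I_m) (u : 'rV[K]_m) := u 0 i.
Let rcrd_lin i a (u v : 'rV[K]_m) : rcrd i (a *: u + v) = a * rcrd i u + rcrd i v.
Proof. by rewrite /rcrd !mxE. Qed.
Let rcrd_bas i j : rcrd i (delta_mx 0 j) = (i == j)%:R.
Proof. by rewrite /rcrd mxE. Qed.
Let rcrdE (u : 'rV[K]_m) : u = \sum_i rcrd i u *: delta_mx 0 i.
Proof. exact: row_sum_delta. Qed.

Lemma dim_kS S : \dim (kS S) = #|S|.
Proof. exact: (dim_maskv rcrd_lin rcrd_bas). Qed.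

Lemma mem_kS S (u : 'rV[K]_m) : u \in kS S <-> u *m pj S = u.
Proof.
rewrite (mem_maskv rcrd_lin rcrd_bas rcrdE); split=> [h|h i /= iS].
  apply/rowP => i; rewrite pjrE; case: (boolP (i \in S)); rewrite ?mulr1 //.
  by rewrite mulr0 => /h.
by rewrite /rcrd -h pjrE (negPf iS) mulr0.
Qed.

(** Filtration steps are initial segments for [ht], so the greatest height in the support tells in
    which step a vector first appears. *)
Definition lead (u : 'rV[K]_m) (i : 'I_m) : Prop :=
  u 0 i != 0 /\ forall j, u 0 j != 0 -> (ht j <= ht i)%N.

Lemma lead_ex (u : 'rV[K]_m) : u != 0 -> exists i, lead u i.
Proof.
move=> u0; have [i0 ui0] : exists i, u 0 i != 0.
  apply: contrapT => h; move/eqP: u0; apply; apply/rowP => i; rewrite mxE.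
  by apply: contrapT => /eqP ui; apply: h; exists i.
by case: (@arg_maxnP _ i0 (fun i => u 0 i != 0) ht ui0) => i ui hi; exists i.
Qed.

Hypothesis ht_inj : injective ht.

(** Vectors with distinct leading positions are independent: in a relation, look at the highest
    leading position among the terms that occur. *)
Lemma lead_card (U : {vspace 'rV[K]_m}) (J : {set 'I_m}) :
  (forall i, i \in J -> exists2 u, u \in U & lead u i) -> (#|J| <= \dim U)%N.
Proof.
move=> JU; have {}JU (k : 'I_#|J|) : {u | u \in U & lead u (enum_val k)}.
  by apply: cid2; apply: JU; apply: enum_valP.
apply: (@freef_dim _ _ _ (fun k => s2val (JU k))) => [c c0|k]; last exact: s2valP (JU k).
apply: contrapT => /existsNP[k0 /eqP ck0].
case: (@arg_maxnP _ k0 (fun k => c k != 0) (fun k => ht (enum_val k)) ck0) => k ck hk.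
have := congr1 (fun u : 'rV[K]_m => u 0 (enum_val k)) c0.
rewrite summxE (bigD1 k) //= big1 ?addr0 => [|l lk].
  have [uk _] := s2valP' (JU k); rewrite !mxE => /eqP.
  by rewrite mulf_eq0 (negPf ck) (negPf uk).
rewrite mxE; have [->|cl] := eqVneq (c l) 0; first by rewrite mul0r.
have [_ ul] := s2valP' (JU l).
have [->|/ul hkl] := eqVneq (s2val (JU l) 0 (enum_val k)) 0; first by rewrite mulr0.
case/eqP: lk; apply: enum_val_inj; apply: ht_inj; apply/eqP.
by rewrite eqn_leq hkl andbT; apply: hk.
Qed.

(* Reduced echelon form: a homogeneous subspace whose leading positions all
   lie in [J] and whose dimension is at least [#|J|] is the graph of a
   filtered homomorphism on the coordinate subspace of [J]. *)
Lemma echelon (U : {vspace 'rV[K]_m}) A (J : {set 'I_m}) :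
  J \subset A -> (U <= kS A)%VS ->
  (forall (u : 'rV[K]_m) x, u \in U -> u *m ev x \in U) ->
  (forall (u : 'rV[K]_m) i, u \in U -> lead u i -> i \in J) -> (#|J| <= \dim U)%N ->
  exists2 Z, Z \in Rv J (A :\: J) &
    forall u : 'rV[K]_m, u \in U <-> (u *m pj A = u /\ u *m (pj (A :\: J) - Z) = 0).
Proof.
move=> JA UA Uev UJ dJ.
have pinj (u : 'rV[K]_m) : u \in U -> u *m pj J = 0 -> u = 0.
  move=> uU uJ; apply/eqP; apply: contraT => /lead_ex[i ui].
  have [ui0 _] := ui; case/eqP: ui0.
  by have := congr1 (fun v : 'rV[K]_m => v 0 i) uJ; rewrite pjrE (UJ u i uU ui) mulr1 mxE.
pose p : 'Hom('rV[K]_m, 'rV[K]_m) := linfun (mulmxr (pj J)).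
have pE (u : 'rV[K]_m) : p u = u *m pj J by rewrite lfunE.
have pU : (p @: U)%VS = kS J.
  apply/eqP; rewrite eqEdim dim_kS limg_dim_eq ?dJ ?andbT.
    apply/subvP => _ /memv_imgP[u _ ->]; apply/mem_kS.
    by rewrite pE -mulmxA pjI finset.setIid.
  apply/eqP; rewrite -subv0; apply/subvP => u; rewrite memv_cap memv_ker pE.
  by case/andP=> uU /eqP /(pinj u uU) ->; apply: mem0v.
(* [r i] is the reduced basis vector of [U] whose part in K^J is the i-th unit vector; for [i]
   outside [J] the value 0 is a filler. *)
have ex_r i : {r | r \in U & i \in J -> r *m pj J = delta_mx 0 i}.
  case: (boolP (i \in J)) => iJ; last by exists 0; [apply: mem0v|].
  have : delta_mx 0 i \in (p @: U)%VS.
    rewrite pU; apply/mem_kS; apply/rowP => j; rewrite pjrE !mxE eqxx /=.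
    by case: eqP => [->|_]; rewrite ?iJ ?mulr1 ?mul0r.
  move=> /memv_imgP /cid2[r rU e]; exists r => // _; rewrite -pE; exact: esym.
pose r i := s2val (ex_r i).
have rU i : r i \in U := s2valP (ex_r i).
have rJ i : i \in J -> r i *m pj J = delta_mx 0 i := s2valP' (ex_r i).
pose Z : 'M[K]_m := \matrix_(i, j) (if i \in J then (r i - delta_mx 0 i) 0 j else 0).
have rA i : r i *m pj A = r i by apply/mem_kS; apply: (subvP UA).
have ZR : Z \in Rv J (A :\: J).
  apply/mem_Rv => i j; rewrite mxE; case: (boolP (i \in J)) => iJ; last by rewrite eqxx.
  case: (boolP (j \in J)) => jJ.
    have := congr1 (fun v : 'rV[K]_m => v 0 j) (rJ i iJ).
    by rewrite pjrE jJ mulr1 !mxE => ->; rewrite subrr eqxx.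
  have -> : (r i - delta_mx 0 i) 0 j = r i 0 j.
    rewrite !mxE eqxx /=; case: eqP => [ji|_]; last by rewrite subr0.
    by move: jJ; rewrite ji iJ.
  move=> rij; have ri0 : r i != 0 by apply: contraNneq rij => ->; rewrite mxE.
  have [k rk] := lead_ex ri0; have kJ := UJ _ _ (rU i) rk; have [rik hk] := rk.
  (* The leading position of [r i] lies in [J], where [r i] has the single entry [i]. So no entry is
     higher than [i], which makes [Z] filtered. *)
  have ki : k = i.
    have := congr1 (fun v : 'rV[K]_m => v 0 k) (rJ i iJ).
    rewrite pjrE kJ mulr1 !mxE eqxx /=; case: eqP => // _ e.
    by move: rik; rewrite e eqxx.
  have jA : j \in A.
    move: rij; rewrite -(rA i) pjrE; case: (j \in A) => //.
    by rewrite mulr0 eqxx.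
  (* [r i] is homogeneous, since its component of colour [col i] has the same part in K^J. *)
  have e : r i *m ev (col i) = r i.
    apply/eqP; rewrite -subr_eq0; apply/eqP; apply: pinj; first by rewrite memvB ?Uev.
    rewrite mulmxBl -mulmxA pj_ev mulmxA rJ //.
    apply/rowP => l; rewrite mxE pjrE !mxE inE eqxx /=.
    by case: eqP => [->|_]; rewrite ?eqxx ?mul0r ?mulr1 subrr.
  apply/and4P; split=> //=; rewrite ?inE ?jJ //; last by rewrite -ki; apply: hk.
  by move: rij; rewrite -e pjrE inE [col j == _]eq_sym; case: (col i == col j); rewrite // mulr0 eqxx.
exists Z => // u.
have rowE i : i \in J -> row i (pj J + Z) = r i.
  move=> iJ; apply/rowP => j; rewrite !mxE iJ andbT eqxx /= eq_sym.
  by rewrite addrC subrK.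
have combU v : v *m (pj J + Z) \in U.
  rewrite mulmx_sum_row; apply: memv_suml => i _; case: (boolP (i \in J)) => iJ.
    by rewrite rowE // memvZ.
  suff -> : row i (pj J + Z) = 0 by rewrite scaler0 mem0v.
  by apply/rowP => j; rewrite !mxE (negPf iJ) andbF addr0.
have ZJ : Z *m pj J = 0.
  by rewrite -(Rv_r ZR) -mulmxA pj_disj ?mulmx0 // disjoint_sym disjD.
have JE : (pj J + Z) *m pj J = pj J by rewrite mulmxDl pjI finset.setIid ZJ addr0.
split=> [uU|[uA uF]].
  have uE : u = u *m (pj J + Z).
    apply/eqP; rewrite -subr_eq0; apply/eqP; apply: pinj; first by rewrite memvB.
    by rewrite mulmxBl -mulmxA JE subrr.
  split; first by apply/mem_kS; apply: (subvP UA).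
  rewrite uE -mulmxA mulmxDl !mulmxBr (Rv_l ZR) (Rv_r ZR) (pj_disj (disjD J A)).
  rewrite (_ : Z *m Z = 0); last exact: Rv_nil (disjD J A) ZR.
  by rewrite subr0 sub0r addNr mulmx0.
suff -> : u = u *m (pj J + Z) by [].
have : u *m Z = u *m pj (A :\: J).
  by apply/eqP; rewrite eq_sym -subr_eq0 -mulmxBr uF.
by rewrite mulmxDr => ->; rewrite -mulmxDr -(pjD JA) uA.
Qed.

(** The kernel of [X] in K^S is homogeneous, so [echelon] applies with T its set of leading
    positions: it is the subspace K^T (1 + Z), cut out in K^S by the last equation. *)
Lemma kernel_form S W X : X \in Rv S W -> exists T, exists Z,
  [/\ T \subset S, Z \in Rv T (S :\: T), (pj T + Z) *m X = 0 &
    forall u : 'rV[K]_m, u *m pj S = u -> u *m X = 0 ->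
      u *m (pj (S :\: T) - Z) = 0].
Proof.
move=> XR; pose U := (kS S :&: lker (linfun (mulmxr X)))%VS.
have UE (u : 'rV[K]_m) : u \in U <-> (u *m pj S = u /\ u *m X = 0).
  rewrite memv_cap memv_ker lfunE /=; split=> [/andP[/mem_kS uS /eqP uX]//|[uS uX]].
  by rewrite uX eqxx andbT; apply/mem_kS.
pose J := [set i | `[< exists2 u : 'rV[K]_m, u \in U & lead u i >]].
have JS : J \subset S.
  apply/subsetP => i; rewrite inE => /asboolP[u /UE[uS _] [ui _]].
  by apply: contraNT ui => iS; rewrite -uS pjrE (negPf iS) mulr0.
have [||||Z ZR ZU] := @echelon U S J JS.
- by apply/subvP => u; rewrite memv_cap => /andP[].
- move=> u x /UE[uS uX]; apply/UE; split.
    by rewrite -mulmxA pj_ev mulmxA uS.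
  by rewrite -mulmxA (Rv_ev _ XR) mulmxA uX mul0mx.
- by move=> u i uU ui; rewrite inE; apply/asboolP; exists u.
- by apply: lead_card => i; rewrite inE => /asboolP.
exists J, Z; split=> //; last first.
  by move=> u uS uX; have /ZU[] : u \in U by apply/UE.
apply/row_matrixP => i; rewrite row_mul row0.
suff /UE[] : row i (pj J + Z) \in U by [].
have ZS : Z *m pj S = Z by rewrite -(Rv_r ZR) -mulmxA pj_sub // finset.subsetDl.
apply/ZU; rewrite -!row_mul; split.
  by rewrite mulmxDl pj_sub // ZS.
rewrite mulmxDl !mulmxBr (Rv_l ZR) (Rv_r ZR) (pj_disj (disjD J S)).
by rewrite (Rv_nil (disjD J S) ZR) subr0 sub0r addNr row0.
Qed.

Lemma rk_max A B : exists w, forall u, (rk A B u <= rk A B w)%N.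
Proof.
have [r /= [[w <-] wmax]] : exists r, (exists w : repr, rk A B w = r) /\
    forall u, (rk A B u <= r)%N.
  have exr : exists r, `[< exists w : repr, rk A B w = r >].
    by exists (rk A B 0); apply/asboolP; exists 0.
  have ubr r : `[< exists w : repr, rk A B w = r >] -> (r <= #|Rm A B|)%N.
    by move=> /asboolP[w <-]; apply: rk_le_Rm.
  case: (ex_maxnP exr ubr) => r /asboolP ex hr; exists r; split=> // u.
  by apply: hr; apply/asboolP; exists u.
by exists w.
Qed.

(** If T is not dense in S, some nonzero polynomial vanishes on all [w] with [cond T S w]. Avoid its
    zeros and those of a maximal minor of delta, for the finitely many T at once. *)
Lemma generic_repr S W : exists w, forall T,
  (cond T S w -> dense T S) /\ (forall u, (rk T W u <= rk T W w)%N).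
Proof.
have ex T : exists h : repr -> K, [/\ polyf h, exists u, h u != 0 &
    forall w, h w != 0 -> (cond T S w -> dense T S) /\
      (forall u, (rk T W u <= rk T W w)%N)].
  have [w0 w0max] := rk_max T W; have [g [gP g0 gF]] := rk_open T W w0.
  have gmax w : g w != 0 -> forall u, (rk T W u <= rk T W w)%N.
    by move=> /gF h u; apply: leq_trans (w0max u) h.
  have [dT|] := pselect (dense T S); first by exists g; split=> [//||w /gmax]; [exists w0 |].
  move=> ndT; have [f [fP f0 [u fu]]] : exists f : repr -> K,
      [/\ polyf f, forall w, cond T S w -> f w = 0 & exists u, f u != 0].
    apply: contrapT => nex; apply: ndT => f fP f0 u; apply: contrapT => /eqP fu.
    by apply: nex; exists f; split=> //; exists u.
  have [v [gv fv]] := polyf_domain gP fP g0 fu.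
  exists (fun w => g w * f w); split; first exact: polyfM.
    by exists v; rewrite mulf_neq0.
  move=> w; rewrite mulf_eq0 negb_or => /andP[gw fw]; split; last exact: gmax.
  by move=> /f0 e; rewrite e eqxx in fw.
have [h hP] := choice ex.
have [T _|w hw] := @polyf_big_domain _ _ _ (enum {set 'I_m}) h.
  by have [? ? _] := hP T.
by exists w => T; have [_ _] := hP T; apply; apply: hw; rewrite mem_enum.
Qed.

Lemma mulmx_factor (A B : 'M[K]_m) :
  (forall u : 'rV[K]_m, u *m A = 0 -> u *m B = 0) -> exists D, B = A *m D.
Proof.
move=> AB; exists (pinvmx A *m B); apply/eqP; rewrite -subr_eq0 mulmxA.
rewrite -{1}[B]mul1mx -mulmxBl; apply/eqP/row_matrixP => i; rewrite row_mul row0.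
apply: AB; rewrite -row_mul mulmxBl mul1mx mulmxKpV ?submx_refl //.
by rewrite subrr row0.
Qed.

(** * The kernel of a null vector of delta *)

Section DisjointBlocks.
Variables (S W : {set 'I_m}).
Hypothesis dSW : [disjoint S & W].

Let pjW_l T Z : T \subset S -> Z \in Rv T (S :\: T) ->
  pj W *m (1%:M + Z) = pj W /\ (1%:M - Z) *m pj W = pj W.
Proof.
move=> TS ZR; split.
  rewrite mulmxDr mulmx1 -(Rv_l ZR) mulmxA pj_disj ?mul0mx ?addr0 //.
  by rewrite disjoint_sym; apply: disjointWl dSW.
rewrite mulmxBl mul1mx -(Rv_r ZR) -mulmxA pj_disj ?mulmx0 ?subr0 //.
by apply: disjointWl dSW; apply: finset.subsetDl.
Qed.

(** Equivariance of delta: 1 + Z changes K^S only, as [W] is disjoint from [S]. *)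
Lemma dlt_cj T Z X w : T \subset S -> Z \in Rv T (S :\: T) -> X \in Rv S W ->
  dlt S W (cj Z w) ((1%:M + Z) *m X) =
  [ffun a => (1%:M + Z) *m dlt S W w X a].
Proof.
move=> TS ZR XR; apply/ffunP => a; rewrite !ffunE (cj_rp _ _ ZR).
have [_ ZI] := unip_mul (disjD T S) ZR.
have [_ WZ] := pjW_l TS ZR.
have ZS : Z *m pj S = Z by rewrite -(Rv_r ZR) -mulmxA pj_sub // finset.subsetDl.
have SZ : pj S *m Z = Z by rewrite -(Rv_l ZR) mulmxA pj_subr.
have SZ' : pj S *m (1%:M + Z) = (1%:M + Z) *m pj S.
  by rewrite mulmxDr mulmx1 mulmxDl mul1mx SZ ZS.
have XZ : X *m Z = 0.
  rewrite -(Rv_r XR) -(Rv_l ZR) -mulmxA (mulmxA (pj _)) pj_disj ?mul0mx ?mulmx0 //.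
  by rewrite disjoint_sym; apply: disjointWl dSW.
have XZ' : X *m (1%:M + Z) = X by rewrite mulmxDr mulmx1 XZ addr0.
have e1 : (1%:M + Z) *m rp w a *m (1%:M - Z) *m ((1%:M + Z) *m X) =
    (1%:M + Z) *m (rp w a *m X).
  by rewrite -!mulmxA [(1%:M - Z) *m _]mulmxA ZI mul1mx.
have e2 : (1%:M + Z) *m X *m ((1%:M + Z) *m rp w a *m (1%:M - Z)) *m pj W =
    (1%:M + Z) *m (X *m rp w a) *m pj W.
  by rewrite -!mulmxA WZ [X *m (_ *m _)]mulmxA XZ' !mulmxA.
by rewrite e1 -mulmxA mulmxBl e2 -mulmxBl -mulmxBr !mulmxA SZ'.
Qed.

Lemma unipR T Z X : T \subset S -> Z \in Rv T (S :\: T) -> X \in Rv S W ->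
  (1%:M + Z) *m X \in Rv S W.
Proof.
move=> TS ZR XR; rewrite mulmxDl mul1mx memvD // (Rv_mul _ XR) //.
by apply: Rv_sub TS (finset.subsetDl _ _) ZR.
Qed.

Lemma rk_cj T Z w : T \subset S -> Z \in Rv T (S :\: T) ->
  (rk S W w <= rk S W (cj Z w))%N.
Proof.
move=> TS ZR; have [x [xR xf]] := limg_freef (dl S W w) (Rv S W).
apply: (@freef_dim _ _ _ (fun i => dl S W (cj Z w) ((1%:M + Z) *m x i))); last first.
  by move=> i; apply: memv_img; apply: unipR TS ZR (xR i).
move=> k k0; apply: xf; apply/ffunP => a; rewrite sum_ffunE ffunE.
have [_ ZI] := unip_mul (disjD T S) ZR.
have := congr1 (fun y : repr => (1%:M - Z) *m y a) k0; rewrite [(0 : repr) a]ffunE mulmx0 => e.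
rewrite -[RHS]e sum_ffunE mulmx_sumr; apply: eq_bigr => i _.
rewrite !ffunE -scalemxAr !dlE (dlt_cj _ TS ZR) //.
by rewrite [in RHS]ffunE mulmxA ZI mul1mx.
Qed.

(* By [rank_max_first_order], at a point of maximal rank every
   [phi = X u] lies in the image of [delta]. *)
Lemma max_rank_kernel w X : (forall u, (rk S W u <= rk S W w)%N) ->
  X \in Rv S W -> dlt S W w X = 0 ->
  forall (psi : repr) (D : 'M[K]_m), psi \in Hv S W ->
    (forall a, psi a = X *m D *m psi a) -> psi \in (dl S W w @: Rv S W)%VS.
Proof.
move=> wmax XR X0 psi D psiH psiD.
(* A deformation of [w] on K^W alone, chosen so that [X *m rp u a] is the negative of [psi a] while
   [rp u a *m X] is 0. *)
pose u : repr := [ffun a => - (pj W *m D *m psi a)].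
have [_ pW] : (forall a, rp psi a = psi a) /\ forall a, psi a *m pj W = psi a.
  split=> a; have [e1 e2] := (mem_Hv S W psi).1 psiH a => //.
  by rewrite -e2 -!mulmxA pjI finset.setIid.
have -> : psi = dl S W u X.
  apply/ffunP => a; have [e1 e2] := (mem_Hv S W psi).1 psiH a.
  have e3 : X *m rp u a = - psi a.
    rewrite rpE ffunE !mulmxA -(Rv_ev _ XR) mulmxN mulNmx !mulmxA; congr (- _).
    by rewrite -!mulmxA [X *m (pj W *m _)]mulmxA (Rv_r XR) [X *m _]mulmxA
      [_ *m (psi a *m _)]mulmxA -psiD mulmxA -rpE e1.
  have e4 : rp u a *m X = 0.
    have WX : pj W *m X = 0.
      by rewrite -(Rv_l XR) mulmxA pj_disj ?mul0mx // disjoint_sym.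
    rewrite rpE ffunE -mulmxA (Rv_ev _ XR) mulmxN mulNmx -(pW a) -!mulmxA.
    by rewrite (mulmxA (pj W) X) WX mul0mx !mulmx0 oppr0.
  by rewrite dlE !ffunE e4 e3 sub0r opprK e2.
apply: rank_max_first_order XR _ => [t|]; last by rewrite dlE.
have -> : dl S W w + t *: dl S W u = dl S W (t *: u + w).
  by apply/lfunP => Z; rewrite add_lfunE scale_lfunE !dlE dlt_linw addrC.
exact: wmax.
Qed.

Section Kernel.
Variables (T : {set 'I_m}) (Z X : 'M[K]_m) (w : repr).
Hypotheses (TS : T \subset S) (ZR : Z \in Rv T (S :\: T)) (XR : X \in Rv S W).
Hypotheses (X0 : dlt S W w X = 0) (kerX : (pj T + Z) *m X = 0).
Hypothesis kerX_sub : forall u : 'rV[K]_m, u *m pj S = u -> u *m X = 0 ->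
  u *m (pj (S :\: T) - Z) = 0.

(** 1 + Z carries K^T onto the kernel of [X] in K^S. So [X'] is a null vector of delta for [cj Z w]
    that kills exactly K^T in K^S. *)
Let X' := (1%:M + Z) *m X.

Let X'R : X' \in Rv S W. Proof. exact: unipR TS ZR XR. Qed.

Let TX' : pj T *m X' = 0.
Proof. by rewrite /X' mulmxA mulmxDr mulmx1 (Rv_l ZR). Qed.

Let X'0 : dlt S W (cj Z w) X' = 0.
Proof.
rewrite (dlt_cj _ TS ZR XR) X0; apply/ffunP => a.
by rewrite !ffunE mulmx0.
Qed.

Let X'_inj (u : 'rV[K]_m) : u *m X' = 0 -> u *m pj (S :\: T) = 0.
Proof.
have ST_Z : pj (S :\: T) *m Z = 0.
  by rewrite -(Rv_l ZR) mulmxA pj_disj ?mul0mx // disjoint_sym disjD.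
have e : u *m X' = u *m pj (S :\: T) *m X.
  rewrite -(Rv_l X'R) (pjD TS) mulmxDl TX' add0r mulmxA /X' mulmxA.
  by congr (_ *m _); rewrite -mulmxA mulmxDr mulmx1 ST_Z addr0.
rewrite e => uX; have uS : u *m pj (S :\: T) *m pj S = u *m pj (S :\: T).
  by rewrite -mulmxA pj_sub // finset.subsetDl.
have := kerX_sub uS uX; rewrite mulmxBr -!mulmxA ST_Z mulmx0 subr0.
by rewrite pjI finset.setIid.
Qed.

(* Otherwise move the [T]-block of [cj Z w] along a line to the one of [w]: the
   vector [X'] stays in the kernel, and for a general point of the line the rank
   of [delta] is maximal while [delta_{T,W}] is surjective. *)
Lemma kernel_nowhere_surj : (forall u, (rk S W u <= rk S W w)%N) ->
  nowhere_surj S W -> (rk T W w < #|Hm T W|)%N.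
Proof.
move=> wmax nsSW; rewrite ltnNge; apply/negP => sT.
have dTW : [disjoint T & W] by apply: disjointWl dSW.
(* [X'] is injective on the complement of K^T in K^S, so the projection to this complement factors
   through it. *)
have [D DE] := mulmx_factor X'_inj; clearbody X'.
pose w1 := cj Z w.
(* Adding [Dl] to [w1] restores the T-block of [w], and the W-blocks agree already; so delta on T
   and W has the same rank as at [w]. *)
pose Dl : repr := [ffun a => pj T *m (rp w a - rp w1 a) *m pj T].
have rpDl a : rp Dl a = Dl a.
  by rewrite rpE ffunE ev_block mulmxBr mulmxBl !rp_ev.
have rpw a : rp (w1 + Dl) a = rp w1 a + Dl a by have := rp_lin a 1 w1 Dl; rewrite !scale1r rpDl.
have TT a : pj T *m rp (w1 + Dl) a *m pj T = pj T *m rp w a *m pj T.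
  have DlT : pj T *m Dl a *m pj T = pj T *m rp w a *m pj T - pj T *m rp w1 a *m pj T.
    rewrite ffunE !mulmxA pjI finset.setIid -[_ *m pj T *m pj T]mulmxA pjI finset.setIid.
    by rewrite mulmxBr mulmxBl.
  by rewrite rpw (mulmxDr (pj T)) mulmxDl DlT addrC subrK.
have WW a : pj W *m rp (w1 + Dl) a *m pj W = pj W *m rp w a *m pj W.
  have [WZ ZW] := pjW_l TS ZR.
  have DlW : pj W *m Dl a = 0.
    by rewrite ffunE !mulmxA pj_disj ?mul0mx // disjoint_sym.
  rewrite rpw (mulmxDr (pj W)) DlW addr0 (cj_rp _ _ ZR) !mulmxA WZ.
  by rewrite -[_ *m (1%:M - Z) *m _]mulmxA ZW.
have sT1 : (#|Hm T W| <= rk T W (w1 + Dl)%R)%N.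
  suff <- : rk T W w = rk T W (w1 + Dl) by [].
  congr (\dim _); apply: eq_in_limg => Y YR; rewrite !dlE; apply/ffunP => a.
  rewrite !ffunE !mulmxBr !mulmxBl; congr (_ - _).
    by rewrite -(Rv_l YR) !mulmxA TT.
  by rewrite -(Rv_r YR) -!mulmxA [pj W *m (_ *m _)]mulmxA -WW !mulmxA.
have [f [fP f0 fF]] := rk_open S W w1.
have [g [gP g0 gF]] := rk_open T W (w1 + Dl).
have [||t [/fF ft /gF gt]] := @polyf_domain_line _ _ f g w1 Dl 0 1 fP gP.
- by rewrite scale0r addr0.
- by rewrite scale1r.
set w2 := w1 + t *: Dl in ft gt.
have w2max u : (rk S W u <= rk S W w2)%N.
  by apply: leq_trans (wmax u) (leq_trans (rk_cj w TS ZR) ft).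
have w2X' : dlt S W w2 X' = 0.
  rewrite /w2 addrC dlt_linw X'0 addr0; apply/ffunP => a; rewrite !ffunE rpDl ffunE.
  have -> : pj T *m (rp w a - rp w1 a) *m pj T *m X' = 0 by rewrite -mulmxA TX' mulmx0.
  rewrite -(Rv_r X'R) -!mulmxA (mulmxA (pj W) (pj T)) pj_disj 1?disjoint_sym //.
  by rewrite mul0mx mulmx0 subrr mul0mx mulmx0 scaler0.
have := nsSW w2; rewrite ltnNge => /negP; apply; rewrite -dim_Mv; apply: dimvS.
apply/subvP => phi phiH.
(* Split [phi]: its part on K^T is hit by some [Y], and the remainder kills K^T, hence factors
   through [X'] and is covered by [max_rank_kernel]. *)
pose phiT : repr := [ffun a => pj T *m phi a].
have phiTH : phiT \in Hv T W.
  apply/mem_Hv => a; have [e1 e2] := (mem_Hv S W phi).1 phiH a; split.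
    by rewrite rpE ffunE mulmxA pj_ev -!mulmxA [ev _ *m _]mulmxA -rpE e1.
  by rewrite ffunE mulmxA pjI finset.setIid -{2}e2 -!mulmxA -{1}e2 -!mulmxA pjI finset.setIid.
have [Y YR phiTE] := rk_surj (leq_trans sT1 gt) phiTH.
have YRS : Y \in Rv S W by apply: Rv_sub TS (subxx _) YR.
have -> : phi = dl S W w2 Y + (phi - dl S W w2 Y) by rewrite addrC subrK.
apply: memvD; first exact: memv_img.
set psi := phi - _.
have psiH : psi \in Hv S W by rewrite memvB // dlE dlt_Hv.
have psiT a : pj T *m psi a = 0.
  have := congr1 (fun y : repr => y a) phiTE.
  move=> e; rewrite !ffunE in e; have -> : psi a = phi a - dlt S W w2 Y a by rewrite /psi dlE !ffunE.
  by rewrite mulmxBr e ffunE !mulmxA (pj_sub TS) subrr.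
apply: (max_rank_kernel w2max X'R w2X' psiH (D := D)) => a.
have [_ e2] := (mem_Hv S W psi).1 psiH a.
rewrite -DE -{1}e2 -mulmxA {1}(pjD TS) mulmxDl [pj T *m _]mulmxA psiT mul0mx add0r.
rewrite mulmxA -{2}e2 !mulmxA [X in _ = X *m _ *m _]pj_sub ?finset.subsetDl //.
Qed.

(* [X'] embeds the quotient of [S] by [T] in [W]. *)
Lemma kernel_quotient T' : T' \subset T -> rk T' W w = #|Rm T' W| ->
  (#|Rm T' (S :\: T)| <= #|Hm T' (S :\: T)|)%N.
Proof.
move=> T'T injT'; clearbody X'; pose B := S :\: T.
have T'S := subset_trans T'T TS.
pose w1 := cj Z w.
(* The block of [w] on K^T' together with the quotient representation of S by T, read off from the
   conjugate. Injectivity of its delta gives the inequality. *)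
pose u : repr := [ffun a => pj T' *m rp w a *m pj T' + pj B *m rp w1 a *m pj B].
have dT'B : [disjoint T' & B] by apply: disjointWl T'T (disjD T S).
suff <- : rk T' B u = #|Rm T' B|.
  by rewrite -dim_Mv; apply: dimvS; apply: limg_dl_Hv.
apply: inj_rk => Y YR Y0.
have rpu a : rp u a = u a.
  by rewrite rpE ffunE mulmxDr mulmxDl !ev_block !rp_ev.
have uY a : u a *m Y = pj T' *m rp w a *m Y.
  have BY : pj B *m Y = 0 by rewrite -(Rv_l YR) mulmxA pj_disj ?mul0mx // disjoint_sym.
  by rewrite ffunE mulmxDl -!mulmxA BY !mulmx0 addr0 (Rv_l YR).
have Yu a : Y *m u a = Y *m rp w1 a *m pj B.
  have YT : Y *m pj T' = 0 by rewrite -(Rv_r YR) -mulmxA pj_disj ?mulmx0 // disjoint_sym.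
  by rewrite ffunE mulmxDr !mulmxA YT !mul0mx add0r (Rv_r YR).
have BX' : pj B *m X' = X' by rewrite -{2}(Rv_l X'R) (pjD TS) mulmxDl TX' add0r.
have X'B : X' \in Rv B W.
  have := Rv_pj B W X'R; rewrite BX' (Rv_r X'R).
  by apply: Rv_sub; rewrite ?finset.subsetIr.
(* [X'] is a morphism from the quotient to K^W, so composing with it sends null vectors [Y] to null
   vectors of the injective delta on T' and W. *)
have YX'R : Y *m X' \in Rv T' W by apply: Rv_mul YR X'B.
have YX'0 : Y *m X' = 0.
  apply: (rk_inj (w := w)) YX'R _; first by rewrite injT'.
  apply/ffunP => a; rewrite !ffunE.
  have e1 : pj T' *m rp w a *m Y = Y *m rp w1 a *m pj B.
    have := congr1 (fun y : repr => y a) Y0; rewrite !ffunE rpu.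
    rewrite uY Yu mulmxBr mulmxBl !mulmxA pjI finset.setIid (Rv_l YR).
    rewrite -[_ *m Y *m pj B]mulmxA (Rv_r YR) -[_ *m pj B *m pj B]mulmxA pjI finset.setIid.
    by move/eqP; rewrite subr_eq0 => /eqP.
  have e2 : X' *m rp w1 a *m pj W = pj S *m rp w1 a *m X'.
    have := congr1 (fun y : repr => y a) X'0; rewrite !ffunE mulmxBr mulmxBl.
    rewrite !mulmxA (Rv_l X'R) -[_ *m X' *m pj W]mulmxA (Rv_r X'R).
    by move/eqP; rewrite subr_eq0 => /eqP.
  have e3 : X' *m rp w1 a *m pj W = X' *m rp w a *m pj W.
    have [WZ ZW] := pjW_l TS ZR.
    rewrite -(Rv_r X'R) (cj_rp _ _ ZR) -!mulmxA [pj W *m (_ *m _)]mulmxA WZ ZW.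
    by rewrite !mulmxA.
  have YS : Y *m pj S = Y by rewrite -(Rv_r YR) -mulmxA pj_sub // finset.subsetDl.
  rewrite mulmxBr mulmxBl !mulmxA e1 -[Y *m rp w1 a *m pj B *m X']mulmxA BX'.
  have -> : pj T' *m Y *m X' *m rp w a *m pj W = Y *m rp w1 a *m X'.
    rewrite (Rv_l YR) -!mulmxA [X' *m (_ *m _)]mulmxA -e3 e2 !mulmxA.
    by rewrite YS.
  by rewrite -[_ *m X' *m pj W]mulmxA (Rv_r X'R) subrr.
have : Y *m pj B = 0.
  by apply/row_matrixP => i; rewrite row_mul X'_inj ?row0 // -row_mul YX'0 row0.
by rewrite (Rv_r YR).
Qed.

End Kernel.

End DisjointBlocks.

Lemma setD_split (A B C : {set 'I_m}) : A \subset B -> B \subset C ->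
  C :\: A = (B :\: A) :|: (C :\: B) /\ [disjoint B :\: A & C :\: B].
Proof.
move=> /subsetP AB /subsetP BC; split.
  apply/setP => i; rewrite !inE; have /implyP := AB i; have /implyP := BC i.
  by case: (i \in A); case: (i \in B); case: (i \in C).
rewrite disjoints_subset; apply/subsetP => i; rewrite !inE negb_and negbK.
by case/andP=> _ ->.
Qed.

Lemma card_Rm_split (D A B C : {set 'I_m}) : A \subset B -> B \subset C ->
  (#|Rm D (C :\: A)| = #|Rm D (B :\: A)| + #|Rm D (C :\: B)|)%N.
Proof.
move=> AB BC; have [-> dBC] := setD_split AB BC.
rewrite -(cardID (fun ij : 'I_m * 'I_m => ij.2 \in B :\: A)); congr (_ + _)%N.
  apply: eq_card => -[i j].
  change (Rm D (B :\: A :|: C :\: B) (i, j) && (j \in B :\: A) = Rm D (B :\: A) (i, j)).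
  by rewrite /Rm /= in_setU; case: (i \in D); case: (j \in B :\: A); rewrite ?andbF ?andbT.
apply: eq_card => -[i j].
change ((j \notin B :\: A) && Rm D (B :\: A :|: C :\: B) (i, j) = Rm D (C :\: B) (i, j)).
rewrite /Rm /= in_setU; case jB: (j \in B :\: A) => //=.
by rewrite (disjointFr dBC jB) andbF.
Qed.

Lemma card_Hm_split (D A B C : {set 'I_m}) : A \subset B -> B \subset C ->
  (#|Hm D (C :\: A)| = #|Hm D (B :\: A)| + #|Hm D (C :\: B)|)%N.
Proof.
move=> AB BC; have [-> dBC] := setD_split AB BC.
rewrite -(cardID (fun x : arrow Q * ('I_m * 'I_m) => x.2.2 \in B :\: A)).
congr (_ + _)%N.
  apply: eq_card => -[a [i j]].
  change (Hm D (B :\: A :|: C :\: B) (a, (i, j)) && (j \in B :\: A) = Hm D (B :\: A) (a, (i, j))).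
  by rewrite /Hm /= in_setU; case: (i \in D); case: (j \in B :\: A); rewrite ?andbF ?andbT.
apply: eq_card => -[a [i j]].
change ((j \notin B :\: A) && Hm D (B :\: A :|: C :\: B) (a, (i, j)) = Hm D (C :\: B) (a, (i, j))).
rewrite /Hm /= in_setU; case jB: (j \in B :\: A) => //=.
by rewrite (disjointFr dBC jB) andbF.
Qed.

(* Iterating the kernel of a generic null vector of [delta]. *)
Lemma nowhere_surj_subspace (W S : {set 'I_m}) : [disjoint S & W] -> nowhere_surj S W ->
  exists T, [/\ T \subset S, dense T S,
    (#|Rm T (S :\: T)| <= #|Hm T (S :\: T)|)%N &
    (#|Rm T W| < #|Hm T W|)%N].
Proof.
move=> dSW nsSW.
(* The induction carries two facts about one T: delta to K^W is nowhere onto, and it is injective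
   somewhere. Together they give the strict inequality. *)
suff [T [TS dT rhT nsT [w injT]]] : exists T, [/\ T \subset S, dense T S,
    (#|Rm T (S :\: T)| <= #|Hm T (S :\: T)|)%N, nowhere_surj T W &
    exists w, rk T W w = #|Rm T W|].
  by exists T; split=> //; rewrite -injT; apply: nsT.
have [n] := ubnP #|S|; elim: n => // n IH in S dSW nsSW *; rewrite ltnS => Sn.
have [w0 w0gen] := generic_repr S W.
have [inj|ninj] := eqVneq (rk S W w0) #|Rm S W|.
  exists S; split=> //; [exact: dense_refl | | by exists w0].
  rewrite finset.setDv (_ : #|Rm S finset.set0| = 0%N) //.
  by apply: eq_card0 => -[i j]; rewrite unfold_in /Rm /= finset.in_set0 andbF.
have [X [XR X0 Xn0]] : exists X, [/\ X \in Rv S W, dlt S W w0 X = 0 & X != 0].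
  apply: contrapT => h; move/eqP: ninj; apply; apply: inj_rk => X XR X0.
  by apply/eqP; apply: contrapT => /negP Xn0; apply: h; exists X.
have [T [Z [TS ZR kerX kerX_sub]]] := kernel_form XR.
have dTW : [disjoint T & W] by apply: disjointWl dSW.
(* As delta kills [X], the kernel of [X] is stable under [w0]; genericity of [w0] turns this single
   instance into density. *)
have dT : dense T S.
  apply: (w0gen T).1; exists Z => // a.
  have TZS : (pj T + Z) *m pj S = pj T + Z.
    by rewrite mulmxDl (pj_sub TS) -(Rv_r ZR) -mulmxA pj_sub // finset.subsetDl.
  have e : pj S *m rp w0 a *m X = X *m rp w0 a *m pj W.
    have := congr1 (fun y : repr => y a) X0; rewrite !ffunE mulmxBr mulmxBl.
    rewrite !mulmxA (Rv_l XR) -[_ *m X *m pj W]mulmxA (Rv_r XR).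
    by move/eqP; rewrite subr_eq0 => /eqP.
  have SF : pj S *m (pj (S :\: T) - Z) = pj (S :\: T) - Z.
    by rewrite mulmxBr pj_subr ?finset.subsetDl // -(Rv_l ZR) mulmxA pj_subr.
  rewrite -SF mulmxA; apply/row_matrixP => i; rewrite row_mul row0.
  apply: kerX_sub; first by rewrite -row_mul -mulmxA pjI finset.setIid.
  have eX : (pj T + Z) *m rp w0 a *m pj S *m X = 0.
    rewrite -TZS -!mulmxA (Rv_l XR) [pj S *m _]mulmxA e -!mulmxA mulmxA kerX.
    by rewrite mul0mx.
  by rewrite -row_mul eX row0.
have Tlt : (#|T| < #|S|)%N.
  rewrite ltnNge; apply/negP => ST; case/eqP: Xn0.
  have TE : T = S by apply/eqP; rewrite eqEcard TS.
  have Z0 : Z = 0 by rewrite -(Rv_r ZR) TE finset.setDv pj0 mulmx0.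
  by rewrite -(Rv_l XR) -TE -[pj T]addr0 -Z0 kerX.
have nsT : nowhere_surj T W.
  move=> u; apply: leq_ltn_trans ((w0gen T).2 u) _.
  by apply: (kernel_nowhere_surj dSW TS ZR XR X0 kerX kerX_sub); first exact: (w0gen S).2.
have [T' [T'T dT' rhT' nsT' [w1 injT']]] := IH T dTW nsT (leq_trans Tlt Sn).
exists T'; split=> //; [exact: subset_trans TS | exact: dense_trans dT | | by exists w1].
(* [w0] has maximal rank on every T, so the injectivity found at [w1] holds at [w0], where the null
   vector [X] lives. *)
have injT'0 : rk T' W w0 = #|Rm T' W|.
  by apply/eqP; rewrite eqn_leq rk_le_Rm -injT' (w0gen T').2.
have hq := kernel_quotient dSW TS ZR XR X0 kerX kerX_sub T'T injT'0.
by rewrite (card_Rm_split T' T'T TS) (card_Hm_split T' T'T TS) leq_add.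
Qed.

End Model.

From mathcomp Require Import classical_sets.

(** * Places *)

Section PartialMorphismDef.
Context {K L : fieldType} (iota : {rmorphism K -> L}).
Local Open Scope classical_set_scope.

(* The graph of a [K]-algebra morphism from a subalgebra of [L] to [K]. *)
Definition phom (G : set (L * K)) : Prop :=
  [/\ forall c, G (iota c, c),
      forall x y a b, G (x, a) -> G (y, b) -> G (x + y, a + b),
      forall x y a b, G (x, a) -> G (y, b) -> G (x * y, a * b) &
      forall a, G (0, a) -> a = 0].

End PartialMorphismDef.

Section Places.
Context {K : closedFieldType} {L : fieldType} (iota : {rmorphism K -> L}).
Local Open Scope classical_set_scope.

Lemma phom_maximal G0 : phom iota G0 -> exists G, [/\ phom iota G, G0 `<=` G &
  forall G', phom iota G' -> G `<=` G' -> G' `<=` G].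
Proof.
(* Zorn runs over the sets whose union with [G0] is a partial morphism, so that the empty chain is
   bounded too. *)
move=> G0P; have [|A [AP Amax]] := @Zorn_bigcup _ (fun X => phom iota (X `|` G0)).
  move=> F FP Ftot; set B := \bigcup_(X in F) X.
  have two z1 z2 : (B `|` G0) z1 -> (B `|` G0) z2 -> exists G,
      [/\ phom iota G, G z1, G z2 & G `<=` B `|` G0].
    have sub X : F X -> X `|` G0 `<=` B `|` G0.
      by move=> FX z [Xz|]; [left; exists X | right].
    move=> [[X FX Xz1]|G0z1] [[Y FY Yz2]|G0z2].
    - have [XY|YX] := Ftot X Y FX FY.
        by exists (Y `|` G0); split; [exact: FP|by left; apply: XY|by left|exact: sub].
      by exists (X `|` G0); split; [exact: FP|by left|by left; apply: YX|exact: sub].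
    - by exists (X `|` G0); split; [exact: FP|by left|by right|exact: sub].
    - by exists (Y `|` G0); split; [exact: FP|by right|by left|exact: sub].
    - by exists G0; split=> // z; right.
  have [G0c _ _ _] := G0P; split.
  - by move=> c; right.
  - by move=> x y a b /two h /h[G [[_ GD _ _] Gx Gy]]; apply; apply: GD.
  - by move=> x y a b /two h /h[G [[_ _ GM _] Gx Gy]]; apply; apply: GM.
  - by move=> a Ba; have [G [[_ _ _ G0f] /G0f]] := two _ _ Ba Ba.
exists (A `|` G0); split; [exact: AP | by move=> z; right |].
move=> G' G'P AG'; apply: contrapT => nG'A; apply: (Amax G').
  split; first by move=> z Az; apply: AG'; left.
  by move=> nAG; apply: nG'A => z /nAG; left.
suff -> : G' `|` G0 = G' by [].
by apply/seteqP; split=> z; [case=> // G0z; apply: AG'; right | left].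
Qed.

Section Maximal.
Variable G : set (L * K).
Hypothesis GP : phom iota G.
Hypothesis Gmax : forall G', phom iota G' -> G `<=` G' -> G' `<=` G.

Let Gc c : G (iota c, c). Proof. by case: GP. Qed.
Let GD x y a b : G (x, a) -> G (y, b) -> G (x + y, a + b).
Proof. by case: GP => _ h _ _; apply: h. Qed.
Let GM x y a b : G (x, a) -> G (y, b) -> G (x * y, a * b).
Proof. by case: GP => _ _ h _; apply: h. Qed.
Let G0 a : G (0, a) -> a = 0.
Proof. by case: GP => _ _ _ h; apply: h. Qed.
Let G00 : G (0, 0). Proof. by rewrite -{1}(rmorph0 iota). Qed.
Let G11 : G (1, 1). Proof. by rewrite -{1}(rmorph1 iota). Qed.
Let GN x a : G (x, a) -> G (- x, - a).
Proof.
move=> Gx; rewrite -mulN1r -[- a]mulN1r; apply: GM => //.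
by rewrite -{1}(rmorph1 iota) -rmorphN.
Qed.

(** Extend to the localisation at the powers of [x]; by maximality nothing is added. *)
Lemma phom_inv x a : G (x, a) -> a != 0 -> G (x^-1, a^-1).
Proof.
move=> Gx a0; have x0 : x != 0.
  by apply: contraNneq a0 => x0; apply/eqP/G0; rewrite -x0.
pose G' : set (L * K) := [set z | exists k y c, [/\ G (y, c), z.1 = y / x ^+ k & z.2 = c / a ^+ k]].
have GX k : G (x ^+ k, a ^+ k).
  by elim: k => [|k IH]; rewrite ?expr0 // !exprS; apply: GM.
have xk k : x ^+ k != 0 by rewrite expf_neq0.
have ak k : a ^+ k != 0 by rewrite expf_neq0.
have sub : G' `<=` G.
  apply: Gmax; last first.
    by move=> [y c] Gy; exists 0%N, y, c; rewrite !expr0 !divr1.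
  split.
  - by move=> c; exists 0%N, (iota c), c; rewrite !expr0 !divr1.
  - move=> _ _ _ _ [k [y [c [Gy /= -> ->]]]] [l [z [d [Gz /= -> ->]]]].
    exists (k + l)%N, (y * x ^+ l + z * x ^+ k), (c * a ^+ l + d * a ^+ k); split.
    + by apply: GD; apply: GM.
    + by rewrite /= exprD addf_div // mulrC.
    + by rewrite /= exprD addf_div // mulrC.
  - move=> _ _ _ _ [k [y [c [Gy /= -> ->]]]] [l [z [d [Gz /= -> ->]]]].
    exists (k + l)%N, (y * z), (c * d); split; first exact: GM.
      by rewrite /= exprD mulf_div.
    by rewrite /= exprD mulf_div.
  - move=> _ [k [y [c [Gy /= y0 ->]]]].
    have {}y0 : y = 0.
      by move/eqP: y0; rewrite eq_sym mulf_eq0 invr_eq0 (negPf (xk k)) orbF => /eqP.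
    by rewrite (G0 (a := c)) ?mul0r // -y0.
by apply: sub; exists 1%N, 1, 1; rewrite !expr1 !mul1r.
Qed.

Definition Gpoly (F : {poly L}) (f : {poly K}) : Prop := forall i, G (F`_i, f`_i).

Let Gsum n (u : 'I_n -> L) (v : 'I_n -> K) :
  (forall i, G (u i, v i)) -> G (\sum_i u i, \sum_i v i).
Proof.
move=> uv; elim/big_rec2: _ => // i y x _ Gx; exact: GD.
Qed.

Lemma GpolyD F f H h : Gpoly F f -> Gpoly H h -> Gpoly (F + H) (f + h).
Proof. by move=> Ff Hh i; rewrite !coefD; apply: GD. Qed.

Lemma GpolyM F f H h : Gpoly F f -> Gpoly H h -> Gpoly (F * H) (f * h).
Proof.
by move=> Ff Hh i; rewrite !coefM; apply: Gsum => j; apply: GM.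
Qed.

Lemma GpolyC x a : G (x, a) -> Gpoly x%:P a%:P.
Proof. by move=> Gx i; rewrite !coefC; case: eqP. Qed.

Lemma GpolyXn k : Gpoly 'X^k 'X^k.
Proof. by move=> i; rewrite !coefXn; case: eqP. Qed.

Lemma Gpoly_map (f : {poly K}) : Gpoly (map_poly iota f) f.
Proof. by move=> i; rewrite coef_map; apply: Gc. Qed.

(* [x] can be added to the domain as soon as no polynomial relation satisfied
   by [x] reduces to the constant [1]: a common root of the reductions gives
   the image of [x]. *)
Lemma phom_adjoin x :
  (forall F, Gpoly F 1 -> F.[x] != 0) -> exists a, G (x, a).
Proof.
(* [I] collects the reductions of the relations of [x]. It is closed under remainders, so a nonzero
   element of least size divides all others. *)
move=> no1; pose I f := exists2 F, Gpoly F f & F.[x] = 0.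
have Imod f h : I f -> I h -> I (f %% h).
  move=> [F Ff F0] [H Hh H0]; pose q := - (f %/ h).
  exists (F + map_poly iota q * H).
    rewrite (_ : f %% h = f + q * h); first exact: GpolyD (GpolyM (Gpoly_map q) Hh).
    by rewrite mulNr {2}(divp_eq f h) addrAC subrr add0r.
  by rewrite hornerD hornerM F0 H0 mulr0 addr0.
have [a aI] : exists a, forall f, I f -> f.[a] = 0.
  have [[g0 [Ig0 g00]]|h] := pselect (exists g, I g /\ g != 0); last first.
    exists 0 => f If; suff -> : f = 0 by rewrite horner0.
    by apply: contrapT => /eqP f0; apply: h; exists f.
  have exg : exists n, `[< exists g, [/\ I g, g != 0 & size g = n] >].
    by exists (size g0); apply/asboolP; exists g0.
  case: (ex_minnP exg) => n /asboolP[g [Ig gn0 sg]] nmin.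
  have dvd f : I f -> g %| f.
    move=> If; apply/modp_eq0P; apply: contrapT => /eqP r0.
    have := nmin (size (f %% g)); rewrite leqNgt -sg ltn_modp gn0 => h.
    by have /h : `[< exists h, [/\ I h, h != 0 & size h = size (f %% g)] >]
      by apply/asboolP; exists (f %% g); split=> //; apply: Imod.
  (* A constant generator could be scaled to a relation of [x] that reduces to 1. *)
  have sg1 : size g != 1%N.
    apply/negP => /size_poly1P[c c0 gE]; have [F Fg F0] := Ig.
    have := no1 ((iota c^-1)%:P * F); rewrite hornerM F0 mulr0 eqxx => /(_ _)/negP; apply => //.
    have := GpolyM (GpolyC (Gc c^-1)) Fg.
    by rewrite gE -polyCM mulVf.
  have [a ra] := closed_rootP g sg1.
  exists a => f /dvd /dvdpP[q ->]; rewrite hornerM.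
  by move/rootP: ra => ->; rewrite mulr0.
pose G' : set (L * K) := [set z | exists F f, [/\ Gpoly F f, z.1 = F.[x] & z.2 = f.[a]]].
have sub : G' `<=` G.
  apply: Gmax; last first.
    by move=> [y c] Gy; exists y%:P, c%:P; rewrite !hornerC; split=> //; exact: GpolyC.
  split.
  - by move=> c; exists (iota c)%:P, c%:P; rewrite !hornerC; split=> //; exact: GpolyC.
  - move=> _ _ _ _ [F [f [Ff /= -> ->]]] [H [h [Hh /= -> ->]]].
    by exists (F + H), (f + h); rewrite !hornerD; split=> //; exact: GpolyD.
  - move=> _ _ _ _ [F [f [Ff /= -> ->]]] [H [h [Hh /= -> ->]]].
    by exists (F * H), (f * h); rewrite !hornerM; split=> //; exact: GpolyM.
  - by move=> _ [F [f [Ff /= F0 ->]]]; apply: aI; exists F.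
exists a; apply: sub; exists 'X, 'X; rewrite !hornerX; split=> //.
exact: (GpolyXn 1).
Qed.

(** Otherwise both [x] and its inverse satisfy relations reducing to 1: the constant coefficient
    maps to 1, the others to 0. The longer relation can be shortened by the reversal of the other, a
    descent on the total size. *)
Lemma phom_valuation x : x != 0 ->
  (exists a, G (x, a)) \/ (exists a, G (x^-1, a)).
Proof.
move=> x0; apply: contrapT => /not_orP[nx nxV].
have rel y : ~ (exists a, G (y, a)) -> exists2 F, Gpoly F 1 & F.[y] = 0.
  move=> ny; apply: contrapT => h; apply: ny; apply: phom_adjoin => F F1.
  by apply/eqP => Fy; apply: h; exists F.
have [F F1 Fx] := rel _ nx; have [H H1 Hx] := rel _ nxV.
have [n] := ubnP (size F + size H)%N.
elim: n => // n IH in x x0 nx nxV F F1 Fx H H1 Hx *; rewrite ltnS.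
wlog sHF : x x0 nx nxV F F1 Fx H H1 Hx / (size H <= size F)%N => [wl|sn].
  have [le|/ltnW le] := leqP (size H) (size F).
    exact: (wl x x0 nx nxV F F1 Fx H H1 Hx le).
  rewrite addnC; apply: (wl x^-1 _ nxV _ H H1 Hx F F1 _ le); rewrite ?invr_eq0 ?invrK //.
(* the top coefficient of [F] is cancelled by the reversal of [H] *)
pose s := size H; pose R : {poly L} := \poly_(i < s) H`_(s.-1 - i).
have H00 : H`_0 != 0.
  have := H1 0%N; rewrite coef1 eqxx; apply: contraPneq => -> /G0 /eqP.
  by rewrite oner_eq0.
have H0inv : G ((H`_0)^-1, 1).
  by have := H1 0%N; rewrite coef1 eqxx => /phom_inv; rewrite invr1; apply; apply: oner_neq0.
have s0 : (0 < s)%N.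
  by rewrite lt0n size_poly_eq0; apply: contraNneq H00 => ->; rewrite coef0.
have Rx : R.[x] = 0.
  have -> : R.[x] = x ^+ s.-1 * H.[x^-1].
    rewrite horner_poly horner_coef mulr_sumr (reindex_inj rev_ord_inj) /=.
    apply: eq_bigr => i _; have := ltn_ord i; rewrite -/s => ilt.
    rewrite (_ : (s.-1 - (s - i.+1))%N = i); last by lia.
    rewrite mulrCA; congr (_ * _); rewrite exprVn.
    rewrite (_ : (s - i.+1)%N = (s.-1 - i)%N); last by lia.
    by rewrite expfB_cond // (negPf x0); lia.
  by rewrite Hx mulr0.
(* The shift aligns the reversed constant term of [H] with the top term of [F]. As the top
   coefficient of [F] maps to 0, so does [e], and [F'] still reduces to 1. *)
pose e := F`_(size F).-1 / H`_0; pose F' := F - e *: ('X^(size F - s) * R).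
have sF1 : (1 < size F)%N.
  rewrite ltnNge; apply/negP => /size1_polyC FE.
  have := F1 0%N; rewrite coef1 eqxx -(hornerC F`_0 x) -FE Fx => /G0 /eqP.
  by rewrite oner_eq0.
have Ge : G (e, 0).
  have := GM (F1 (size F).-1) H0inv; rewrite mulr1 coef1.
  by rewrite (_ : ((size F).-1 == 0%N) = false) //; lia.
have R_G : Gpoly R (\poly_(i < s) ((1 : {poly K})`_(s.-1 - i))).
  by move=> i; rewrite !coef_poly; case: ifP.
have F'1 : Gpoly F' 1.
  rewrite -[1]addr0 -oppr0 -[X in - X](scale0r ('X^(size F - s) * \poly_(i < s) ((1 : {poly K})`_(s.-1 - i)))).
  rewrite /F' -!scaleNr -!mul_polyC; apply: GpolyD => //; apply: GpolyM.
    by apply: GpolyC; apply: GN.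
  by apply: GpolyM => //; apply: GpolyXn.
have F'x : F'.[x] = 0 by rewrite hornerD hornerN hornerZ hornerM Rx !mulr0 Fx subr0.
apply: (IH x x0 nx nxV F' F'1 F'x H H1 Hx).
suff : (size F' < size F)%N by move: sn; rewrite -/s; lia.
rewrite -(ltn_predK sF1) ltnS; apply/leq_sizeP => j hj.
have sF : (s <= size F)%N by [].
have jF : (j != (size F).-1) -> (size F <= j)%N by move=> jn; rewrite -(ltn_predK sF1) ltn_neqAle eq_sym jn.
rewrite coefB coefZ coefXnM (_ : (j < size F - s)%N = false); last by lia.
rewrite coef_poly; have [jE|/jF jn] := eqVneq j (size F).-1.
  rewrite (_ : (j - (size F - s) < s)%N); last by lia.
  rewrite (_ : (s.-1 - (j - (size F - s)))%N = 0%N); last by lia.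
  by rewrite jE /e divfK // subrr.
rewrite (_ : (j - (size F - s) < s)%N = false); last by lia.
by rewrite mulr0 subr0 nth_default.
Qed.

End Maximal.

Theorem place_extension G0 : phom iota G0 -> exists G, [/\ phom iota G, G0 `<=` G &
  forall x, x != 0 -> (exists a, G (x, a)) \/ (exists a, G (x^-1, a))].
Proof.
move=> /phom_maximal[G [GP G0G Gmax]]; exists G; split=> //.
exact: phom_valuation.
Qed.

End Places.

(** * Partial morphisms on matrices and polynomials *)

Section PartialMorphisms.
Context {K : numFieldType} {L : fieldType} {iota : {rmorphism K -> L}} {G : set (L * K)}.
Hypothesis GP : phom iota G.

Let Gc c : G (iota c, c). Proof. by case: GP. Qed.
Let GD x y a b : G (x, a) -> G (y, b) -> G (x + y, a + b).
Proof. by case: GP => _ h _ _; apply: h. Qed.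
Let GM x y a b : G (x, a) -> G (y, b) -> G (x * y, a * b).
Proof. by case: GP => _ _ h _; apply: h. Qed.
Let G00 : G (0, 0). Proof. by rewrite -{1}(rmorph0 iota). Qed.
Let G11 : G (1, 1). Proof. by rewrite -{1}(rmorph1 iota). Qed.

Lemma phomN x a : G (x, a) -> G (- x, - a).
Proof.
move=> Gx; rewrite -mulN1r -[- a]mulN1r; apply: GM => //.
by rewrite -{1}(rmorph1 iota) -rmorphN; apply: Gc.
Qed.

Lemma phom_unique x a b : G (x, a) -> G (x, b) -> a = b.
Proof.
move=> Ga /phomN Gb; apply/eqP; rewrite -subr_eq0; apply/eqP.
by case: GP => _ _ _; apply; rewrite -[X in (X, _)](subrr x); apply: GD.
Qed.

Lemma phom_sum (I : Type) (r : seq I) (P : pred I) (u : I -> L) (v : I -> K) :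
  (forall i, G (u i, v i)) -> G (\sum_(i <- r | P i) u i, \sum_(i <- r | P i) v i).
Proof. by move=> uv; elim/big_rec2: _ => // i y x _ Gx; apply: GD. Qed.

Lemma phom_prod (I : Type) (r : seq I) (P : pred I) (u : I -> L) (v : I -> K) :
  (forall i, G (u i, v i)) -> G (\prod_(i <- r | P i) u i, \prod_(i <- r | P i) v i).
Proof. by move=> uv; elim/big_rec2: _ => // i y x _ Gx; apply: GM. Qed.

Lemma phom_meval n (p : {mpoly K[n]}) (u : 'I_n -> L) (v : 'I_n -> K) :
  (forall i, G (u i, v i)) -> G (mmap iota u p, p.@[v]).
Proof.
move=> uv; move: p; apply: mpoly_ring_ind => [c|i|p q Gp Gq|p q Gp Gq].
- by rewrite mmapC mevalC; apply: Gc.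
- by rewrite mmapX mmap1U mevalXU.
- by rewrite mmapD mevalD; apply: GD.
- by rewrite rmorphM mevalM; apply: GM.
Qed.

Definition mxphom m n (M : 'M[L]_(m, n)) (N : 'M[K]_(m, n)) : Prop :=
  forall i j, G (M i j, N i j).

Lemma mxphom_map m n (N : 'M[K]_(m, n)) : mxphom (map_mx iota N) N.
Proof. by move=> i j; rewrite mxE; apply: Gc. Qed.

Lemma mxphomD m n (M M' : 'M[L]_(m, n)) N N' :
  mxphom M N -> mxphom M' N' -> mxphom (M + M') (N + N').
Proof. by move=> h h' i j; rewrite !mxE; apply: GD. Qed.

Lemma mxphomB m n (M M' : 'M[L]_(m, n)) N N' :
  mxphom M N -> mxphom M' N' -> mxphom (M - M') (N - N').
Proof. by move=> h h' i j; rewrite !mxE; apply: GD => //; apply: phomN. Qed.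

Lemma mxphomM m n p (M : 'M[L]_(m, n)) (M' : 'M[L]_(n, p)) N N' :
  mxphom M N -> mxphom M' N' -> mxphom (M *m M') (N *m N').
Proof. by move=> h h' i j; rewrite !mxE; apply: phom_sum => k; apply: GM. Qed.

Lemma phom_det n (M : 'M[L]_n) N : mxphom M N -> G (\det M, \det N).
Proof.
move=> MN; apply: phom_sum => s; apply: GM; last exact: phom_prod.
by rewrite -(rmorph_sign iota); apply: Gc.
Qed.

Lemma mxphom_adj n (M : 'M[L]_n) N : mxphom M N -> mxphom (\adj M) (\adj N).
Proof.
move=> MN i j; rewrite !mxE; apply: GM; first by rewrite -(rmorph_sign iota); apply: Gc.
by apply: phom_det => k l; rewrite !mxE.
Qed.

End PartialMorphisms.

(** [P] does not depend on [G], so the same element [P M] can be evaluated at all points and at a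
    place. *)
Lemma phom_polyf (K : numFieldType) (L : fieldType) (iota : {rmorphism K -> L}) m
    (p : 'M[K]_m -> K) : polyf p ->
  exists P : 'M[L]_m -> L, forall G, phom iota G -> forall M N,
    mxphom (G := G) M N -> G (P M, p N).
Proof.
move=> [d [q _ pq]].
exists (fun M => mmap iota (fun i => \sum_k \sum_l M k l * iota (v2r (delta_mx k l : 'M[K]_m) 0 i)) q).
move=> G GP M N MN; rewrite pq; apply: (phom_meval GP) => i.
rewrite [in v2r N](matrix_sum_delta N) linear_sum summxE /=.
apply: (phom_sum GP) => k; rewrite linear_sum summxE /=; apply: (phom_sum GP) => l.
by rewrite linearZ mxE; case: GP => Gc _ GM _; apply: GM.
Qed.

Section Maximum.
Context {K L : fieldType} {iota : {rmorphism K -> L}} {G : set (L * K)}.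
Hypothesis GP : phom iota G.
Hypothesis Gval : forall x, x != 0 -> (exists a, G (x, a)) \/ (exists a, G (x^-1, a)).

(** Finiteness of the quotient is a total preorder on nonzero elements, so a finite family has a
    largest one. *)
Lemma place_max (I : finType) (P : pred I) (d : I -> L) i0 : P i0 -> d i0 != 0 ->
  exists i, [/\ P i, d i != 0 & forall j, P j -> exists c, G (d j / d i, c)].
Proof.
move=> Pi0 di0; have [Gc GD GM _] := GP.
suff h : forall s : seq I, exists i, [/\ P i, d i != 0 &
    forall j, j \in s -> P j -> exists c, G (d j / d i, c)].
  have [i [Pi di h']] := h (enum I); exists i; split=> // j.
  by apply: h'; rewrite mem_enum.
elim=> [|j s [i [Pi di IH]]]; first by exists i0.
have same : (P j -> exists c, G (d j / d i, c)) -> exists i, [/\ P i, d i != 0 &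
    forall j', j' \in j :: s -> P j' -> exists c, G (d j' / d i, c)].
  move=> ji; exists i; split=> // j'; rewrite inE => /orP[/eqP -> //|]; exact: IH.
have [dj|dj] := eqVneq (d j) 0.
  by apply: same => _; exists 0; rewrite dj mul0r -(rmorph0 iota).
case: (boolP (P j)) => Pj; last by apply: same => Pj'; rewrite Pj' in Pj.
have [|ji|[c jic]] := @Gval (d j / d i); first by rewrite mulf_neq0 ?invr_eq0.
  by apply: same.
exists j; split=> // j'; rewrite inE => /orP[/eqP -> _|/IH h /h[c' j'i]].
  by exists 1; rewrite divff // -(rmorph1 iota).
exists (c' * c); suff -> : d j' / d j = d j' / d i * (d j / d i)^-1 by apply: GM.
by rewrite invf_div mulrA divfK.
Qed.

End Maximum.

Local Notation "x %:F" := (@FracField.tofrac _ x).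

(** * The function field of a vector space *)

Section Fractions.
Import generic_quotient FracField.
Local Open Scope quotient_scope.

Lemma frac_eq (R : idomainType) (x : {fraction R}) :
  exists2 nd : R * R, nd.2 != 0 & x = nd.1%:F / nd.2%:F.
Proof.
elim/quotW: x => r; exists (frac r); first exact: denom_ratioP.
have d0 : (frac r).2%:F != 0 by rewrite tofrac_eq0 denom_ratioP.
apply: (mulIf d0); rewrite divfK //; unlock FracField.tofrac; rewrite -[LHS]pi_mul.
apply/eqmodP; rewrite /= equivfE /mulf !numden_Ratio ?oner_neq0 ?mulr1 ?denom_ratioP //.
by rewrite mulrC.
Qed.

End Fractions.

Section GenericPoint.
Context {K : numFieldType} {U : vectType K}.

Notation ratf := {fraction {mpoly K[dim U]}}.

Definition ratf_const : {rmorphism K -> ratf} := [the {rmorphism K -> ratf} of (@FracField.tofrac _ \o @mpolyC (dim U) K)].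

(* The value at [u] of a rational function whose denominator does not vanish there. *)
Definition value_at (u : U) : set (ratf * K) := [set z | exists p q,
  [/\ q.@[v2r u 0] != 0, z.1 = p%:F / q%:F & z.2 = p.@[v2r u 0] / q.@[v2r u 0]]]%classic.

Lemma meval_neq0 (q : {mpoly K[dim U]}) u : q.@[v2r u 0] != 0 -> q%:F != 0.
Proof. by rewrite tofrac_eq0; apply: contraNneq => ->; rewrite meval0. Qed.

Lemma value_at_phom u : phom ratf_const (value_at u).
Proof.
split.
- by move=> c; exists c%:MP, 1%:MP; rewrite /= !mevalC mpolyC1 tofrac1 !divr1 oner_neq0.
- move=> _ _ _ _ [p [q [q0 /= -> ->]]] [p' [q' [q'0 /= -> ->]]].
  exists (p * q' + p' * q), (q * q').
  rewrite /= mevalD !mevalM tofracD !tofracM; split; first exact: mulf_neq0.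
    exact: addf_div (meval_neq0 q0) (meval_neq0 q'0).
  exact: addf_div q0 q'0.
- move=> _ _ _ _ [p [q [q0 /= -> ->]]] [p' [q' [q'0 /= -> ->]]].
  exists (p * p'), (q * q').
  by rewrite /= !mevalM mulf_neq0 // !tofracM !mulf_div.
move=> _ [p [q [q0 /= p0 ->]]]; move/eqP: p0.
rewrite eq_sym mulf_eq0 invr_eq0 (negPf (meval_neq0 q0)) orbF tofrac_eq0 => /eqP ->.
by rewrite meval0 mul0r.
Qed.

Lemma value_atV u x c : value_at u (x, c) -> c != 0 -> value_at u (x^-1, c^-1).
Proof.
move=> [p [q [q0 /= -> ->]]]; rewrite mulf_eq0 negb_or => /andP[p0 _].
by exists q, p; rewrite p0 /= !invf_div.
Qed.

Lemma generic_value (f : U -> K) : polyf f -> exists x, forall u, value_at u (x, f u).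
Proof.
move=> [d [p _ fp]]; exists p%:F => u; exists p, 1%:MP.
by rewrite /= mevalC mpolyC1 tofrac1 !divr1 oner_neq0.
Qed.

Lemma generic_mx m n (M : U -> 'M[K]_(m, n)) : (forall i j, polyf (fun u => M u i j)) ->
  exists Mg : 'M[ratf]_(m, n), forall u, mxphom (G := value_at u) Mg (M u).
Proof.
move=> MP; pose c i j := cid (generic_value (MP i j)).
by exists (\matrix_(i, j) sval (c i j)) => u i j; rewrite mxE; apply: (svalP (c i j)).
Qed.

(** Identities over the function field can be checked on a nonempty open set: otherwise [f], the
    numerator and the denominator are nonzero at a common point. *)
Lemma ratf_vanish (x : ratf) (f : U -> K) u0 : polyf f -> f u0 != 0 ->
  (forall u, f u != 0 -> value_at u (x, 0)) -> x = 0.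
Proof.
move=> fP f0 fx; have [[n d] /= d0 xE] : exists2 nd, nd.2 != 0 & x = nd.1%:F / nd.2%:F.
  exact: frac_eq.
apply: contrapT => /eqP; rewrite xE mulf_eq0 negb_or tofrac_eq0 => /andP[n0 _].
have ev (p : {mpoly K[dim U]}) : p != 0 ->
    polyf (fun u : U => p.@[v2r u 0]) /\ exists u : U, p.@[v2r u 0] != 0.
  move=> p0; split; first by exists (msize p), p.
  apply: contrapT => h; move/eqP: p0; apply; apply: mpoly_fun0 => v.
  by apply: contrapT => /eqP pv; apply: h; exists (r2v v); rewrite r2vK.
have [nP [u1 nu1]] := ev n n0; have [dP [u2 du2]] := ev d d0.
have [u3 [fu3 nu3]] := polyf_domain fP nP f0 nu1.
have [|u [fnu du]] := polyf_domain (polyfM fP nP) dP _ du2 (u1 := u3).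
  by rewrite mulf_neq0.
move: fnu; rewrite mulf_eq0 negb_or => /andP[/fx fu nu].
have := phom_unique (value_at_phom u) fu (b := n.@[v2r u 0] / d.@[v2r u 0]).
move=> h; have : n.@[v2r u 0] / d.@[v2r u 0] != 0 by rewrite mulf_neq0 ?invr_eq0.
by rewrite -h ?eqxx // xE; exists n, d.
Qed.

End GenericPoint.

(** * Charts of Schubert cells *)

Section Evaluation.
Context {K : numFieldType}.

Lemma polyf_meval (U : vectType K) n (q : {mpoly K[n]}) (c : U -> 'I_n -> K) :
  (forall k, polyf (c^~ k)) -> polyf (fun u : U => q.@[c u]).
Proof.
move=> cP; move: q; apply: mpoly_ring_ind => [a|i|p q pP qP|p q pP qP].
- by exists 0%N; apply: (polyd_eq (polyd_const 0%N a)) => u; rewrite mevalC.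
- by have [d iP] := cP i; exists d; apply: (polyd_eq iP) => u; rewrite mevalXU.
- have [d pqP] := polyfD pP qP; exists d.
  by apply: (polyd_eq pqP) => u; rewrite mevalD.
- have [d pqP] := polyfM pP qP; exists d.
  by apply: (polyd_eq pqP) => u; rewrite mevalM.
Qed.

Lemma polyf_row n (f : 'rV[K]_n -> K) : polyf f ->
  exists q : {mpoly K[n]}, forall v, f v = q.@[v 0].
Proof.
move=> [d [p _ fp]].
pose lq := [tuple \sum_j v2r (delta_mx 0 j : 'rV[K]_n) 0 i *: 'X_j | i < dim 'rV[K]_n]
  : (dim 'rV[K]_n).-tuple {mpoly K[n]}.
exists (p \mPo lq) => v; rewrite comp_mpoly_meval fp; apply: meval_eq => i.
rewrite tnth_mktuple [in LHS](row_sum_delta v) linear_sum summxE raddf_sum /=.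
by apply: eq_bigr => j _; rewrite linearZ mxE mevalZ mevalXU mulrC.
Qed.

End Evaluation.

Section Chart.
Context {K : numFieldType} {Q : quiver} (V : vertex Q -> vectType K).
Variables (F : forall x, filtration (V x)) (S : subfamily V).
Context {m : nat} (col : 'I_m -> vertex Q) (ht : 'I_m -> nat) (A J : {set 'I_m}).
Variable crd : forall x, 'Hom(V x, 'rV[K]_m).
Variable dcr : forall x, 'Hom('rV[K]_m, V x).

Local Notation ev := (ev col).
Local Notation Rv := (Rv col ht).

(* Coordinates on the [V x] in bases adapted to the filtrations and to [S]:
   [V x] and [S x] are spanned by the basis vectors of colour [x] with index in
   [A] and [J], and the filtration is given by initial segments for [ht]. *)
Record adapted : Prop := Adapted {
  ad_inj : injective ht;
  ad_sub : J \subset A;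
  ad_dcrK : forall x u, dcr x (crd x u) = u;
  ad_crdK : forall x r, crd x (dcr x r) = r *m pj A *m ev x;
  ad_fil : forall x k, (k <= len (F x))%N -> exists c, forall u,
    u \in fil (F x) k <-> forall j, crd x u 0 j != 0 -> (ht j < c)%N;
  ad_fil_le : forall i, i \in A -> exists2 k, (k <= len (F (col i)))%N &
    forall u, u \in fil (F (col i)) k <->
      forall j, crd (col i) u 0 j != 0 -> (ht j <= ht i)%N;
  ad_fil_lt : forall i, i \in A -> exists2 k, (k <= len (F (col i)))%N &
    forall u, u \in fil (F (col i)) k <->
      forall j, crd (col i) u 0 j != 0 -> (ht j < ht i)%N;
  ad_S : forall x u, u \in S x <-> crd x u *m pj J = crd x u }.

Hypothesis ad : adapted.

Let crd_pj x u : crd x u = crd x u *m pj A *m ev x.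
Proof. by rewrite -(ad_crdK ad) (ad_dcrK ad). Qed.

Lemma crdA x u : crd x u *m pj A = crd x u.
Proof.
rewrite {1}crd_pj -!mulmxA pj_ev !mulmxA -[_ *m pj A *m pj A]mulmxA pjI.
by rewrite finset.setIid -crd_pj.
Qed.

Lemma crd_ev x u : crd x u *m ev x = crd x u.
Proof. by rewrite {1}crd_pj -mulmxA pjI finset.setIid -crd_pj. Qed.

Lemma crd_dcr x r : r *m pj A = r -> r *m ev x = r -> crd x (dcr x r) = r.
Proof. by move=> rA rx; rewrite (ad_crdK ad) rA rx. Qed.

Lemma crd_inj x : injective (crd x).
Proof. by move=> u v e; rewrite -(ad_dcrK ad u) e (ad_dcrK ad). Qed.

Lemma crd_neq0 x u j : crd x u 0 j != 0 -> (j \in A) /\ col j = x.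
Proof.
move=> uj; split.
  by apply: contraNT uj => jA; rewrite -crdA pjrE (negPf jA) mulr0.
by apply/eqP; apply: contraNT uj => jx; rewrite -crd_ev pjrE inE (negPf jx) mulr0.
Qed.

Local Notation B := (A :\: J).

(** The member K^J (1 + X) of the cell, given by equations: the part of a vector in K^B is the image
    under [X] of its part in K^J. *)
Definition gr X : subfamily V :=
  fun x => lker (linfun (mulmxr (pj B - X)) \o crd x)%VF.

Lemma mem_gr X x u : u \in gr X x <-> crd x u *m (pj B - X) = 0.
Proof. by rewrite memv_ker comp_lfunE lfunE; split=> /eqP. Qed.

Let BA : B \subset A. Proof. exact: finset.subsetDl. Qed.

Let crd_unip X x u : X \in Rv J B ->
  crd x (dcr x (crd x u *m (1%:M + X))) = crd x u *m (1%:M + X).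
Proof.
move=> XR; apply: crd_dcr.
  rewrite mulmxDr mulmx1 mulmxDl crdA; congr (_ + _).
  by rewrite -mulmxA -(Rv_r XR) -!mulmxA pj_sub.
by rewrite mulmxDr mulmx1 mulmxDl crd_ev -mulmxA -(Rv_ev _ XR) mulmxA crd_ev.
Qed.

Lemma gr_borel X : X \in Rv J B -> borel_orbit F S (gr X).
Proof.
move=> XR; have NXR : - X \in Rv J B by rewrite memvN.
pose g x : 'End(V x) := (dcr x \o linfun (mulmxr (1%:M + X)) \o crd x)%VF.
have gE x u : g x u = dcr x (crd x u *m (1%:M + X)) by rewrite !comp_lfunE lfunE.
have [XI IX] := unip_mul (disjD J A) XR.
exists g => [x|x].
  split=> [|k kF].
    apply/eqP; rewrite -subv0; apply/subvP => u; rewrite memv_ker gE memv0.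
    move=> /eqP /(congr1 (crd x)); rewrite crd_unip // linear0.
    move=> /(congr1 (mulmx^~ (1%:M - X))); rewrite /= mul0mx -mulmxA XI mulmx1.
    by move=> u0; apply/eqP; apply: (@crd_inj x); rewrite u0 linear0.
  have [c cE] := ad_fil ad kF; apply/subvP => _ /memv_imgP[u /cE uc ->].
  apply/cE => j; rewrite gE crd_unip // mulmxDr mulmx1 mxE.
  have [uj0|/uc //] := eqVneq (crd x u 0 j) 0; rewrite uj0 add0r mxE => sj.
  have [i uX] : exists i, crd x u 0 i * X i j != 0.
    apply: contrapT => h; move/eqP: sj; apply; apply: big1 => i _.
    by apply: contrapT => /eqP h'; apply: h; exists i.
  move: uX; rewrite mulf_eq0 negb_or => /andP[/uc ic Xij].
  have /and4P[_ _ _ /= h] := (mem_Rv col ht J B X).1 XR i j Xij.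
  by apply: leq_ltn_trans h ic.
have e : (1%:M - X) *m pj B = pj B - X by rewrite mulmxBl mul1mx (Rv_r XR).
apply/vspaceP => u; apply/idP/idP => [/mem_gr ugr|/memv_imgP[s /(ad_S ad) sS ->]].
  apply/memv_imgP; exists (dcr x (crd x u *m (1%:M + - X))); last first.
    by rewrite gE crd_unip // -mulmxA IX mulmx1 (ad_dcrK ad).
  apply/(ad_S ad); rewrite crd_unip // .
  have uA : crd x u *m (1%:M - X) *m pj A = crd x u *m (1%:M - X).
    by rewrite -(crd_unip _ NXR) crdA.
  by rewrite -[RHS]uA (pjD (ad_sub ad)) [in RHS]mulmxDr -[crd x u *m _ *m pj B]mulmxA e ugr addr0.
apply/mem_gr; rewrite gE crd_unip // -e mulmxA -[_ *m _ *m (1%:M - X)]mulmxA XI mulmx1.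
by rewrite -sS -mulmxA pj_disj ?mulmx0 // disjD.
Qed.

(** [g] preserves the step up to height [ht i] and, being injective, maps the step strictly below
    onto itself. Losing the entry at [i] would put [s] in the lower step. *)
Lemma borel_lead g x s i : borel F g -> lead ht (crd x s) i ->
  lead ht (crd x (g x s)) i.
Proof.
move=> gB [si hi]; have [gker gF] := gB x.
have [iA ix] := crd_neq0 si; subst x.
have [k kF kE] := ad_fil_le ad iA; have [l lF lE] := ad_fil_lt ad iA.
have gs j : crd (col i) (g (col i) s) 0 j != 0 -> (ht j <= ht i)%N.
  have /(subvP (gF k kF)) : g (col i) s \in (g (col i) @: fil (F (col i)) k)%VS.
    by apply: memv_img; apply/kE.
  by move/kE; apply.
split=> //; apply/negP => /eqP gi0.
have gker0 : lker (g (col i)) == 0%VS by apply/eqP.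
have gFl : (g (col i) @: fil (F (col i)) l)%VS = fil (F (col i)) l.
  apply/eqP; rewrite eqEdim gF //= limg_dim_eq // gker capv0 //.
have : g (col i) s \in fil (F (col i)) l.
  apply/lE => j sj; rewrite ltn_neqAle gs // andbT.
  by apply: contraNneq sj => /(ad_inj ad) ->; rewrite gi0.
rewrite -gFl => /memv_imgP[s' s'F /(lker0P gker0) ss'].
by move: s'F; rewrite -ss' => /lE /(_ i si); rewrite ltnn.
Qed.

Lemma S_lead i : i \in J -> exists2 s, s \in S (col i) & lead ht (crd (col i) s) i.
Proof.
move=> iJ; have iA : i \in A := fintype.subsetP (ad_sub ad) i iJ.
have e : crd (col i) (dcr (col i) (delta_mx 0 i)) = delta_mx 0 i.
  apply: crd_dcr; apply/rowP => j; rewrite pjrE !mxE eqxx /=.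
    by case: eqP => [->|_]; rewrite ?iA ?mulr1 ?mul0r.
  by case: eqP => [->|_]; rewrite ?inE ?eqxx ?mulr1 ?mul0r.
exists (dcr (col i) (delta_mx 0 i)).
  apply/(ad_S ad); rewrite e; apply/rowP => j; rewrite pjrE !mxE eqxx /=.
  by case: eqP => [->|_]; rewrite ?iJ ?mulr1 ?mul0r.
rewrite e; split=> [|j]; rewrite !mxE eqxx ?eqxx ?oner_eq0 //=.
by have [->|_] := eqVneq j i; rewrite // eqxx.
Qed.

(** A Borel translate of S keeps the set [J] of leading positions, so its echelon form is a graph
    over K^J. *)
Lemma borel_orbitE T : borel_orbit F S T <->
  exists2 X, X \in Rv J B & forall x, T x = gr X x.
Proof.
split=> [[g gB TE]|[X XR TE]]; last first.
  by have [g gB gE] := gr_borel XR; exists g => // x; rewrite TE.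
(* All [T x] are gathered in one coordinate space; [ev x] recovers the individual ones. *)
pose U := (\sum_x crd x @: T x)%VS.
have Uev u x : u \in U -> exists2 t, t \in T x & u *m ev x = crd x t.
  move=> /memv_sumP[v vT ->]; have /memv_imgP[t tT vx] := vT x isT.
  exists t => //; rewrite mulmx_suml (bigD1 x) //= vx crd_ev big1 ?addr0 // => y yx.
  have /memv_imgP[t' _ ->] := vT y isT.
  rewrite -crd_ev -mulmxA pj_disj ?mulmx0 // finset.disjoints_subset.
  by apply/fintype.subsetP => i; rewrite !inE => /eqP ->.
have crdU x t : t \in T x -> crd x t \in U.
  by move=> tT; apply: (subvP (sumv_sup x isT (subvv _))); apply: memv_img.
have UJ (u : 'rV[K]_m) i : u \in U -> lead ht u i -> i \in J.
  move=> uU [ui hi]; have [t tT ut] := Uev u (col i) uU.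
  have ti : lead ht (crd (col i) t) i.
    split=> [|j]; rewrite -ut pjrE; first by rewrite inE eqxx mulr1.
    rewrite mulf_eq0 negb_or => /andP[/hi //].
  move: tT; rewrite TE => /memv_imgP[s sS tE].
  have s0 : crd (col i) s != 0.
    apply: contraTneq isT => s0; have : s = 0 by apply: (@crd_inj (col i)); rewrite s0 linear0.
    by move=> e; have [] := ti; rewrite tE e !linear0 mxE eqxx.
  have [i' si'] := lead_ex ht s0; have := borel_lead gB si'; rewrite -tE => ti'.
  have -> : i = i'.
    apply: (ad_inj ad); apply/eqP; rewrite eqn_leq.
    by case: ti ti' => [ti1 ti2] [ti1' ti2']; rewrite ti2' // ti2.
  have [si0 _] := si'; move: si0; rewrite -((ad_S ad s).1 sS) pjrE.
  by case: (i' \in J); rewrite // mulr0 eqxx.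
have [|u x /(Uev _ x)[t tT ->]||Z ZR UE] := @echelon K Q m col ht U A J (ad_sub ad) _ _ UJ.
- apply/subv_sumP => x _; apply/subvP => _ /memv_imgP[t _ ->].
  by apply/mem_kS; apply: crdA.
- exact: crdU.
- apply: (lead_card (ad_inj ad)) => i iJ; have [s sS si] := S_lead iJ.
  exists (crd (col i) (g (col i) s)); last exact: borel_lead.
  by apply: crdU; rewrite TE memv_img.
exists Z => // x; apply/vspaceP => t; apply/idP/idP => [tT|/mem_gr tZ].
  by apply/mem_gr; have /UE[] := crdU x t tT.
have /(Uev _ x)[t' t'T e] : crd x t \in U by apply/UE; rewrite crdA.
by move: e; rewrite crd_ev => /(@crd_inj x) ->.
Qed.

Local Notation alpha := (fun x => \dim (S x)).
Implicit Types (E G : 'M[K]_m) (e : frame V alpha) (T : subfamily V).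

Definition Jx x := [set i in J | col i == x]%SET.

Lemma dim_S x : \dim (S x) = #|Jx x|.
Proof.
have <- : \dim (crd x @: S x) = \dim (S x).
  apply: limg_dim_eq; apply/eqP; rewrite -subv0; apply/subvP => u.
  rewrite memv_cap memv_ker memv0 => /andP[_ /eqP u0].
  by apply/eqP; apply: (@crd_inj x); rewrite u0 linear0.
rewrite -(@dim_kS K m (Jx x)); congr (\dim _).
have pjJx : pj J *m ev x = pj (Jx x) :> 'M[K]_m.
  by rewrite pjI; congr (pj _); apply/setP => i; rewrite !inE.
apply/vspaceP => r; apply/idP/idP => [/memv_imgP[u /(ad_S ad) uS ->]|/mem_kS rJ].
  by apply/mem_kS; rewrite -pjJx mulmxA uS crd_ev.
have rA : r *m pj A = r.
  rewrite -rJ -mulmxA pj_sub //; apply/fintype.subsetP => i; rewrite inE => /andP[iJ _].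
  exact: fintype.subsetP (ad_sub ad) i iJ.
have rx : r *m ev x = r by rewrite -rJ -pjJx -!mulmxA pjI finset.setIid.
rewrite -(crd_dcr rA rx); apply: memv_img; apply/(ad_S ad).
rewrite crd_dcr // -rJ -mulmxA pj_sub //.
by apply/fintype.subsetP => i; rewrite inE => /andP[].
Qed.

Definition jx x (k : 'I_(\dim (S x))) : 'I_m := enum_val (cast_ord (dim_S x) k).

Lemma jxP x (k : 'I_(\dim (S x))) : jx k \in J /\ col (jx k) = x.
Proof. by have := enum_valP (cast_ord (dim_S x) k); rewrite inE => /andP[-> /eqP]. Qed.

Lemma jx_inj x : injective (@jx x).
Proof. by move=> k l /enum_val_inj/cast_ord_inj. Qed.

Lemma jx_surj i : i \in J -> exists k : 'I_(\dim (S (col i))), jx k = i.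
Proof.
move=> iJ; have iJx : i \in Jx (col i) by rewrite inE iJ eqxx.
exists (cast_ord (esym (dim_S (col i))) (enum_rank_in iJx i)).
by rewrite /jx cast_ordKV enum_rankK_in.
Qed.

Lemma jx_surj_col x i : i \in J -> col i = x -> exists k : 'I_(\dim (S x)), jx k = i.
Proof. by move=> iJ <-; apply: jx_surj. Qed.

(** A frame of the whole family is encoded by one matrix, with the coordinates of its vectors in the
    rows indexed by [J] and zero rows elsewhere; [mx] is the inverse dictionary. *)
Definition fr E : frame V alpha :=
  fun x => [tuple dcr x (row (jx k) E) | k < \dim (S x)].

Lemma tnth_fr E x k : tnth (fr E x) k = dcr x (row (jx k) E).
Proof. exact: tnth_mktuple. Qed.

Definition mx (e : frame V alpha) : 'M[K]_m :=
  \sum_x \sum_k (delta_mx (jx k) 0 : 'cV[K]_m) *m crd x (tnth (e x) k).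

Lemma row_mx_jx e x (k : 'I_(\dim (S x))) : row (jx k) (mx e) = crd x (tnth (e x) k).
Proof.
have cE y (l : 'I_(\dim (S y))) i : row i ((delta_mx (jx l) 0 : 'cV[K]_m) *m crd y (tnth (e y) l))
    = (i == jx l)%:R *: crd y (tnth (e y) l).
  rewrite row_mul; apply/rowP => j; rewrite !mxE big_ord1 !mxE eqxx andbT.
  by rewrite ord1.
rewrite /mx linear_sum (bigD1 x) //= linear_sum (bigD1 k) //= cE eqxx scale1r.
rewrite big1 => [|l lk]; last by rewrite /= cE (inj_eq (@jx_inj x)) eq_sym (negPf lk) scale0r.
rewrite big1 ?addr0 // => y yx; rewrite linear_sum big1 // => l _; rewrite /= cE.
case: eqP => [e'|_]; last by rewrite scale0r.
by case/eqP: yx; have [_ <-] := jxP l; rewrite -e'; have [_ ->] := jxP k.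
Qed.

Lemma row_mx0 e i : i \notin J -> row i (mx e) = 0.
Proof.
move=> iJ; rewrite /mx linear_sum big1 // => x _; rewrite linear_sum big1 // => k _.
apply/rowP => j; rewrite !mxE big1 // => l _; rewrite mxE.
case: eqP => [e'|_]; last by rewrite mul0r.
by move: iJ; rewrite e'; have [-> _] := jxP k.
Qed.

Definition framemx E : Prop :=
  [/\ pj J *m E = E, E *m pj A = E & forall x, ev x *m E = E *m ev x].

Definition good E : Prop := framemx E /\ exists D, E *m D = pj J.

Lemma row_ext (E E' : 'M[K]_m) : pj J *m E = E -> pj J *m E' = E' ->
  (forall x (k : 'I_(\dim (S x))), row (jx k) E = row (jx k) E') -> E = E'.
Proof.
move=> EJ E'J h; apply/row_matrixP => i; case: (boolP (i \in J)) => iJ.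
  by have [k <-] := jx_surj iJ.
rewrite -EJ -E'J !row_mul (_ : row i (pj J) = 0) ?mul0mx //.
by apply/rowP => j; rewrite !mxE (negPf iJ) andbF.
Qed.

Lemma pjJ_of_rows E : (forall i, i \notin J -> row i E = 0) -> pj J *m E = E.
Proof.
move=> h; apply/row_matrixP => i; apply/rowP => j; rewrite mxE pjlE.
case: (boolP (i \in J)) => [_|iJ]; first by rewrite mul1r mxE.
by rewrite mul0r h // mxE.
Qed.

Lemma framemx_mx e : framemx (mx e).
Proof.
have mxJ : pj J *m mx e = mx e by apply: pjJ_of_rows => i; apply: row_mx0.
split=> // [|x]; apply: row_ext; rewrite ?mulmxA ?mxJ //.
- by move=> x k; rewrite row_mul row_mx_jx crdA.
- by rewrite -pj_ev -mulmxA mxJ.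
move=> y k; rewrite [in RHS]row_mul row_mx_jx.
have -> : row (jx k) (ev x *m mx e) = (x == y)%:R *: crd y (tnth (e y) k).
  apply/rowP => j; rewrite -(row_mx_jx e k) mxE pjlE [RHS]mxE [in RHS]mxE inE.
  by have [_ ->] := jxP k; rewrite eq_sym.
have [->|xy] := eqVneq x y; first by rewrite scale1r crd_ev.
rewrite scale0r -crd_ev -mulmxA pj_disj ?mulmx0 // finset.disjoints_subset.
by apply/fintype.subsetP => i; rewrite !inE => /eqP ->; rewrite eq_sym.
Qed.

Lemma crd_row E x (k : 'I_(\dim (S x))) : framemx E ->
  crd x (dcr x (row (jx k) E)) = row (jx k) E.
Proof.
move=> [EJ EA Ex]; apply: crd_dcr; rewrite -row_mul ?EA // -Ex.
by apply/rowP => j; rewrite mxE pjlE inE; have [_ ->] := jxP k; rewrite eqxx mul1r mxE.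
Qed.

Lemma fr_mx e : fr (mx e) = e.
Proof.
apply: functional_extensionality_dep => x; apply: eq_from_tnth => k.
by rewrite tnth_mktuple row_mx_jx (ad_dcrK ad).
Qed.

Lemma sum_ev : \sum_x ev x = 1%:M :> 'M[K]_m.
Proof.
apply/matrixP => i j; rewrite summxE (bigD1 (col i)) //= big1 ?addr0.
  by rewrite !mxE inE eqxx andbT.
by move=> x xi; rewrite mxE inE [col i == x]eq_sym (negPf xi) andbF.
Qed.

Lemma jx_sum x (r : 'rV[K]_m) :
  r *m pj J *m ev x = \sum_(k < \dim (S x)) r 0 (jx k) *: delta_mx 0 (jx k).
Proof.
apply/rowP => j; rewrite !pjrE inE summxE.
case: (boolP (j \in J)) => jJ; last first.
  rewrite mulr0 mul0r big1 // => k _; rewrite !mxE eqxx /=.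
  by case: eqP => [e|_]; rewrite ?mulr0 //; move: jJ; rewrite e; have [-> _] := jxP k.
have [jx|xj] := eqVneq (col j) x; last first.
  rewrite mulr0 big1 // => k _; rewrite !mxE eqxx /=.
  by case: eqP => [e|_]; rewrite ?mulr0 //; move: xj; rewrite e; have [_ ->] := jxP k; rewrite eqxx.
have [k <-] := jx_surj_col jJ jx; rewrite !mulr1 (bigD1 k) //= !mxE !eqxx mulr1.
rewrite big1 ?addr0 // => l lk; rewrite !mxE (inj_eq (@jx_inj _)) eq_sym (negPf lk).
by rewrite andbF mulr0.
Qed.

Lemma mem_frame_span E x u : framemx E ->
  u \in frame_span (fr E) x <-> exists r, crd x u = r *m E.
Proof.
move=> Ef; have [EJ EA Ex] := Ef; split=> [/coord_span ->|[r ur]].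
  exists (\sum_k coord (fr E x) k u *: delta_mx 0 (jx k)).
  rewrite linear_sum mulmx_suml; apply: eq_bigr => k _.
  by rewrite linearZ -scalemxAl -tnth_nth tnth_mktuple /= crd_row // -rowE.
have -> : u = \sum_k r 0 (jx k) *: tnth (fr E x) k.
  apply: (@crd_inj x); rewrite linear_sum -crd_ev ur -mulmxA -Ex mulmxA.
  rewrite -{1}EJ mulmxA -[r *m ev x *m pj J]mulmxA pj_ev mulmxA jx_sum mulmx_suml.
  by apply: eq_bigr => k _; rewrite linearZ tnth_mktuple /= crd_row // -scalemxAl -rowE.
by apply: memv_suml => k _; apply: memvZ; apply: memv_span; apply: mem_tnth.
Qed.

Lemma good_free E : good E -> forall x, free (fr E x).
Proof.
move=> [Ef [D ED]] x; have [EJ EA Ex] := Ef.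
apply/freeP => c c0 k.
have /(congr1 (crd x)) := c0; rewrite linear_sum linear0.
under eq_bigr => l _ do rewrite linearZ -tnth_nth tnth_mktuple /= crd_row // rowE scalemxAl.
rewrite -mulmx_suml => /(congr1 (mulmx^~ D)); rewrite /= -mulmxA ED mul0mx.
move=> /rowP /(_ (jx k)); rewrite pjrE (proj1 (jxP k)) mulr1 summxE mxE.
rewrite (bigD1 k) //= !mxE !eqxx mulr1 big1 ?addr0 // => l lk.
by rewrite !mxE (inj_eq (@jx_inj x)) eq_sym (negPf lk) andbF mulr0.
Qed.

Lemma good_mx e : (forall x, free (e x)) -> good (mx e).
Proof.
move=> ef; have mf := framemx_mx e; split=> //; have [mJ mA mev] := mf.
have [|D DE] := @mulmx_factor K m (mx e) (pj J); last by exists D.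
move=> u u0; apply/rowP => i; rewrite pjrE mxE.
case: (boolP (i \in J)) => iJ; last by rewrite mulr0.
have [k ki] := jx_surj iJ; rewrite mulr1 -ki.
move/freeP: (ef (col i)) => /(_ (fun k => u 0 (jx k))); apply.
apply: (@crd_inj (col i)); rewrite linear_sum linear0.
transitivity (u *m pj J *m ev (col i) *m mx e); last first.
  by rewrite -mulmxA mev mulmxA -[u *m _ *m _]mulmxA mJ u0 mul0mx.
rewrite jx_sum mulmx_suml; apply: eq_bigr => l _.
by rewrite linearZ -scalemxAl -rowE row_mx_jx -tnth_nth.
Qed.

Lemma Gr_good T : Gr alpha T -> exists2 E, good E & frame_span (fr E) = T.
Proof.
move=> TG; pose e : frame V alpha := fun x => tcast (TG x) (vbasis (T x)).
have eE x : e x = vbasis (T x) :> seq (V x) by rewrite val_tcast.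
exists (mx e); first by apply: good_mx => x; rewrite eE (basis_free (vbasisP _)).
rewrite fr_mx; apply: functional_extensionality_dep => x.
by rewrite /frame_span eE (span_basis (vbasisP _)).
Qed.

Lemma good_Gr E : good E -> Gr alpha (frame_span (fr E)).
Proof. by move=> /good_free h x; have /eqP := h x; rewrite size_tuple. Qed.

Lemma gr_good X : X \in Rv J B ->
  good (pj J + X) /\ frame_span (fr (pj J + X)) = gr X.
Proof.
move=> XR; have XJ : X *m pj J = 0.
  by rewrite -(Rv_r XR) -mulmxA pj_disj ?mulmx0 // disjoint_sym disjD.
have Ef : framemx (pj J + X).
  split=> [||x].
  - by rewrite mulmxDr pjI finset.setIid (Rv_l XR).
  - rewrite mulmxDl pj_sub ?(ad_sub ad) //; congr (_ + _).
    by rewrite -(Rv_r XR) -mulmxA pj_sub.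
  - by rewrite mulmxDr mulmxDl pj_ev (Rv_ev _ XR).
split; first by split=> //; exists (pj J); rewrite mulmxDl pjI finset.setIid XJ addr0.
apply: functional_extensionality_dep => x; apply/vspaceP => u.
have EF : (pj J + X) *m (pj B - X) = 0.
  rewrite mulmxDl !mulmxBr pj_disj ?disjD // (Rv_l XR) (Rv_r XR).
  by rewrite (Rv_nil (disjD J A) XR) subr0 sub0r addNr.
apply/idP/idP => [/(mem_frame_span _ Ef)[r ur]|/mem_gr uF].
  by apply/mem_gr; rewrite ur -mulmxA EF mulmx0.
apply/(mem_frame_span _ Ef); exists (crd x u).
have : crd x u *m X = crd x u *m pj B.
  by apply/eqP; rewrite eq_sym -subr_eq0 -mulmxBr uF.
by rewrite mulmxDr => ->; rewrite -mulmxDr -(pjD (ad_sub ad)) crdA.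
Qed.

(** The structure group, a product of general linear groups acting on frames from the left;
    completing by the identity off [J] gives a determinant. *)
Definition glJ G : Prop := [/\ pj J *m G = G, G *m pj J = G,
  forall x, ev x *m G = G *m ev x & \det (G + pj (~: J)) != 0].

Let pjC : pj J *m pj (~: J) = 0 :> 'M[K]_m.
Proof. by rewrite pj_disj // finset.disjoints_subset finset.setCK. Qed.

Let pjC' : pj (~: J) *m pj J = 0 :> 'M[K]_m.
Proof. by rewrite pj_disj // disjoint_sym finset.disjoints_subset finset.setCK. Qed.

Let pjJC : pj J + pj (~: J) = 1%:M :> 'M[K]_m.
Proof.
rewrite -pjU ?finset.disjoints_subset ?finset.setCK // finset.setUCr.
by apply/matrixP => i j; rewrite !mxE inE andbT.
Qed.

Lemma glJ_inv G : glJ G -> exists2 N, N *m G = pj J & G *m N = pj J.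
Proof.
move=> [GJ JG _ Gd]; set P := G + _ in Gd.
have uP : P \in unitmx by rewrite unitmxE unitfE.
have PJ : P *m pj J = G by rewrite mulmxDl pjC' addr0 JG.
have JP : pj J *m P = G by rewrite mulmxDr pjC addr0 GJ.
exists (pj J *m invmx P *m pj J).
  rewrite -[_ *m pj J *m G]mulmxA GJ -PJ mulmxA -[pj J *m _ *m P]mulmxA mulVmx //.
  by rewrite mulmx1 pjI finset.setIid.
rewrite !mulmxA JG -JP -[pj J *m P *m _]mulmxA mulmxV //.
by rewrite mulmx1 pjI finset.setIid.
Qed.

Lemma glJ_frame G E : glJ G -> framemx E -> framemx (G *m E).
Proof.
move=> [GJ JG Gx _] [EJ EA Ex]; split=> [||x]; first by rewrite mulmxA GJ.
  by rewrite -mulmxA EA.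
by rewrite mulmxA Gx -mulmxA Ex mulmxA.
Qed.

Lemma glJ_good G E : glJ G -> good E -> good (G *m E).
Proof.
move=> GG [Ef [D ED]]; split; first exact: glJ_frame.
have [N _ GN] := glJ_inv GG; have [_ JG _ _] := GG.
by exists (D *m N); rewrite mulmxA -[G *m E *m D]mulmxA ED JG GN.
Qed.

Lemma glJ_span G E : glJ G -> framemx E ->
  frame_span (fr (G *m E)) = frame_span (fr E).
Proof.
move=> GG Ef; have Gf := glJ_frame GG Ef; have [N NG _] := glJ_inv GG.
have [EJ _ _] := Ef.
apply: functional_extensionality_dep => x; apply/vspaceP => u.
apply/idP/idP => [/(mem_frame_span _ Gf)[r ur]|/(mem_frame_span _ Ef)[r ur]].
  by apply/(mem_frame_span _ Ef); exists (r *m G); rewrite ur mulmxA.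
apply/(mem_frame_span _ Gf); exists (r *m N).
by rewrite ur -[RHS]mulmxA [N *m _]mulmxA NG EJ.
Qed.

Lemma same_span E E' : good E -> good E' ->
  frame_span (fr E') = frame_span (fr E) -> exists2 G, glJ G & E' = G *m E.
Proof.
have trans E1 E2 : good E1 -> good E2 -> frame_span (fr E2) = frame_span (fr E1) ->
    exists G, [/\ pj J *m G = G, G *m pj J = G, forall x, ev x *m G = G *m ev x & E2 = G *m E1].
  move=> [E1f [D ED]] [E2f _] e12; have [E1J E1A E1x] := E1f; have [E2J E2A E2x] := E2f.
  (* Keep the colour-preserving part of the change of frame; nothing is lost, as frames are
     homogeneous. *)
  pose G := \sum_x ev x *m (E2 *m D *m pj J) *m ev x.
  have E2D : E2 = E2 *m D *m E1.
    apply: row_ext; rewrite ?mulmxA ?E2J // => x k.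
    have /(mem_frame_span _ E1f)[r rE] : tnth (fr E2 x) k \in frame_span (fr E1) x.
      by rewrite -e12 memv_span ?mem_tnth.
    move: rE; rewrite tnth_mktuple crd_row // => rE.
    by rewrite !row_mul rE -[r *m E1 *m D]mulmxA ED -mulmxA E1J.
  exists G; split.
  - rewrite mulmx_sumr; apply: eq_bigr => x _.
    by rewrite !mulmxA -pj_ev -!mulmxA [pj J *m _]mulmxA E2J.
  - rewrite mulmx_suml; apply: eq_bigr => x _.
    by rewrite -!mulmxA pj_ev [pj J *m (pj J *m _)]mulmxA pjI finset.setIid.
  - move=> x; rewrite mulmx_sumr mulmx_suml; apply: eq_bigr => y _.
    have [->|yx] := eqVneq y x.
      by rewrite !mulmxA pjI finset.setIid -[_ *m ev x *m ev x]mulmxA pjI finset.setIid.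
    have ev0 y1 y2 : y1 != y2 -> ev y1 *m ev y2 = 0 :> 'M[K]_m.
      move=> y12; rewrite pj_disj // finset.disjoints_subset.
      by apply/fintype.subsetP => i; rewrite !inE => /eqP ->.
    rewrite !mulmxA ev0 1?eq_sym // !mul0mx -mulmxA ev0 // mulmx0 //.
  - rewrite mulmx_suml -[LHS]mul1mx -sum_ev mulmx_suml; apply: eq_bigr => x _.
    set P := E2 *m D *m pj J.
    have PE1 : P *m (ev x *m E1) = E2 *m ev x.
      by rewrite E1x mulmxA -[P *m E1]mulmxA E1J -E2D.
    move: (P) PE1 => {}P PE1.
    by rewrite -!mulmxA PE1 -E2x mulmxA pjI finset.setIid.
move=> E1g E2g e12; have [G [JG GJ Gx E2E]] := trans _ _ E1g E2g e12.
have [G' [JG' GJ' _ E1E]] := trans _ _ E2g E1g (esym e12).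
exists G => //; split=> //.
have [_ [D' ED']] := E2g.
have GG' : G *m G' = pj J.
  by rewrite -GJ' mulmxA -ED' mulmxA -[G *m G' *m E']mulmxA -E1E -E2E.
suff /mulmx1_unit[] : (G + pj (~: J)) *m (G' + pj (~: J)) = 1%:M by rewrite unitmxE unitfE.
rewrite mulmxDl !mulmxDr GG' pjI finset.setIid -(JG') -{1}GJ.
by rewrite (mulmxA (pj _) (pj _)) pjC' mul0mx -mulmxA pjC mulmx0 addr0 add0r pjJC.
Qed.

Lemma closed_poly Z : zariski_closed alpha Z ->
  exists P : set ('M[K]_m -> K), (forall p, P p -> polyf p) /\
    forall E, good E -> (Z (frame_span (fr E)) <-> forall p, P p -> p E = 0).
Proof.
move=> [_ [P PZ]].
exists [set p | exists2 q, P q & p = fun E => q.@[frame_coord (fr E)]]%classic; split.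
  move=> _ [q _ ->]; apply: polyf_meval => k; rewrite /frame_coord.
  case: (enum_val k) => x [i j]; apply: polyf_lin => c u v.
  by rewrite /fr !tnth_mktuple !linearP.
move=> E Eg; rewrite (PZ _ (good_free Eg)); split=> [h _ [q Pq ->]|h q Pq]; first exact: h.
by apply: (h (fun E => q.@[frame_coord (fr E)])); exists q.
Qed.

Let coords (v : 'rV[K]_(#|frame_index V alpha|)) : 'M[K]_m :=
  \sum_x \sum_(k < \dim (S x)) (delta_mx (jx k) 0 : 'cV[K]_m) *m
    crd x (\sum_j v 0 (enum_rank (existT _ x (k, j) : frame_index V alpha)) *:
             tnth (vbasis {: V x}) j).

Let coordsE e : coords (\row_k frame_coord e k) = mx e.
Proof.
apply: eq_bigr => x _; apply: eq_bigr => k _; congr (_ *m crd x _).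
rewrite [RHS](coord_vbasis (memvf _)); apply: eq_bigr => j _.
by rewrite mxE /frame_coord enum_rankK -tnth_nth.
Qed.

Let coords_lin c u v : coords (c *: u + v) = c *: coords u + coords v.
Proof.
rewrite /coords scaler_sumr -big_split; apply: eq_bigr => x _ /=.
rewrite scaler_sumr -big_split; apply: eq_bigr => k _ /=.
rewrite scalemxAr -mulmxDr -linearP; congr (_ *m crd x _).
rewrite scaler_sumr -big_split; apply: eq_bigr => j _ /=.
by rewrite !mxE scalerA scalerDl.
Qed.

Definition zero_locus (p : 'M[K]_m -> K) : set (subfamily V) :=
  [set T | Gr alpha T /\ forall E, good E -> frame_span (fr E) = T -> p E = 0].

(** [p] need not be invariant under a change of frame, so all its translates by the structure group
    serve as equations. *)
Lemma zero_locus_closed p : polyf p -> zariski_closed alpha (zero_locus p).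
Proof.
move=> pP; split=> [T []//|].
exists [set q | exists2 G, glJ G & forall e, q.@[frame_coord e] = p (G *m mx e)]%classic.
move=> e ef; have eg := good_mx ef; have [mf _] := eg.
split=> [[_ h] q [G GG ->]|h].
  by apply: h; [apply: glJ_good | rewrite glJ_span // fr_mx].
split; first by move=> x; have /eqP := ef x; rewrite size_tuple.
move=> E Eg; rewrite -[in frame_span e](fr_mx e) => /(same_span eg Eg)[G GG ->].
have [|q qE] := @polyf_row K _ (fun v => p (G *m coords v)).
  apply: (polyf_comp pP (g := fun v => G *m coords v) (d := 1%N)) => i.
  by apply: polyd_lin => c u v; rewrite coords_lin linearP /= linearP !mxE.
have {}qE e' : q.@[frame_coord e'] = p (G *m mx e').
  by rewrite -coordsE qE; apply: meval_eq => k; rewrite mxE.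
by rewrite -qE; apply: h; exists G.
Qed.

Lemma orbit_Gr : (borel_orbit F S `<=` Gr alpha)%classic.
Proof.
move=> T /borel_orbitE[X XR TE] x; rewrite TE.
by have [Xg <-] := gr_good XR; apply: good_Gr.
Qed.

Lemma borel_orbit_gr T : borel_orbit F S T <-> exists2 X, X \in Rv J B & T = gr X.
Proof.
rewrite borel_orbitE; split=> -[X XR TE]; exists X => //; last by rewrite TE.
exact: functional_extensionality_dep.
Qed.

Lemma Omega_vanish p : polyf p ->
  (forall E, good E -> borel_orbit F S (frame_span (fr E)) -> p E = 0) ->
  forall E, good E -> Omega F S (frame_span (fr E)) -> p E = 0.
Proof.
move=> pP p0 E Eg [_ /(_ _ (zero_locus_closed pP))h].
have [|_] := h; last exact.
move=> T TO; split; first exact: orbit_Gr.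
by move=> E' E'g E'T; apply: p0 => //; rewrite E'T.
Qed.

(** The linear projection to the matrix algebra in which [glJ] is open; it lets the structure group
    be treated as an open subset of a vector space. *)
Definition blk (M : 'M[K]_m) : 'M[K]_m :=
  \matrix_(i, j) (if [&& i \in J, j \in J & col i == col j] then M i j else 0).

Lemma blk_lin c (M N : 'M[K]_m) : blk (c *: M + N) = c *: blk M + blk N.
Proof.
by apply/matrixP => i j; rewrite !mxE; case: ifP; rewrite // mulr0 addr0.
Qed.

Lemma blkP M : [/\ pj J *m blk M = blk M, blk M *m pj J = blk M &
  forall x, ev x *m blk M = blk M *m ev x].
Proof.
split=> [||x]; apply/matrixP => i j; rewrite ?pjlE ?pjrE !mxE ?inE.
- by case: (i \in J); rewrite /= ?mul1r ?mul0r.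
- by case: (j \in J); rewrite ?andbF ?mulr1 ?mulr0 ?andbF //=; case: (i \in J).
- case: ifP => [/and3P[_ _ /eqP ->]|_]; last by rewrite mulr0 mul0r.
  by rewrite mulrC.
Qed.

Lemma blk_id G : pj J *m G = G -> G *m pj J = G -> (forall x, ev x *m G = G *m ev x) ->
  blk G = G.
Proof.
move=> JG GJ Gx; apply/matrixP => i j; rewrite mxE.
case: (boolP (i \in J)) => iJ /=; last by rewrite -JG pjlE (negPf iJ) mul0r.
case: (boolP (j \in J)) => jJ /=; last by rewrite -GJ pjrE (negPf jJ) mulr0.
case: eqP => // /eqP ij; have := congr1 (fun M : 'M[K]_m => M i j) (Gx (col i)).
by rewrite pjlE pjrE !inE eqxx eq_sym (negPf ij) mul1r mulr0.
Qed.

Lemma glJ_id G : glJ G -> blk G = G.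
Proof. by case=> *; apply: blk_id. Qed.

Lemma glJ1 : glJ (pj J).
Proof.
split=> [||x|]; rewrite ?pjI ?finset.setIid ?pjJC ?det1 ?oner_neq0 //.
by rewrite finset.setIC.
Qed.

Lemma blk_glJ M : \det (blk M + pj (~: J)) != 0 -> glJ (blk M).
Proof. by move=> h; have [? ? ?] := blkP M; split. Qed.

Lemma polymap_blk E : polymap 1 (fun M => blk M *m E).
Proof. by move=> i; apply: polyd_lin => c u v; rewrite blk_lin mulmxDl -scalemxAl linearP !mxE. Qed.

Lemma polyf_blk_det : polyf (fun M => \det (blk M + pj (~: J))).
Proof.
exists (m * 1)%N; apply: polyd_det => i j.
apply: (@polyd_ext _ _ _ (fun M => blk M i j + pj (~: J) i j)); first by move=> M; rewrite [RHS]mxE.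
apply: polydD; last exact: polyd_const.
by apply: polyd_lin => c u v; rewrite blk_lin !mxE.
Qed.

(** Irreducibility concerns subspaces, whereas [p] and [q] live on frames. If each is nonzero on
    some frame of T, then both are nonzero on a common frame of T, because the structure group is
    open in a vector space. *)
Lemma irred_poly Z p q : zariski_irreducible alpha Z -> (Z `<=` Gr alpha)%classic ->
  polyf p -> polyf q ->
  (forall E, good E -> Z (frame_span (fr E)) -> p E * q E = 0) ->
  (forall E, good E -> Z (frame_span (fr E)) -> p E = 0) \/
  (forall E, good E -> Z (frame_span (fr E)) -> q E = 0).
Proof.
move=> [_ Zirr] ZG pP qP pq0.
have [|h|h] := Zirr _ _ (zero_locus_closed pP) (zero_locus_closed qP); last 2 first.
- by left=> E Eg /h[_]; apply.
- by right=> E Eg /h[_]; apply.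
move=> T TZ; apply: contrapT => /not_orP[nTp nTq].
have ex r : ~ zero_locus r T -> exists E, [/\ good E, frame_span (fr E) = T & r E != 0].
  move=> nT; apply: contrapT => h; apply: nT; split; first exact: ZG.
  by move=> E Eg ET; apply: contrapT => /eqP rE; apply: h; exists E.
have [E1 [E1g E1T pE1]] := ex _ nTp; have [E2 [E2g E2T qE2]] := ex _ nTq.
have [|G2 G2G E2E] := same_span E1g E2g; first by rewrite E1T E2T.
have [[E1J _ _] _] := E1g.
have [||M1 [pM dM]] := @polyf_domain _ _ (fun M => p (blk M *m E1))
  (fun M => \det (blk M + pj (~: J))) (pj J) (pj J) (polyf_comp pP (polymap_blk E1)) polyf_blk_det.
- by rewrite (glJ_id glJ1) E1J.
- by rewrite (glJ_id glJ1); have [] := glJ1.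
have [||M [/= ]] := @polyf_domain _ _ (fun M => p (blk M *m E1) * \det (blk M + pj (~: J)))
  (fun M => q (blk M *m E1)) M1 G2
  (polyfM (polyf_comp pP (polymap_blk E1)) polyf_blk_det) (polyf_comp qP (polymap_blk E1)).
- by rewrite mulf_neq0.
- by rewrite (glJ_id G2G) -E2E.
rewrite mulf_eq0 negb_or => /andP[pM' /blk_glJ MG] qM.
have : p (blk M *m E1) * q (blk M *m E1) = 0.
  by apply: pq0; rewrite ?glJ_span ?E1T //; [apply: glJ_good | case: E1g].
by move/eqP; rewrite mulf_eq0 (negPf pM') (negPf qM).
Qed.

End Chart.

(** * The dimension of a Schubert variety *)

Section Growth.
Context {K : numFieldType}.

Lemma polyf_sum (U : vectType K) (I : Type) (r : seq I) (P : pred I) (F : I -> U -> K) :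
  (forall i, polyf (F i)) -> polyf (fun u => \sum_(i <- r | P i) F i u).
Proof.
move=> FP; elim: r => [|i r [d IH]].
  by exists 0%N; apply: (polyd_eq (polyd_const 0%N 0)) => u; rewrite big_nil.
case: (boolP (P i)) => Pi; last first.
  by exists d; apply: (polyd_eq IH) => u; rewrite big_cons (negPf Pi).
have [e sP] := polyfD (FP i) (ex_intro _ d IH).
by exists e; apply: (polyd_eq sP) => u; rewrite big_cons Pi.
Qed.

(* As [f] vanishes on [E] and is not a zero divisor on [E'], the coefficients of a
   relation are killed one power of [f] at a time. *)
Lemma indep_step (U : vectType K) (E E' : U -> Prop) (I : finType) (fam : I -> U -> K)
    (f : U -> K) :
  (forall u, E u -> E' u) -> (forall i, polyf (fam i)) -> polyf f ->
  indep E fam -> (forall u, E u -> f u = 0) ->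
  (forall h, polyf h -> (forall u, E' u -> f u * h u = 0) -> forall u, E' u -> h u = 0) ->
  forall k, indep E' (fun (ij : I * 'I_k) u => fam ij.1 u * f u ^+ ij.2).
Proof.
move=> EE' famP fP Ei f0 fdom k c c0.
suff {c c0} h : forall c : 'I_k -> I -> K,
    (forall u, E' u -> \sum_(j < k) (\sum_i c j i * fam i u) * f u ^+ j = 0) ->
    forall j i, c j i = 0.
  move=> [i j]; apply: (h (fun j i => c (i, j))) => u E'u; rewrite -[RHS](c0 u E'u).
  transitivity (\sum_i \sum_(j < k) c (i, j) * (fam i u * f u ^+ j)).
    rewrite [RHS]exchange_big; apply: eq_bigr => j1 _ /=.
    by rewrite mulr_suml; apply: eq_bigr => i' _; rewrite mulrA.
  by rewrite pair_bigA; apply: eq_bigr => -[i' j'] _.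
elim: k => [|k IH] c c0; first by case.
have h0 i : c ord0 i = 0.
  move: i; apply: Ei => u Eu; have := c0 u (EE' u Eu).
  rewrite big_ord_recl expr0 mulr1 [X in _ + X]big1 ?addr0 // => j _.
  by rewrite f0 // exprS mul0r mulr0.
have hS j i : c (lift ord0 j) i = 0.
  move: j i; apply: IH; apply: fdom => [|u E'u].
    apply: polyf_sum => j; apply: polyfM.
      by apply: polyf_sum => i; apply: polyfM => //; apply: polyf_const.
    by have [d fd] := fP; exists (d * j)%N; apply: polyd_exp.
  rewrite -[RHS](c0 u E'u) big_ord_recl [X in X * _ + _]big1 ?mul0r ?add0r.
    rewrite mulr_sumr; apply: eq_bigr => j _.
    by rewrite [in RHS]exprS mulrCA.
  by move=> i _; rewrite h0 mul0r.
by move=> j i; case: (unliftP ord0 j) => [j' ->|->].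
Qed.

End Growth.

Section ClosureTopology.
Context (K : fieldType) (I : finType) (V : I -> vectType K) (alpha : I -> nat).
Local Open Scope classical_set_scope.
Implicit Types X Y Z : set (subfamily V).

Lemma sub_closure X : X `<=` Gr alpha -> X `<=` zariski_closure alpha X.
Proof. by move=> XG T XT; split=> [|Z _]; [apply: XG | apply]. Qed.

Lemma closure_min X Z : zariski_closed alpha Z -> X `<=` Z ->
  zariski_closure alpha X `<=` Z.
Proof. by move=> Zc XZ T [_]; apply. Qed.

Lemma closure_closed X : zariski_closed alpha (zariski_closure alpha X).
Proof.
split=> [T []//|].
exists [set p | exists Z P, [/\ X `<=` Z, zariski_closed alpha Z, P p &
  forall e : frame V alpha, (forall x, free (e x)) ->
    (Z (frame_span e) <-> forall p, P p -> p.@[frame_coord e] = 0)]].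
move=> e ef; split=> [[_ h] p [Z [P [XZ Zc Pp PZ]]]|h].
  by apply: (PZ e ef).1 Pp; apply: h.
split=> [x|Z Zc XZ]; first by have /eqP := ef x; rewrite size_tuple.
have [_ [P PZ]] := Zc; apply/(PZ e ef) => p Pp.
by apply: h; exists Z, P.
Qed.

End ClosureTopology.

Section Dimension.
Context {K : numFieldType} {Q : quiver} (V : vertex Q -> vectType K).
Variables (F : forall x, filtration (V x)) (S : subfamily V).
Context {m : nat} (col : 'I_m -> vertex Q) (ht : 'I_m -> nat) (A J : {set 'I_m}).
Variable crd : forall x, 'Hom(V x, 'rV[K]_m).
Variable dcr : forall x, 'Hom('rV[K]_m, V x).
Hypothesis ad : adapted F S col ht A J crd dcr.
Local Notation ev := (ev col).
Local Notation B := (A :\: J).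
Local Notation alpha := (fun x => \dim (S x)).
Local Notation good := (good col A J).
Local Notation glJ := (glJ col J).
Local Notation blk := (blk col J).
Local Notation fr := (fr ad).
Local Notation gr := (gr A J crd).
Implicit Types (E G : 'M[K]_m) (T : subfamily V).

Let frames (Z : set (subfamily V)) E := good E /\ Z (frame_span (fr E)).

Let Gv := Rv col (fun _ => 0%N) J J : {vspace 'M[K]_m}.

Let mem_Gv G : G \in Gv <-> blk G = G.
Proof.
rewrite mem_Rv; split=> [h|<- i j].
  apply/matrixP => i j; rewrite mxE; have [->|/h] := eqVneq (G i j) 0; first by case: ifP.
  by case/and4P => /= -> -> ->.
rewrite mxE; case: ifP => [/and3P[iJ jJ ij] _|_]; last by rewrite eqxx.
by rewrite /Rm /= iJ jJ ij.
Qed.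

Let Gval (g : subvs_of Gv) : blk (vsval g) = vsval g.
Proof. exact/mem_Gv/subvsP. Qed.

Let prj (M : 'M[K]_m) : subvs_of Gv := vsproj Gv (blk M).

Let prj_lin c (M N : 'M[K]_m) : prj (c *: M + N) = c *: prj M + prj N.
Proof. by rewrite /prj blk_lin linearP. Qed.

Let prj_id (g : subvs_of Gv) : prj (vsval g) = g.
Proof. by rewrite /prj Gval vsvalK. Qed.

(** Already over one point the frames include all [G *m E0], and right multiplication by [D0]
    recovers [G]: use the monomials in the coordinates of the structure group. *)
Let chain_base (Z : set (subfamily V)) : zariski_irreducible alpha Z ->
  (Z `<=` Gr alpha)%classic -> exists D, forall k, exists (I : finType) fam,
   [/\ #|I| = (k ^ \dim Gv)%N, forall i, polyd (D * k)%N (fam i) & indep (frames Z) (fam : I -> _)].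
Proof.
move=> [[T0 T0Z] _] ZG; have [E0 E0g E0T] := Gr_good ad (ZG _ T0Z).
have [E0f [D0 ED0]] := E0g.
exists (\dim Gv) => k; exists {ffun 'I_(dim (subvs_of Gv)) -> 'I_k}.
exists (fun (a : {ffun 'I_(dim (subvs_of Gv)) -> 'I_k}) E => \prod_i v2r (prj (E *m D0)) 0 i ^+ a i); split.
- by rewrite card_ffun !card_ord.
- move=> a; apply: (@polyd_le _ _ (\sum_(i < \dim Gv) (1 * a i))%N).
    rewrite -[X in (_ <= X * _)%N](card_ord (\dim Gv)) -sum_nat_const leq_sum // => i _.
    by rewrite mul1n ltnW.
  apply: polyd_prod => i; apply: polyd_exp; apply: polyd_lin => c u v.
  by rewrite mulmxDl -scalemxAl prj_lin linearP !mxE.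
move=> c c0; apply: (@indep_monomials K (subvs_of Gv) k c) => g _.
apply: contrapT => /eqP gn0.
pose f (g : subvs_of Gv) := \sum_(a : {ffun 'I_(dim (subvs_of Gv)) -> 'I_k}) c a * \prod_i v2r g 0 i ^+ a i.
pose h (g : subvs_of Gv) := \det (blk (vsval g) + pj (~: J)).
have [||||u []] := @polyf_domain K _ f h g (prj (pj J)).
- apply: polyf_sum => a; apply: polyfM; first exact: polyf_const.
  exists (\sum_(i < dim (subvs_of Gv)) 1 * a i)%N.
  by apply: polyd_prod => i; apply: polyd_exp; apply: polyd_coord.
- apply: (polyf_comp (polyf_blk_det col J) (g := vsval) (d := 1%N)) => i.
  by apply: polyd_lin => a u v; rewrite !linearP !mxE.
- exact: gn0.
- have e := glJ_id (@glJ1 K Q m col J); rewrite /h /prj e vsprojK ?e; last exact/mem_Gv.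
  by have [] := @glJ1 K Q m col J.
move=> fu hu; have uG := blk_glJ hu; rewrite Gval in uG.
case/eqP: fu; rewrite -[RHS](c0 (vsval u *m E0)).
  have [_ uJ _ _] := uG.
  apply: eq_bigr => a _; rewrite -mulmxA ED0 uJ prj_id //.
by split; [apply: glJ_good | rewrite glJ_span // E0T].
Qed.

(** At each step some [f] vanishes on [Z n] but not on [Z n.+1]. By irreducibility it is no zero
    divisor there, so its powers below k multiply the number of independent functions by k. *)
Let chain_indep (Z : nat -> set (subfamily V)) n :
  (forall i, (i <= n)%N -> zariski_closed alpha (Z i) /\ zariski_irreducible alpha (Z i)) ->
  (forall i, (i < n)%N -> (Z i `<` Z i.+1)%classic) ->
  exists D, forall k, exists (I : finType) fam,
    [/\ #|I| = (k ^ (\dim Gv + n))%N, forall i, polyd (D * k)%N (fam i)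
      & indep (frames (Z n)) (fam : I -> _)].
Proof.
elim: n => [|n IH] Zi Zlt.
  have [[ZG _] Zirr] := Zi 0%N (leqnn _).
  by rewrite addn0; apply: chain_base.
have [|i /ltnW|D Dk] := IH; [by move=> i /leqW; apply: Zi | by apply: Zlt |].
have [/(closed_poly ad)[P [Pp PZ]] _] := Zi n (leqnSn n).
have [[ZG _] Zirr] := Zi n.+1 (leqnn _).
have [ZZ nZZ] := Zlt n (leqnn _).
have [T [TZ nTZ]] : exists T, Z n.+1 T /\ ~ Z n T.
  by apply: contrapT => h; apply: nZZ => T TZ; apply: contrapT => nT; apply: h; exists T.
have [E Eg ET] := Gr_good ad (ZG _ TZ).
have [f [Pf fE]] : exists f, P f /\ f E != 0.
  apply: contrapT => h; apply: nTZ; rewrite -ET; apply/(PZ E Eg) => p Pp'.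
  by apply: contrapT => /eqP pE; apply: h; exists p.
have [d fd] := Pp f Pf.
have f0 E' : frames (Z n) E' -> f E' = 0 by move=> [/PZ h /h]; apply.
exists (D + d)%N => k; have [I [fam [Ik famD famI]]] := Dk k.
exists (I * 'I_k)%type, (fun (ij : I * 'I_k) u => fam ij.1 u * f u ^+ ij.2); split.
- by rewrite card_prod card_ord Ik -expnSr addnS.
- move=> [i j] /=; apply: (@polyd_le _ _ (D * k + d * j)%N).
    by rewrite mulnDl leq_add2l leq_mul2l ltnW ?orbT.
  by apply: polydM => //; apply: polyd_exp.
apply: (indep_step _ _ _ famI f0) => [E' [E'g /ZZ]//|i|//|h hP fh]; first by exists (D * k)%N.
- by exists d.
have [h'|h' E' [E'g /(h' _ E'g)]//] := irred_poly Zirr ZG (ex_intro _ d fd) hP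
  (fun E' E'g E'Z => fh E' (conj E'g E'Z)).
by move: fE; rewrite (h' E Eg) ?ET ?eqxx.
Qed.

(* A chain of length [n] yields [k ^ (s + n)] independent functions of degree
   O(k) on frames, [s] being the dimension of the structure group. *)
Lemma chain_length n : irreducible_chain alpha (Omega F S) n -> (n <= #|Rm col ht J B|)%N.
Proof.
move=> [Z [Zi Zlt]].
have [i /Zi[]//|D Dk] := chain_indep _ Zlt.
(* The frames of members of the cell are products of a group element and a normal form, so the
   functions pull back injectively to a space of dimension [\dim Gv + #|Rm|]. *)
pose U2 : vectType K := (subvs_of Gv * subvs_of (Rv col ht J B))%type.
pose psi (u : U2) : 'M[K]_m := vsval u.1 *m (pj J + vsval u.2).
have psiP : polymap 2 psi.
  apply: polymapM; apply: (@polyd_mulmx _ _ 1 1) => i j.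
    by apply: polyd_lin => a u v; rewrite !linearP !mxE.
  apply: (@polyd_ext _ _ _ (fun u : U2 => pj J i j + vsval u.2 i j)).
    by move=> u; rewrite [RHS]mxE.
  apply: polydD; first exact: polyd_const.
  by apply: polyd_lin => a u v; rewrite !linearP !mxE.
rewrite -(dim_Rv (K := K)) -(leq_add2l (\dim Gv)).
apply: (@growth_leq _ _ (D * 2)%N) => k; have [I [fam [<- famD famI]]] := Dk k.
have := @indep_card K U2 I (fun i u => fam i (psi u)) (D * 2 * k)%N; apply.
  by move=> i; rewrite mulnAC; apply: polyd_comp.
move=> c c0; apply: famI => E [Eg EZ].
apply: (Omega_vanish (ad := ad) (p := fun E => \sum_i c i * fam i E)) (Eg) _; last first.
  by have [_ _] := Zi n (leqnn _); apply.
  move=> {EZ}E {}Eg /(borel_orbit_gr ad)[X XR EX].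
  have [Xg XE] := gr_good ad XR; have := same_span (ad := ad) Xg Eg; rewrite EX XE.
  case=> // G /glJ_id /mem_Gv GG ->.
  have := c0 (Subvs GG, Subvs XR) Logic.I.
  by rewrite /psi /=.
apply: polyf_sum => i; apply: polyfM; [exact: polyf_const | by exists (D * k)%N].
Qed.

(** A flag of coordinate subspaces in the affine space of the cell, along an enumeration of its
    coordinates; the closures form the chain of maximal length. *)
Let W r := [set X : 'M[K]_m | X \in Rv col ht J B /\
  forall i j, X i j != 0 -> (index (i, j) (enum (Rm col ht J B)) < r)%N]%classic.
Let cell r := zariski_closure alpha [set gr X | X in W r]%classic.

Let W0 r : W r 0.
Proof. by split=> [|i j]; rewrite ?mem0v // mxE eqxx. Qed.

Let W_line r X Y t : W r X -> W r Y -> W r (X + t *: (Y - X)).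
Proof.
move=> [XR Xr] [YR Yr]; split=> [|i j].
  by rewrite memvD // memvZ // memvB.
rewrite !mxE => h; have [X0|/Xr//] := eqVneq (X i j) 0.
by apply: Yr; apply: contraNneq h => Y0; rewrite X0 Y0 subrr mulr0 addr0.
Qed.

Let cell_Gr r : ([set gr X | X in W r] `<=` Gr alpha)%classic.
Proof. by move=> _ [X [XR _] <-]; have [Xg <-] := gr_good ad XR; apply: good_Gr. Qed.

Let cell_irr r : zariski_irreducible alpha (cell r).
Proof.
split; first by exists (gr 0); apply: sub_closure (cell_Gr (r:=r)) _ _; exists 0.
move=> Z1 Z2 Zc1 Zc2 Z12; apply: contrapT => /not_orP[n1 n2].
have ex Z : zariski_closed alpha Z -> ~ (cell r `<=` Z)%classic ->
    exists X p, [/\ W r X, polyf p, p (pj J + X) != 0 &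
      forall Y, W r Y -> Z (gr Y) -> p (pj J + Y) = 0].
  move=> Zc nZ; have [P [Pp PZ]] := closed_poly ad Zc.
  have [X [XW nX]] : exists X, W r X /\ ~ Z (gr X).
    apply: contrapT => h; apply: nZ; apply: closure_min => // _ [X XW <-].
    by apply: contrapT => nX; apply: h; exists X.
  have [Xg XE] := gr_good ad (proj1 XW).
  have [p [Pp' pX]] : exists p, P p /\ p (pj J + X) != 0.
    apply: contrapT => h; apply: nX; rewrite -XE; apply/(PZ _ Xg) => p Pp'.
    by apply: contrapT => /eqP pX; apply: h; exists p.
  exists X, p; split=> //; first exact: Pp.
  move=> Y [YR _]; have [Yg <-] := gr_good ad YR.
  by move=> /(PZ _ Yg); apply.
have [X1 [p1 [X1W p1P p1X Z1p]]] := ex _ Zc1 n1.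
have [X2 [p2 [X2W p2P p2X Z2p]]] := ex _ Zc2 n2.
(* The line from [X1] to [X2] stays in [W r], and on it the two nonvanishing loci meet. *)
have [||t [h1 h2]] := @polyf_domain_line K _ p1 p2 (pj J + X1) (X2 - X1) 0 1 p1P p2P.
- by rewrite scale0r addr0.
- by rewrite scale1r -addrA [X1 + _]addrC subrK.
have tW := W_line t X1W X2W; rewrite -!addrA in h1 h2.
have : cell r (gr (X1 + t *: (X2 - X1))).
  by apply: (sub_closure (cell_Gr (r:=r))); exists (X1 + t *: (X2 - X1)).
by case/Z12 => [/(Z1p _ tW)|/(Z2p _ tW)] e; [rewrite e eqxx in h1 | rewrite e eqxx in h2].
Qed.

Let cell_lt r : (r < #|Rm col ht J B|)%N -> (cell r `<` cell r.+1)%classic.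
Proof.
move=> rR; have rs : (r < size (enum (Rm col ht J B)))%N by rewrite -cardE.
split.
  apply: closure_min; first exact: closure_closed.
  move=> _ [X [XR Xr] <-]; apply: sub_closure; first exact: cell_Gr.
  by exists X => //; split=> // i j /Xr/leqW.
have [ij0 _] : exists ij : 'I_m * 'I_m, ij \in Rm col ht J B by apply/card_gt0P; apply: leq_ltn_trans rR.
pose i := (nth ij0 (enum (Rm col ht J B)) r).1; pose j := (nth ij0 (enum (Rm col ht J B)) r).2.
have ijE : (i, j) = nth ij0 (enum (Rm col ht J B)) r by rewrite -surjective_pairing.
have ijr : index (i, j) (enum (Rm col ht J B)) = r by rewrite ijE index_uniq ?enum_uniq.
have ijR : (i, j) \in Rm col ht J B by rewrite -mem_enum ijE mem_nth.
(* By Cramer's rule, on a frame [G *m (pj J + X)] this is the entry [X i j] times a nonzero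
   determinant: it tests the coordinate number r on any frame. *)
pose p (E : 'M[K]_m) := (\adj (E *m pj J + pj (~: J)) *m (E *m pj B)) i j.
have entryP (E0 : 'M[K]_m) : forall k l, polyd 1 (fun E : 'M[K]_m => (E *m E0) k l).
  by move=> k l; apply: polyd_lin => a u v; rewrite mulmxDl -scalemxAl !mxE.
have pP : polyf p.
  exists (m * 1 + 1)%N; apply: polyd_mulmx => // k l; apply: polyd_adj => k' l'.
  apply: (@polyd_ext _ _ _ (fun E => (E *m pj J) k' l' + pj (~: J) k' l')).
    by move=> E; rewrite [RHS]mxE.
  by apply: polydD => //; apply: polyd_const.
have pE G X : pj J *m G = G -> G *m pj J = G -> X \in Rv col ht J B ->
    p (G *m (pj J + X)) = \det (G + pj (~: J)) * X i j.
  move=> JG GJ XR.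
  have XJ : X *m pj J = 0.
    by rewrite -(Rv_r XR) -mulmxA pj_disj ?mulmx0 // disjoint_sym disjD.
  have CX : pj (~: J) *m X = 0.
    rewrite -(Rv_l XR) mulmxA pj_disj ?mul0mx //.
    by rewrite disjoint_sym finset.disjoints_subset finset.setCK.
  have e1 : G *m (pj J + X) *m pj J = G.
    by rewrite -mulmxA mulmxDl XJ addr0 pjI finset.setIid.
  have e2 : G *m (pj J + X) *m pj B = (G + pj (~: J)) *m X.
    rewrite -mulmxA mulmxDl pj_disj ?disjD // add0r (Rv_r XR).
    by rewrite mulmxDl CX addr0.
  by rewrite /p e1 e2 mulmxA mul_adj_mx mul_scalar_mx mxE.
have sub : (cell r `<=` zero_locus ad p)%classic.
  apply: closure_min; first exact: zero_locus_closed.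
  move=> _ [X [XR Xr] <-]; have [Xg XE] := gr_good ad XR.
  rewrite -XE; split; first exact: good_Gr.
  move=> E Eg /(same_span Xg Eg)[G [JG GJ _ _] ->]; rewrite pE //.
  have [->|/Xr] := eqVneq (X i j) 0; first by rewrite mulr0.
  by rewrite ijr ltnn.
pose X : 'M[K]_m := delta_mx i j.
have XR : X \in Rv col ht J B.
  apply/mem_Rv => k l; rewrite mxE; case: (k =P i) => [->|_]; last by rewrite eqxx.
  by case: (l =P j) => [-> _|_]; last by rewrite eqxx.
have [Xg XE] := gr_good ad XR.
move=> le; have /sub[_ /(_ _ Xg XE)] : cell r (gr X).
  apply: le; apply: sub_closure; first exact: cell_Gr.
  exists X => //; split=> // k l; rewrite mxE; case: (k =P i) => [->|_]; last by rewrite eqxx.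
  by case: (l =P j) => [-> _|_]; [rewrite ijr | rewrite eqxx].
have [J1 J2 _ J3] := @glJ1 K Q m col J.
have := pE (pj J) X J1 J2 XR.
rewrite mulmxDr J1 (Rv_l XR) => -> /eqP; rewrite mulf_eq0 (negPf J3) /= mxE !eqxx.
by rewrite oner_eq0.
Qed.

Theorem dim_OmegaE : dim_Omega F S = #|Rm col ht J B|.
Proof.
have chain : irreducible_chain alpha (Omega F S) #|Rm col ht J B|.
  exists cell; split=> [r _|r]; last exact: cell_lt.
  split; [exact: closure_closed | exact: cell_irr |].
  apply: closure_min; first exact: closure_closed.
  move=> _ [X [XR _] <-]; apply: sub_closure; first exact: (orbit_Gr ad).
  exact: (gr_borel ad).
rewrite /dim_Omega /dimension; case: xgetP => [d -> [dc dmax]|/(_ #|Rm col ht J B|)].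
  by apply/eqP; rewrite eqn_leq chain_length //= dmax.
by case; split=> //; apply: chain_length.
Qed.

End Dimension.

(** * Intersecting subspaces and density *)

Section Subrepresentations.
Context {K : numFieldType} {Q : quiver} (V : vertex Q -> vectType K).
Variables (F : forall x, filtration (V x)) (S : subfamily V).
Context {m : nat} (col : 'I_m -> vertex Q) (ht : 'I_m -> nat) (A J : {set 'I_m}).
Variable crd : forall x, 'Hom(V x, 'rV[K]_m).
Variable dcr : forall x, 'Hom('rV[K]_m, V x).
Hypothesis ad : adapted F S col ht A J crd dcr.
Local Notation ev := (ev col).
Local Notation rp := (rp col).
Local Notation Rv := (Rv col ht).
Local Notation B := (A :\: J).
Local Notation alpha := (fun x => \dim (S x)).
Local Notation good := (good col A J).
Local Notation fr := (fr ad).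
Local Notation gr := (gr A J crd).
Local Notation repr := {ffun arrow Q -> 'M[K]_m}.
Implicit Types (E G D : 'M[K]_m) (T : subfamily V) (w : repr).

Definition vrep w : representation V := fun a =>
  (dcr (target a) \o linfun (mulmxr (rp w a)) \o crd (source a))%VF.

Lemma crd_vrep w a u :
  crd (target a) (vrep w a u) = crd (source a) u *m rp w a *m pj A.
Proof.
rewrite !comp_lfunE lfunE (ad_crdK ad) /= -!mulmxA -pj_ev; congr (_ *m _).
by rewrite rpE -!mulmxA [ev (target a) *m (ev _ *m _)]mulmxA pjI finset.setIid.
Qed.

Lemma vrep_surj (v : representation V) : exists w, v = vrep w.
Proof.
pose g a : 'Hom('rV[K]_m, 'rV[K]_m) := (crd (target a) \o v a \o dcr (source a))%VF.
exists [ffun a => lin1_mx (g a)]; apply: functional_extensionality_dep => a.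
apply/lfunP => u; rewrite !comp_lfunE lfunE /= rpE ffunE !mulmxA (crd_ev ad).
by rewrite mul_rV_lin1 /= !comp_lfunE (ad_dcrK ad) (crd_ev ad) (ad_dcrK ad).
Qed.

Lemma subrepP E D w : good E -> E *m D = pj J ->
  subrepresentation (vrep w) (frame_span (fr E)) <->
  forall a, E *m rp w a *m pj A *m (1%:M - D *m E) = 0.
Proof.
move=> [Ef _] ED; have [EJ EA Ex] := Ef.
have E0 : E *m (1%:M - D *m E) = 0 by rewrite mulmxBr mulmx1 mulmxA ED EJ subrr.
split=> [h a|h a].
  apply/row_matrixP => i; rewrite row0 row_mul.
  case: (boolP (i \in J)) => iJ; last first.
    rewrite -EJ !row_mul (_ : row i (pj J) = 0) ?mul0mx //.
    by apply/rowP => j; rewrite !mxE (negPf iJ) andbF.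
  have [ia|ia] := eqVneq (col i) (source a); last first.
    have -> : rp w a = ev (source a) *m rp w a by rewrite rpE !mulmxA pjI finset.setIid.
    rewrite mulmxA -Ex !row_mul (_ : row i (ev _) = 0) ?mul0mx //.
    by apply/rowP => j; rewrite !mxE inE (negPf ia) andbF.
  have [k ki] := jx_surj_col ad iJ ia; subst i.
  pose u := tnth (fr E (source a)) k.
  have uE : crd (source a) u = row (jx ad k) E by rewrite /u tnth_fr crd_row.
  have uT : vrep w a u \in frame_span (fr E) (target a).
    by apply: (subvP (h a)); apply: memv_img; rewrite memv_span ?mem_tnth.
  have /(mem_frame_span ad _ Ef)[r] := uT.
  by rewrite crd_vrep uE !row_mul => ->; rewrite -mulmxA E0 mulmx0.
apply/subvP => _ /memv_imgP[u /(mem_frame_span ad _ Ef)[r ur] ->].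
apply/(mem_frame_span ad _ Ef); exists (r *m (E *m rp w a *m pj A *m D)).
rewrite crd_vrep ur; have /eqP := h a; rewrite mulmxBr mulmx1 subr_eq0 => /eqP e.
by rewrite -!mulmxA in e *; rewrite e.
Qed.

Lemma subrep_gr X w : X \in Rv J B ->
  subrepresentation (vrep w) (gr X) <->
  forall a, (pj J + X) *m rp w a *m (pj B - X) = 0.
Proof.
move=> XR; have [Xg <-] := gr_good ad XR.
have XD : (pj J + X) *m pj J = pj J.
  rewrite mulmxDl pjI finset.setIid -(Rv_r XR) -mulmxA pj_disj ?mulmx0 ?addr0 //.
  by rewrite disjoint_sym disjD.
have e : pj A *m (1%:M - pj J *m (pj J + X)) = pj B - X.
  rewrite mulmxBr mulmx1 mulmxA pj_subr ?(ad_sub ad) // mulmxDr pjI finset.setIid.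
  by rewrite (Rv_l XR) (pjD (ad_sub ad)) [pj J + pj B]addrC opprD addrA addrK.
have {}e (M : 'M[K]_m) : M *m pj A *m (1%:M - pj J *m (pj J + X)) = M *m (pj B - X).
  by rewrite -mulmxA e.
by rewrite (subrepP _ Xg XD); split=> h a; have := h a; rewrite e.
Qed.

(** The stable member of Omega may lie outside the orbit. Its frame [E0] is deformed to nearby
    frames [E] together with [w1], by conjugation; [f] vanishes whenever [E] spans a member of the
    orbit, hence on the closure, in particular at [E0]. *)
Lemma intersecting_dense : intersecting F S -> @dense K Q m col ht J A.
Proof.
move=> SV f fP f0 w1; apply: contrapT => /eqP fw1.
have [T0 T0O T0v] := SV (vrep w1); have [T0G _] := T0O.
have [E0 E0g E0T] := Gr_good ad T0G; have [E0f [D0' ED0']] := E0g.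
have [E0J E0A E0x] := E0f.
(* A right inverse of [E0] that respects colours, so that [g E] commutes with every [ev x] when [E]
   does. *)
pose D0 := \sum_x ev x *m (pj A *m D0') *m ev x.
have ED0 : E0 *m D0 = pj J.
  rewrite mulmx_sumr -[RHS]mulmx1 -(sum_ev col) mulmx_sumr; apply: eq_bigr => x _.
  rewrite !mulmxA -E0x -[ev x *m E0 *m _]mulmxA E0A -[ev x *m E0 *m _]mulmxA ED0'.
  by rewrite pj_ev -mulmxA pjI finset.setIid.
have D0x x : ev x *m D0 = D0 *m ev x.
  have evE y z : ev y *m ev z = (y == z)%:R *: ev y :> 'M[K]_m.
    have [->|yz] := eqVneq y z; first by rewrite pjI finset.setIid scale1r.
    rewrite scale0r pj_disj // finset.disjoints_subset.
    by apply/fintype.subsetP => i; rewrite !inE => /eqP ->.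
  rewrite mulmx_sumr mulmx_suml; apply: eq_bigr => y _.
  rewrite !mulmxA evE -!mulmxA evE eq_sym; have [->|_] := eqVneq y x; first by rewrite !scale1r.
  by rewrite !scale0r !mul0mx !mulmx0.
have AD0 : pj A *m D0 = D0.
  rewrite mulmx_sumr; apply: eq_bigr => x _.
  by rewrite !mulmxA -pj_ev -(mulmxA (ev x)) pjI finset.setIid.
(* [g E] carries [E0] to [E] and is the identity at [E0]. *)
pose g E := 1%:M + D0 *m (E - E0).
(* The adjugate in place of the inverse keeps this polynomial; the scalar factor does not affect
   stability. *)
pose wE E : repr := [ffun a => \adj (g E) *m w1 a *m g E].
(* The determinant makes [r] vanish where [g E] is not invertible. *)
pose r E := f (wE E) * \det (g E).
have gij i j : polyd 1 (fun E => g E i j).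
  apply: (@polyd_ext _ _ _ (fun E => (1%:M - D0 *m E0) i j + (D0 *m E) i j)).
    by move=> E; rewrite /g mulmxBr !mxE; ring.
  apply: polydD; first exact: polyd_const.
  by apply: polyd_lin => c u v; rewrite linearP !mxE.
have rP : polyf r.
  apply: polyfM; last by exists (m * 1)%N; apply: polyd_det.
  apply: (polyf_comp (d := (m * 1 + 0 + 1)%N) fP); apply: polymapF => a i j.
  apply: (@polyd_ext _ _ _ (fun E => (\adj (g E) *m w1 a *m g E) i j)).
    by move=> E; rewrite ffunE.
  apply: polyd_mulmx => // k l; apply: (@polyd_mulmx _ _ _ _ _ _ _ (fun E => \adj (g E)) (fun _ => w1 a)).
    by move=> k' l'; apply: polyd_adj.
  by move=> k' l'; apply: polyd_const.
have r0 : r E0 = 0.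
  apply: (Omega_vanish (ad := ad) rP) (E0g) _; last by rewrite E0T.
  move=> E Eg /(borel_orbit_gr ad)[X XR EX]; have [Ef _] := Eg; have [EJ EA Ex] := Ef.
  have [d0|d0] := eqVneq (\det (g E)) 0; first by rewrite /r d0 mulr0.
  have gU : g E \in unitmx by rewrite unitmxE unitfE.
  have gx x : ev x *m g E = g E *m ev x.
    rewrite mulmxDr mulmxDl mul1mx mulmx1 mulmxA D0x -!mulmxA; congr (_ + _ *m _).
    by rewrite mulmxBr mulmxBl Ex E0x.
  have ax x : ev x *m \adj (g E) = \adj (g E) *m ev x.
    have := congr1 (fun M => \adj (g E) *m M *m \adj (g E)) (gx x).
    rewrite /= !mulmxA mul_adj_mx -[_ *m g E *m _]mulmxA mul_mx_adj.
    rewrite mul_scalar_mx mul_mx_scalar -scalemxAl => /(scalerI d0) e.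
    by rewrite e.
  have gA : pj A *m g E = g E *m pj A.
    rewrite mulmxDr mulmxDl mul1mx mulmx1 mulmxA AD0 -mulmxA; congr (_ + _ *m _).
    by rewrite mulmxBl EA E0A.
  have rpw a : rp (wE E) a = \adj (g E) *m rp w1 a *m g E.
    rewrite [LHS]rpE ffunE [in RHS]rpE !mulmxA ax -[_ *m g E *m ev _]mulmxA.
    by rewrite -gx !mulmxA.
  have Eg0 : E0 *m g E = E.
    by rewrite mulmxDr mulmx1 mulmxA ED0 mulmxBr EJ E0J addrC subrK.
  have Ei : E *m invmx (g E) = E0 by rewrite -{1}Eg0 -mulmxA mulmxV ?mulmx1.
  have Ea : E *m \adj (g E) = \det (g E) *: E0.
    by rewrite -{1}Eg0 -mulmxA mul_mx_adj mul_mx_scalar.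
  have T0v' : forall a, E0 *m rp w1 a *m pj A *m (1%:M - D0 *m E0) = 0.
    by apply/(subrepP _ E0g ED0); rewrite E0T.
  have : subrepresentation (vrep (wE E)) (frame_span (fr E)).
    apply/(subrepP (D := invmx (g E) *m D0) _ Eg); first by rewrite mulmxA Ei.
    move=> a; rewrite rpw; set N := 1%:M - _ *m E.
    have gN : g E *m N = 1%:M - D0 *m E0.
      rewrite mulmxBr mulmx1 !mulmxA mulmxV // mul1mx.
      by rewrite /g mulmxBr addrA addrAC addrK.
    have -> : E *m (\adj (g E) *m rp w1 a *m g E) *m pj A *m N =
        \det (g E) *: (E0 *m rp w1 a *m pj A *m (g E *m N)).
      rewrite !mulmxA Ea -!scalemxAl; congr (_ *: (_ *m N)).
      by rewrite -[LHS]mulmxA -gA !mulmxA.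
    rewrite gN.
    by rewrite T0v' scaler0.
  rewrite EX => /(subrep_gr _ XR) h.
  by rewrite /r f0 ?mul0r //; exists X.
move/eqP: r0; rewrite /r mulf_eq0 /=.
have g0 : g E0 = 1%:M by rewrite /g subrr mulmx0 addr0.
rewrite g0 det1 oner_eq0 orbF.
suff -> : wE E0 = w1 by rewrite (negPf fw1).
by apply/ffunP => a; rewrite ffunE g0 adj1 mul1mx mulmx1.
Qed.

End Subrepresentations.

(** * Minors and normalised frames *)

Section ColumnSelection.
Context {K : fieldType} {m : nat} (J : {set 'I_m}).

(** Right multiplication puts column [f j] at each position [j] of [J]. Adding [pj (~: J)] then
    gives a square matrix whose determinant is a maximal minor of a frame. *)
Definition selmx (f : {ffun 'I_m -> 'I_m}) : 'M[K]_m :=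
  \matrix_(i, j) ((i == f j) && (j \in J))%:R.

Lemma mul_selmx (E : 'M[K]_m) f i j : (E *m selmx f) i j = E i (f j) * (j \in J)%:R.
Proof.
rewrite mxE (bigD1 (f j)) //= mxE eqxx big1 ?addr0 // => k kf.
by rewrite mxE (negPf kf) mulr0.
Qed.

Lemma det_replace_col (M : 'M[K]_m) k :
  (forall i j, j != k -> M i j = (i == j)%:R) -> \det M = M k k.
Proof.
move=> ME; rewrite (expand_det_col M k) (bigD1 k) //= big1 ?addr0 => [|i ik].
  rewrite /cofactor (_ : row' k (col' k M) = 1%:M) ?det1 ?mulr1.
    by rewrite -signr_odd addnn odd_double expr0 mulr1.
  by apply/matrixP => i j; rewrite !mxE ME ?(inj_eq lift_inj) // eq_sym neq_lift.
rewrite /cofactor; case: (unliftP i k) => [k' kk'|ki]; last by rewrite ki eqxx in ik.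
rewrite (expand_det_row _ k') big1 ?mulr0 // => j _.
by rewrite !mxE -kk' (ME k (lift k j)) ?(negPf (neq_lift _ _)) ?mul0r // eq_sym neq_lift.
Qed.

End ColumnSelection.

Section Minors.
Context {K : numFieldType} {Q : quiver} {m : nat} (col : 'I_m -> vertex Q) (A J : {set 'I_m}).
Local Notation ev := (ev col).
Local Notation N f E := (E *m selmx J f + pj (~: J)).
Implicit Types (E : 'M[K]_m) (f : {ffun 'I_m -> 'I_m}).

Lemma sel_pjC f : selmx J f *m pj (~: J) = 0 :> 'M[K]_m.
Proof.
by apply/matrixP => i j; rewrite pjrE !mxE inE -mulnb mulrnA; case: (j \in J); rewrite ?mulr0 ?mul0r ?muln0 ?mul0r.
Qed.

Lemma sel_pj f : selmx J f *m pj J = selmx J f :> 'M[K]_m.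
Proof.
by apply/matrixP => i j; rewrite pjrE !mxE; case: (j \in J); rewrite ?andbF ?mulr0 ?mulr1.
Qed.

Lemma sel_col f x : (forall j, j \in J -> col (f j) = col j) ->
  ev x *m selmx J f = selmx J f *m ev x :> 'M[K]_m.
Proof.
move=> fcol; apply/matrixP => i j; rewrite pjlE pjrE !mxE !inE.
case: (i =P f j) => [->|_] /=; last by rewrite mulr0 mul0r.
case: (boolP (j \in J)) => jJ; last by rewrite mulr0 mul0r.
by rewrite fcol // mulrC.
Qed.

Lemma normalized_frame E f : framemx col A J E -> (forall j, j \in J -> col (f j) = col j) ->
  \det (N f E) != 0 ->
  let E' := invmx (N f E) *m E in
  [/\ framemx col A J E', E' *m selmx J f = pj J, glJ col J (E *m selmx J f) &
    E = E *m selmx J f *m E'].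
Proof.
move=> [EJ EA Ex] fcol d0 E'; rewrite {}/E'; set n := N f E in d0 *; set E' := invmx n *m E; set n' := E *m selmx J f.
have uN : n \in unitmx by rewrite unitmxE unitfE.
have n'J : pj J *m n' = n' by rewrite mulmxA EJ.
have n'J' : n' *m pj J = n' by rewrite -mulmxA sel_pj.
have n'x x : ev x *m n' = n' *m ev x.
  by rewrite mulmxA Ex -mulmxA sel_col // mulmxA.
have JC : pj J *m pj (~: J) = 0 :> 'M[K]_m.
  by rewrite pj_disj // finset.disjoints_subset finset.setCK.
have CJ : pj (~: J) *m pj J = 0 :> 'M[K]_m.
  by rewrite pj_disj // disjoint_sym finset.disjoints_subset finset.setCK.
have nC : n *m pj (~: J) = pj (~: J).
  by rewrite mulmxDl -mulmxA sel_pjC mulmx0 add0r pjI finset.setIid.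
have iC : invmx n *m pj (~: J) = pj (~: J).
  by rewrite -{1}nC mulmxA mulVmx ?mul1mx.
have comm P : P *m n = n *m P -> P *m invmx n = invmx n *m P.
  move=> Pn; rewrite -[P in LHS](mulKmx uN) -[LHS]mulmxA -[n *m P]Pn.
  by rewrite -[P *m n *m _]mulmxA mulmxV // mulmx1.
have nJ : pj J *m n = n *m pj J.
  by rewrite mulmxDr mulmxDl JC CJ n'J n'J'.
have nx x : ev x *m n = n *m ev x by rewrite mulmxDr mulmxDl n'x pj_ev.
have CE : pj (~: J) *m E = 0 by rewrite -EJ mulmxA CJ mul0mx.
have n'E : n' = n - pj (~: J) by rewrite addrK.
split.
- split=> [||x].
  + by rewrite /E' mulmxA (comm _ nJ) -mulmxA EJ.
  + by rewrite /E' -mulmxA EA.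
  + by rewrite /E' mulmxA (comm _ (nx x)) -!mulmxA Ex.
- rewrite /E' -mulmxA -/n' n'E mulmxBr mulVmx // iC.
  apply/matrixP => i j; rewrite !mxE inE.
  by case: (i == j); case: (i \in J); rewrite /= ?subr0 ?subrr.
- by split.
have Cn : pj (~: J) *m n = n *m pj (~: J).
  by rewrite nC mulmxDr mulmxA CE mul0mx add0r pjI finset.setIid.
rewrite -/n' n'E mulmxBl /E' !mulmxA mulmxV // mul1mx.
by rewrite (comm _ Cn) -mulmxA CE mulmx0 subr0.
Qed.

(** Cramer's rule: entries of a normalised frame are quotients of minors, so they are finite once
    the denominator has largest value. *)
Lemma normalized_entry E f k j : framemx col A J E -> \det (N f E) != 0 -> k \in J ->
  (invmx (N f E) *m E) k j =
  \det (N [ffun l => if l == k then j else f l] E) / \det (N f E).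
Proof.
move=> [EJ EA Ex] d0 kJ; set f' := [ffun l => _]; set n := N f E in d0 *.
have uN : n \in unitmx by rewrite unitmxE unitfE.
have colE i : (invmx n *m N f' E) i k = (invmx n *m E) i j.
  rewrite [LHS]mxE [RHS]mxE; apply: eq_bigr => l _; congr (_ * _).
  rewrite mxE mul_selmx !mxE ffunE eqxx kJ mulr1 inE.
  by case: eqP => [->|_]; rewrite ?kJ addr0.
have colN i l : l != k -> (invmx n *m N f' E) i l = (i == l)%:R.
  move=> lk; transitivity ((invmx n *m n) i l); last by rewrite mulVmx // mxE.
  rewrite [LHS]mxE [RHS]mxE; apply: eq_bigr => h _; congr (_ * _).
  by rewrite /n [LHS]mxE [RHS]mxE !mul_selmx ffunE (negPf lk).
have := det_replace_col colN; rewrite colE => <-.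
by rewrite det_mulmx det_inv mulrC.
Qed.

End Minors.

(** * Limits of stable members of the cell *)

Section Properness.
Context {K : numClosedFieldType} {Q : quiver} (V : vertex Q -> vectType K).
Variables (F : forall x, filtration (V x)) (S : subfamily V).
Context {m : nat} (col : 'I_m -> vertex Q) (ht : 'I_m -> nat) (A J : {set 'I_m}).
Variable crd : forall x, 'Hom(V x, 'rV[K]_m).
Variable dcr : forall x, 'Hom('rV[K]_m, V x).
Hypothesis ad : adapted F S col ht A J crd dcr.
Hypothesis dJ : @dense K Q m col ht J A.
Local Notation ev := (ev col).
Local Notation Rv := (Rv col ht).
Local Notation B := (A :\: J).
Local Notation good := (good col A J).
Local Notation fr := (fr ad).
Local Notation gr := (gr A J crd).
Local Notation repr := {ffun arrow Q -> 'M[K]_m}.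
Local Notation N f E := (E *m selmx J f + pj (~: J)).

Let U : vectType K := ('M[K]_m * repr)%type.
Let L := {fraction {mpoly K[dim U]}}.
Let iota : {rmorphism K -> L} := ratf_const.

Let rX (M : 'M[K]_m) : 'M[K]_m :=
  \matrix_(i, j) if Rm col ht J B (i, j) then M i j else 0.

Let rX_Rv M : rX M \in Rv J B.
Proof. by apply/mem_Rv => i j; rewrite mxE; case: ifP; rewrite ?eqxx. Qed.

Let rX_id X : X \in Rv J B -> rX X = X.
Proof.
move=> /mem_Rv XR; apply/matrixP => i j; rewrite mxE.
by have [->|/XR -> //] := eqVneq (X i j) 0; case: ifP.
Qed.

Let rX_lin c M M' : rX (c *: M + M') = c *: rX M + rX M'.
Proof. by apply/matrixP => i j; rewrite !mxE; case: ifP; rewrite // mulr0 addr0. Qed.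

(** A vector space parametrises the pairs: [Ex u] is a frame of the member, and [Phi u] a
    representation preserving it, conjugate to one preserving K^J. *)
Let Ex (u : U) : 'M[K]_m := pj J + rX u.1.
Let Phi (u : U) : repr := cj (- rX u.1) (trP col J B u.2).

Let Ex_poly i j : polyd 1 (fun u => Ex u i j).
Proof.
apply: (@polyd_ext _ _ _ (fun u : U => pj J i j + rX u.1 i j)).
  by move=> u; rewrite [RHS]mxE.
apply: polydD; first exact: polyd_const.
by apply: polyd_lin => c u v; rewrite linearP rX_lin !mxE.
Qed.

Let Phi_entry a i j : polyd 3 (fun u => Phi u a i j).
Proof.
apply: (@polyd_ext _ _ _ (fun u : U => ((1%:M + - rX u.1) *m trP col J B u.2 a *m (1%:M - - rX u.1)) i j)).
  by move=> u; rewrite /Phi /cj [in RHS]ffunE.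
have XP k l : polyd 1 (fun u : U => rX u.1 k l).
  by apply: polyd_lin => c u v; rewrite linearP rX_lin !mxE.
apply: (@polyd_mulmx _ _ 2 1) => [k l|k l].
  apply: (@polyd_mulmx _ _ 1 1) => [k' l'|k' l'].
    apply: (@polyd_ext _ _ _ (fun u : U => (1%:M : 'M[K]_m) k' l' - rX u.1 k' l')).
      by move=> u; rewrite [RHS]mxE [X in _ = _ + X]mxE.
    by apply: polydB => //; apply: polyd_const.
  apply: polyd_lin => c u v; rewrite !trPE; case: ifP; rewrite ?mulr0 ?addr0 //.
  by rewrite linearP !ffunE !mxE.
apply: (@polyd_ext _ _ _ (fun u : U => (1%:M : 'M[K]_m) k l + rX u.1 k l)).
  by move=> u; rewrite [RHS]mxE opprK.
by apply: polydD => //; apply: polyd_const.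
Qed.

Let Phi_dense q : polyf q -> (forall u, q (Phi u) = 0) -> forall w, q w = 0.
Proof.
move=> qP q0; apply: dJ qP _ => w [X XR /(cond_cj w XR) XP].
rewrite -(q0 (X, cj X w)) /Phi /= rX_id // trP_id //.
by rewrite (cjK _ (disjD J A) XR).
Qed.

Let Phi_sub u : subrepresentation (vrep col crd dcr (Phi u)) (gr (rX u.1)).
Proof.
apply/(subrep_gr ad) => //; apply/(cond_cj _ (rX_Rv _)).
by rewrite (cjNK _ (disjD J A) (rX_Rv _)); apply: inP_trP.
Qed.

Let val u := value_at (u : U).

(* A common specialisation for the generic point of the family of pairs
   (member of the big cell, representation preserving it) and for [w]. *)
Let place w : exists G : set (L * K), [/\ phom iota G,
  forall x, x != 0 -> (exists a, G (x, a)) \/ (exists a, G (x^-1, a)) &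
  forall x q, polyf q -> (forall u, val u (x, q (Phi u))) -> G (x, q w)].
Proof.
pose G0 : set (L * K) := [set z | exists q, [/\ polyf q, z.2 = q w &
  forall u, val u (z.1, q (Phi u))]]%classic.
have G0P : phom iota G0.
  split.
  - move=> c; exists (fun _ => c); split=> // [|u]; first exact: polyf_const.
    by have [h _ _ _] := value_at_phom u; apply: h.
  - move=> x y a b [p [pP /= -> px]] [q [qP /= -> qy]].
    exists (fun w => p w + q w); split=> // [|u]; first exact: polyfD.
    by have [_ h _ _] := value_at_phom u; apply: h; [apply: px | apply: qy].
  - move=> x y a b [p [pP /= -> px]] [q [qP /= -> qy]].
    exists (fun w => p w * q w); split=> // [|u]; first exact: polyfM.
    by have [_ _ h _] := value_at_phom u; apply: h; [apply: px | apply: qy].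
  (* Density enters here: a polynomial that vanishes on the image of [Phi] vanishes at [w]. *)
  move=> a [q [qP /= -> q0]]; apply: Phi_dense => // u.
  by have [_ _ _ h] := value_at_phom u; apply: h; apply: q0.
have [G [GP G0G Gv]] := place_extension G0P; exists G; split=> // x q qP qx.
by apply: G0G; exists q.
Qed.

Let mxval u m1 m2 (M : 'M[L]_(m1, m2)) N := mxphom (G := val u) M N.

(* The frame of the generic member, normalised by a minor of largest value, has
   finite entries: its specialisation is a frame of a limit of members. *)
Theorem dense_intersecting : intersecting F S.
Proof.
move=> v; have [w ->] := vrep_surj ad v.
have [G [GP Gv Gq]] := place w.
have vP u : phom iota (val u) := value_at_phom u.
have [Eg EgP] := @generic_mx K U m m Ex (fun i j => ex_intro _ 1%N (Ex_poly i j)).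
have [wg wgP] : exists wg : arrow Q -> 'M[L]_m, forall a,
    (forall u, mxval u (wg a) (Phi u a)) /\ mxphom (G := G) (wg a) (w a).
  have h a : exists M : 'M[L]_m, (forall u, mxval u M (Phi u a)) /\ mxphom (G := G) M (w a).
    have [M MP] := @generic_mx K U m m (fun u => Phi u a) (fun i j => ex_intro _ 3%N (Phi_entry a i j)).
    exists M; split=> // i j; apply: (Gq _ (fun w => w a i j)) => [|u]; last exact: MP.
    by apply: polyf_lin => c w1 w2; rewrite !ffunE !mxE.
  by exists (fun a => sval (cid (h a))) => a; apply: (svalP (cid (h a))).
pose mp m1 m2 (M : 'M[K]_(m1, m2)) : 'M[L]_(m1, m2) := map_mx iota M.
pose Ng f := Eg *m mp _ _ (selmx J f) + mp _ _ (pj (~: J)).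
have NgP u f : mxval u (Ng f) (N f (Ex u)).
  apply: (mxphomD (vP u)); last exact: mxphom_map.
  by apply: (mxphomM (vP u)); [apply: EgP | apply: mxphom_map].
have dP u f : val u (\det (Ng f), \det (N f (Ex u))) by apply: (phom_det (vP u)); apply: NgP.
pose colp := [pred f : {ffun 'I_m -> 'I_m} | [forall j, (j \in J) ==> (col (f j) == col j)]].
(* Among the colour-preserving selections take one whose minor has largest value. The identity
   selection shows that some minor is nonzero: its value at u = 0 is 1. *)
have [||f [fcol df fmax]] := @place_max K L iota G GP Gv _ colp (fun f => \det (Ng f)) [ffun j => j].
- by apply/forallP => j; rewrite ffunE eqxx implybT.
- have := dP 0 [ffun j => j].
  have -> : N [ffun j => j] (Ex 0) = 1%:M.
    have -> : selmx J [ffun j => j] = pj J :> 'M[K]_m.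
      by apply/matrixP => i j; rewrite !mxE ffunE; case: eqP => // ->.
    have rX0 : rX 0 = 0 by rewrite rX_id // mem0v.
    rewrite /Ex /= rX0 addr0 pjI finset.setIid.
    rewrite -pjU ?finset.disjoints_subset ?finset.setCK // finset.setUCr.
    by apply/matrixP => i j; rewrite !mxE inE andbT.
  rewrite det1 => h; apply: contraTneq isT => d0.
  by have [_ _ _ h'] := vP 0; rewrite d0 in h; have /eqP := h' _ h; rewrite oner_eq0.
have {}fcol j : j \in J -> col (f j) = col j.
  by move=> jJ; have /forallP/(_ j)/implyP/(_ jJ)/eqP := fcol.
pose dK u := \det (N f (Ex u)).
have dKP : polyf dK.
  exists (m * 1)%N; apply: polyd_det => i j.
  apply: (@polyd_ext _ _ _ (fun u => (Ex u *m selmx J f) i j + pj (~: J) i j)).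
    by move=> u; rewrite [RHS]mxE.
  apply: polydD; last exact: polyd_const.
  apply: (@polyd_mulmx _ _ 1 0 _ _ _ Ex (fun _ => selmx J f)) => // k l.
  exact: polyd_const.
have [u0 du0] : exists u0, dK u0 != 0.
  apply: contrapT => h; move/eqP: df; apply.
  apply: (@ratf_vanish _ _ _ (fun _ => 1) 0); rewrite ?oner_eq0 //; first exact: polyf_const.
  move=> u _; have [d0|d0] := eqVneq (dK u) 0; first by rewrite -d0; apply: dP.
  by case: h; exists u.
have vanish x : (forall u, dK u != 0 -> val u (x, 0)) -> x = 0.
  exact: ratf_vanish dKP du0.
(* A matrix identity that holds at all points with [dK u != 0] holds generically, hence after
   specialisation. *)
have transfer m1 m2 (M : 'M[L]_(m1, m2)) M0 :
    (forall u, dK u != 0 -> mxval u M 0) -> mxphom (G := G) M M0 -> M0 = 0.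
  move=> Mv MG; apply/matrixP => i j; rewrite mxE; case: GP => _ _ _; apply.
  have <- : M i j = 0 by apply: vanish => u /Mv/(_ i j); rewrite mxE.
  exact: MG.
have dVP u : dK u != 0 -> val u ((\det (Ng f))^-1, (dK u)^-1).
  exact: value_atV (dP u f).
pose Eh := (\det (Ng f))^-1 *: (\adj (Ng f) *m Eg).
pose Ek u := invmx (N f (Ex u)) *m Ex u.
have EhP u : dK u != 0 -> mxval u Eh (Ek u).
  move=> du i j; rewrite /Ek /invmx unitmxE unitfE du -scalemxAl [X in (X, _)]mxE [X in (_, X)]mxE.
  have [_ _ vM _] := vP u; apply: vM; first exact: dVP.
  by apply: (mxphomM (vP u)); [apply: (mxphom_adj (vP u)); apply: NgP | apply: EgP].
have Exg u : good (Ex u) /\ frame_span (fr (Ex u)) = gr (rX u.1) by apply: gr_good.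
have EkP u : dK u != 0 -> [/\ framemx col A J (Ek u), Ek u *m selmx J f = pj J,
    glJ col J (Ex u *m selmx J f) & Ex u = Ex u *m selmx J f *m Ek u].
  by move=> du; have [[Ef _] _] := Exg u; apply: normalized_frame.
(* Entries with row outside [J] or between different colours are 0; the others are minors divided by
   the largest one. *)
have EhG k j : exists c, G (Eh k j, c).
  have G00 : G (0, 0) by have [Gc _ _ _] := GP; rewrite -{1}(rmorph0 iota); apply: Gc.
  case: (boolP (k \in J)) => kJ; last first.
    exists 0; suff -> : Eh k j = 0 by [].
    apply: vanish => u du; have [[JE _ _] _ _ _] := EkP u du.
    by have := EhP u du k j; rewrite -JE pjlE (negPf kJ) mul0r.
  have [kj|kj] := eqVneq (col j) (col k); last first.
    exists 0; suff -> : Eh k j = 0 by [].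
    apply: vanish => u du; have [[_ _ Ekx] _ _ _] := EkP u du.
    have := EhP u du k j; suff -> : Ek u k j = 0 by [].
    have := congr1 (fun M : 'M[K]_m => M k j) (Ekx (col k)).
    by rewrite pjlE pjrE !inE eqxx (negPf kj) mul1r mulr0.
  pose f' := [ffun l => if l == k then j else f l].
  have [|c Gc] := fmax f'.
    apply/forallP => l; apply/implyP => lJ; rewrite ffunE.
    by case: (l =P k) => [->|_]; rewrite ?kj // fcol.
  exists c; suff -> : Eh k j = \det (Ng f') / \det (Ng f) by [].
  apply/eqP; rewrite -subr_eq0; apply/eqP; apply: vanish => u du.
  have [[Ef _] _] := Exg u; have := normalized_entry j Ef du kJ => e.
  have [_ vD vM _] := vP u; rewrite -(subrr (Ek u k j)); apply: vD; first exact: EhP.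
  by apply: (phomN (vP u)); rewrite /Ek e; apply: vM; [apply: dP | apply: dVP].
pose E0 : 'M[K]_m := \matrix_(i, j) sval (cid (EhG i j)).
have E0P : mxphom (G := G) Eh E0 by move=> i j; rewrite [X in (_, X)]mxE; apply: (svalP (cid (EhG i j))).
have E0f : framemx col A J E0.
  split=> [||x]; apply/eqP; rewrite -subr_eq0; apply/eqP.
  - apply: (@transfer _ _ (mp _ _ (pj J) *m Eh - Eh)) => [u du|].
      have [[e _ _] _ _ _] := EkP u du; rewrite -(subrr (Ek u)) -{1}e.
      by apply: (mxphomB (vP u)); [apply: (mxphomM (vP u)); [apply: mxphom_map | apply: EhP] | apply: EhP].
    by apply: (mxphomB GP) => //; apply: (mxphomM GP) => //; apply: mxphom_map.
  - apply: (@transfer _ _ (Eh *m mp _ _ (pj A) - Eh)) => [u du|].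
      have [[_ e _] _ _ _] := EkP u du; rewrite -(subrr (Ek u)) -{1}e.
      by apply: (mxphomB (vP u)); [apply: (mxphomM (vP u)); [apply: EhP | apply: mxphom_map] | apply: EhP].
    by apply: (mxphomB GP) => //; apply: (mxphomM GP) => //; apply: mxphom_map.
  apply: (@transfer _ _ (mp _ _ (ev x) *m Eh - Eh *m mp _ _ (ev x))) => [u du|].
    have [[_ _ e] _ _ _] := EkP u du; rewrite -(subrr (Ek u *m ev x)) -{1}e.
    by apply: (mxphomB (vP u)); apply: (mxphomM (vP u)); (apply: mxphom_map || apply: EhP).
  by apply: (mxphomB GP); apply: (mxphomM GP) => //; apply: mxphom_map.
have E0D : E0 *m selmx J f = pj J.
  apply/eqP; rewrite -subr_eq0; apply/eqP.
  apply: (@transfer _ _ (Eh *m mp _ _ (selmx J f) - mp _ _ (pj J))) => [u du|].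
    have [_ e _ _] := EkP u du; have <- : Ek u *m selmx J f - pj J = 0 by rewrite e subrr.
    apply: (mxphomB (vP u)); last by apply: (mxphom_map (vP u)).
    by apply: (mxphomM (vP u)); [apply: EhP | apply: (mxphom_map (vP u))].
  apply: (mxphomB GP); last by apply: (mxphom_map GP).
  by apply: (mxphomM GP) => //; apply: mxphom_map.
have E0g : good E0 by split=> //; exists (selmx J f).
have Ekg u : dK u != 0 -> good (Ek u) /\ frame_span (fr (Ek u)) = gr (rX u.1).
  move=> du; have [Ef ED Gl e] := EkP u du; split; first by split=> //; exists (selmx J f).
  by rewrite -(glJ_span ad Gl Ef) -e; case: (Exg u).
exists (frame_span (fr E0)).
  split=> [|Z /(closed_poly ad)[P [Pp PZ]] orbZ]; first exact: good_Gr.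
  apply/(PZ _ E0g) => p Pp'; have [pL pLP] := phom_polyf iota (Pp p Pp').
  have pL0 : pL Eh = 0.
    apply: vanish => u du; have [Ekg' Eks] := Ekg u du.
    have <- : p (Ek u) = 0.
      by apply: (PZ _ Ekg').1 Pp'; rewrite Eks; apply: orbZ; apply: (gr_borel ad).
    by apply: pLP; [apply: vP | apply: EhP].
  have [_ _ _ G0] := GP; apply: G0; rewrite -pL0; exact: pLP.
apply/(subrepP ad _ E0g E0D) => a; rewrite rpE.
(* Stability is one polynomial identity in the frame and the representation, so it can be read at
   the points [u], where it holds, and at the place. *)
have h (H : set (L * K)) (HP : phom iota H) w' E' : mxphom (G := H) (wg a) (w' a) ->
    mxphom (G := H) Eh E' -> mxphom (G := H)
  (Eh *m (mp _ _ (ev (source a)) *m wg a *m mp _ _ (ev (target a))) *m mp _ _ (pj A) *m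
     (mp _ _ 1%:M - mp _ _ (selmx J f) *m Eh))
  (E' *m (ev (source a) *m w' a *m ev (target a)) *m pj A *m (1%:M - selmx J f *m E')).
  move=> Hw HE.
  have mpP m1 m2 (M : 'M[K]_(m1, m2)) : mxphom (G := H) (mp _ _ M) M := mxphom_map HP M.
  have HM m1 m2 m3 (M : 'M[L]_(m1, m2)) (M' : 'M[L]_(m2, m3)) M1 M2 :
    mxphom (G := H) M M1 -> mxphom (G := H) M' M2 -> mxphom (G := H) (M *m M') (M1 *m M2).
    exact: (mxphomM HP).
  apply: (HM); last by apply: (mxphomB HP) => //; apply: (HM).
  by do 4![apply: (HM) => //].
apply: transfer (h _ GP w E0 (proj2 (wgP a)) E0P) => u du.
have [Ekg' Eks] := Ekg u du; have [_ ED _ _] := EkP u du.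
suff <- : Ek u *m rp col (Phi u) a *m pj A *m (1%:M - selmx J f *m Ek u) = 0.
  by rewrite rpE; apply: h; [apply: vP | apply: (proj1 (wgP a)) | apply: EhP].
by have [h1 _] := subrepP ad (Phi u) Ekg' ED; apply: h1; rewrite Eks; apply: Phi_sub.
Qed.

End Properness.

(** * Adapted bases *)

Section AdaptedBasis.
Context {K : numFieldType} {U : vectType K} (F : filtration U) (S T : {vspace U}).
Hypothesis TS : (T <= S)%VS.

Lemma fil_mono i j : (i <= j)%N -> (j <= len F)%N -> (fil F i <= fil F j)%VS.
Proof.
elim: j => [|j IH]; first by rewrite leqn0 => /eqP ->.
rewrite leq_eqVlt ltnS => /orP[/eqP -> //|ij] jF.
by apply: subv_trans (fil_sub jF); apply: IH => //; apply: ltnW.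
Qed.

(* The next basis vector is taken in [T], or else in [S], whenever possible. *)
Lemma fil_pick k : ~~ (fil F k.+1 <= fil F k)%VS -> exists v,
  [/\ v \in fil F k.+1, v \notin fil F k,
    (v \in S) || (S :&: fil F k.+1 <= fil F k)%VS &
    (v \in T) || (T :&: fil F k.+1 <= fil F k)%VS].
Proof.
move=> /subvPn[v0 v0k v0k'].
have [TF|/subvPn[v]] := boolP (T :&: fil F k.+1 <= fil F k)%VS; last first.
  by rewrite memv_cap => /andP[vT vk] vk'; exists v; rewrite vT (subvP TS v vT).
have [SF|/subvPn[v]] := boolP (S :&: fil F k.+1 <= fil F k)%VS; last first.
  by rewrite memv_cap => /andP[vS vk] vk'; exists v; rewrite vS orbT.
by exists v0; rewrite v0k v0k' !orbT.
Qed.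

(** A vector is added at each jump of the filtration. If it is not in [W], then [W] gains nothing at
    this jump, so the chosen vectors in [W] keep spanning its steps. *)
Lemma adapted_seq k : (k <= len F)%N -> exists b : seq U,
  [/\ free b, <<b>>%VS = fil F k,
    forall i, (i <= k)%N -> <<take (\dim (fil F i)) b>>%VS = fil F i &
    forall W, W \in [:: S; T] -> (W :&: fil F k <= <<[seq x <- b | x \in W]>>)%VS].
Proof.
elim: k => [|k IH] kF.
  exists [::]; rewrite nil_free span_nil fil_first; split=> // [i|W _].
    by rewrite leqn0 => /eqP ->; rewrite fil_first.
  by rewrite capv0.
have [b [bf bk bi bW]] := IH (ltnW kF).
have szb : size b = \dim (fil F k) by move/eqP: bf; rewrite bk.
have [le|/fil_pick[v [vk vk' vS vT]]] := boolP (fil F k.+1 <= fil F k)%VS.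
  have e : fil F k.+1 = fil F k by apply/eqP; rewrite eqEsubv le fil_sub.
  exists b; rewrite e; split=> // i; rewrite leq_eqVlt => /orP[/eqP ->|/bi//].
  by rewrite e bi.
have bvf : free (b ++ [:: v]).
  have /perm_free -> : perm_eq (b ++ [:: v]) (v :: b) by rewrite perm_catC.
  by rewrite free_cons bk vk' bf.
have fE : fil F k.+1 = (fil F k + <[v]>)%VS.
  apply/eqP; rewrite eq_sym eqEdim subv_add fil_sub //= -memvE vk /=.
  apply: leq_trans (fil_dim kF) _; rewrite -szb -bk -span_seq1 -span_cat.
  by move/eqP: bvf => ->; rewrite size_cat addn1.
have bvk : <<b ++ [:: v]>>%VS = fil F k.+1 by rewrite span_cat span_seq1 bk fE.
exists (b ++ [:: v]); split=> // [i|W WST].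
  rewrite leq_eqVlt => /orP[/eqP ->|ik].
    by rewrite -bvk; move/eqP: bvf => ->; rewrite take_size.
  rewrite takel_cat ?bi // szb dimvS // fil_mono // ltnW //.
have vW : (v \in W) || (W :&: fil F k.+1 <= fil F k)%VS.
  by move: WST; rewrite !inE => /orP[] /eqP ->.
apply/subvP => u; rewrite memv_cap filter_cat span_cat => /andP[uW uk].
case/boolP: (v \in W) vW => vW /= h; last first.
  apply: (subvP (addvSl _ _)); apply: (subvP (bW W WST)).
  by rewrite memv_cap uW; apply: (subvP h); rewrite memv_cap uW.
move: uk; rewrite fE => /memv_addP[w wk [_ /vlineP[c ->] uE]]; rewrite uE.
rewrite /= vW span_seq1; apply: memv_add; last by rewrite memvZ ?memv_line.
apply: (subvP (bW W WST)); rewrite memv_cap wk andbT.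
have -> : w = u - c *: v by rewrite uE addrK.
by rewrite memvB // memvZ.
Qed.

Lemma adapted_basis : exists b : (\dim {:U}).-tuple U, [/\ basis_of fullv b,
  forall k, (k <= len F)%N -> forall u, u \in fil F k <->
    forall j, coord b j u != 0 -> (j < \dim (fil F k))%N &
  forall W, W \in [:: S; T] -> forall u, u \in W <->
    forall j, coord b j u != 0 -> b`_j \in W].
Proof.
have [b0 [bf bk bi bW]] := adapted_seq (leqnn (len F)).
rewrite fil_last in bk.
have szb : size b0 == \dim {:U} by move: bf; rewrite /free bk eq_sym.
pose b : (\dim {:U}).-tuple U := Tuple szb.
have bb : basis_of fullv b by rewrite basisEdim bk subvv (eqP szb) leqnn.
have coordE u : u = \sum_j coord b j u *: b`_j by apply: (coord_basis bb); rewrite memvf.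
have crd_bas (i j : 'I_(\dim {:U})) : coord b i b`_j = (i == j)%:R.
  by rewrite coord_free ?(basis_free bb) // eq_sym.
have supp (Y : seq U) u j : {subset Y <= b0} -> u \in <<Y>>%VS -> coord b j u != 0 -> b`_j \in Y.
  move=> Yb uY; apply: contraNT => jY.
  have maskE := @mem_maskv K U 'I_(\dim {:U}) (fun j u => coord b j u) (fun j => b`_j)
    (fun j a u v => linearP (coord b j) a u v) crd_bas coordE.
  have := maskE (fun l => b`_l \in Y) u.
  suff : (<<Y>> <= maskv (fun j : 'I_(\dim {:U}) => b`_j) (fun l => b`_l \in Y))%VS.
    by move=> /subvP/(_ u uY) h [/(_ h j jY) -> _].
  apply/span_subvP => y yY; apply/maskE => {}j {}jY.
  have /(nthP 0)[l lb yE] := Yb y yY.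
  have lb' : (l < \dim {:U})%N by rewrite -(eqP szb).
  have -> : y = b`_(Ordinal lb') by rewrite -yE.
  rewrite crd_bas; case: eqP => // jl.
  by case/negP: jY; rewrite jl /= yE.
have inW (W : {vspace U}) (P : pred 'I_(\dim {:U})) u : (forall j, P j -> b`_j \in W) ->
    (forall j, coord b j u != 0 -> P j) -> u \in W.
  move=> PW uP; rewrite [u]coordE; apply: memv_suml => j _.
  by have [->|/uP/PW h] := eqVneq (coord b j u) 0; rewrite ?scale0r ?mem0v // memvZ.
exists b; split=> // [k kF u|W WST u].
  have d_le : (\dim (fil F k) <= size b0)%N by rewrite (eqP szb) dimvS // subvf.
  split=> [uk j uj|].
    have : b`_j \in take (\dim (fil F k)) b0.
      by apply: (supp _ u) => //; [apply: mem_take | rewrite bi].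
    by rewrite in_take ?mem_nth ?(eqP szb) // index_uniq ?(eqP szb) ?(free_uniq bf).
  apply: inW => j jk; rewrite -(bi k kF); apply: memv_span.
  by rewrite -(nth_take 0 jk) mem_nth // size_takel.
split=> [uW j uj|]; last exact: inW.
have uF : u \in <<[seq x <- b0 | x \in W]>>%VS.
  by apply: (subvP (bW W WST)); rewrite memv_cap uW fil_last memvf.
have := supp _ u j _ uF uj; rewrite mem_filter => h.
by have /andP[] : (b`_j \in W) && (b`_j \in b0); first by apply: h => y; rewrite mem_filter => /andP[].
Qed.

(** Dimensions grow by at most one, so none is skipped. *)
Lemma dim_fil_attained d : (d <= \dim {:U})%N -> exists2 k, (k <= len F)%N & \dim (fil F k) = d.
Proof.
move=> dU; suff h n : (n <= len F)%N -> (d <= \dim (fil F n))%N ->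
    exists2 k, (k <= len F)%N & \dim (fil F k) = d.
  by apply: (h (len F)); rewrite ?fil_last.
elim: n => [|n IH] nF dn.
  by exists 0%N => //; move: dn; rewrite fil_first dimv0 leqn0 => /eqP ->.
have [dn'|nd] := leqP d (\dim (fil F n)); first by apply: IH => //; apply: ltnW.
exists n.+1 => //; apply/eqP; rewrite eqn_leq dn andbT.
exact: leq_trans (fil_dim nF) _.
Qed.

End AdaptedBasis.

Section Charts.
Context {K : numFieldType} {Q : quiver} (V : vertex Q -> vectType K).
Variables (F : forall x, filtration (V x)).
Variable b : forall x, (\dim {: V x}).-tuple (V x).
Hypothesis bb : forall x, basis_of fullv (b x).
Hypothesis bF : forall x k, (k <= len (F x))%N -> forall u, u \in fil (F x) k <->
  forall j, coord (b x) j u != 0 -> (j < \dim (fil (F x) k))%N.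

Let I : finType := {x : vertex Q & 'I_(\dim {: V x})}.
Let m := #|I|.
Let vtx (i : 'I_m) : vertex Q := tag (enum_val i).
Let pos (i : 'I_m) : nat := tagged (enum_val i).
Let idx x (k : 'I_(\dim {: V x})) : 'I_m := enum_rank (Tagged _ k : I).
(** Within a colour, heights compare like positions; adding the rank of the vertex makes them
    distinct across colours. *)
Let hgt (i : 'I_m) : nat := (pos i * #|vertex Q| + enum_rank (vtx i))%N.

Let vtx_idx x (k : 'I_(\dim {: V x})) : vtx (idx k) = x.
Proof. by rewrite /vtx /idx enum_rankK. Qed.

Let pos_idx x (k : 'I_(\dim {: V x})) : pos (idx k) = k.
Proof. by rewrite /pos /idx enum_rankK. Qed.

Let idxP i x : vtx i = x -> exists k : 'I_(\dim {: V x}), i = idx k.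
Proof.
move=> <-; exists (tagged (enum_val i)); rewrite /idx /vtx -[LHS]enum_valK.
by congr enum_rank; case: (enum_val i).
Qed.

Let idx_inj x : injective (@idx x).
Proof. by move=> k l /(congr1 pos); rewrite !pos_idx => /ord_inj. Qed.

Let hgt_lt i d : (hgt i < d * #|vertex Q|)%N = (pos i < d)%N.
Proof.
have h := ltn_ord (enum_rank (vtx i)); rewrite /hgt; apply/idP/idP => lt.
  rewrite -(ltn_pmul2r (m := #|vertex Q|)) ?(leq_ltn_trans (leq0n _) h) //.
  exact: leq_ltn_trans (leq_addr _ _) lt.
apply: (@leq_trans ((pos i).+1 * #|vertex Q|)%N); last by rewrite leq_mul2r lt orbT.
by rewrite mulSn addnC ltn_add2r.
Qed.

Let hgt_ltn i j : vtx i = vtx j -> (hgt i < hgt j)%N = (pos i < pos j)%N.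
Proof.
move=> ij; rewrite /hgt ij ltn_add2r ltn_pmul2r //.
by have := ltn_ord (enum_rank (vtx j)); apply: leq_ltn_trans.
Qed.

Let hgt_leq i j : vtx i = vtx j -> (hgt i <= hgt j)%N = (pos i <= pos j)%N.
Proof. by move=> ij; rewrite leqNgt hgt_ltn 1?eq_sym // -leqNgt. Qed.

Let hgt_inj : injective hgt.
Proof.
move=> i j e; have ij : vtx i = vtx j.
  apply: enum_rank_inj; apply: ord_inj.
  have := congr1 (fun n => n %% #|vertex Q|)%N e.
  by rewrite /hgt !modnMDl !modn_small.
have pij : pos i = pos j.
  by apply/eqP; rewrite eqn_leq -!hgt_leq // e leqnn.
have [k ik] := idxP ij; have [l jl] := idxP (erefl (vtx j)).
have kl : k = l by apply: ord_inj; rewrite -(pos_idx k) -(pos_idx l) -ik -jl.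
by rewrite ik kl.
Qed.

Definition chart_crd x (u : V x) : 'rV[K]_m := \sum_k coord (b x) k u *: delta_mx 0 (idx k).
Definition chart_dcr x (r : 'rV[K]_m) : V x := \sum_(k < \dim {: V x}) r 0 (idx k) *: (b x)`_k.

Lemma chart_crd_linear x : linear (@chart_crd x).
Proof.
move=> c u v; rewrite /chart_crd scaler_sumr -big_split; apply: eq_bigr => k _ /=.
by rewrite linearP scalerDl scalerA.
Qed.
HB.instance Definition _ x := GRing.isLinear.Build K (V x) 'rV[K]_m _ (@chart_crd x) (@chart_crd_linear x).

Lemma chart_dcr_linear x : linear (@chart_dcr x).
Proof.
move=> c r s; rewrite /chart_dcr scaler_sumr -big_split; apply: eq_bigr => k _ /=.
by rewrite !mxE scalerDl scalerA.
Qed.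
HB.instance Definition _ x := GRing.isLinear.Build K 'rV[K]_m (V x) _ (@chart_dcr x) (@chart_dcr_linear x).

Let crd x : 'Hom(V x, 'rV[K]_m) := linfun (@chart_crd x).
Let dcr x : 'Hom('rV[K]_m, V x) := linfun (@chart_dcr x).

Let crd_idx x (u : V x) k : crd x u 0 (idx k) = coord (b x) k u.
Proof.
rewrite lfunE /= /chart_crd summxE (bigD1 k) //= !mxE !eqxx mulr1 big1 ?addr0 // => l lk.
by rewrite !mxE (inj_eq (@idx_inj x)) eq_sym (negPf lk) andbF mulr0.
Qed.

Let crd_vtx x (u : V x) i : vtx i != x -> crd x u 0 i = 0.
Proof.
move=> ix; rewrite lfunE /= /chart_crd summxE big1 // => l _; rewrite !mxE.
by case: (i =P idx l) => [e|_]; [rewrite e vtx_idx eqxx in ix | rewrite andbF mulr0].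
Qed.

Let crd_supp x (u : V x) (P : 'I_m -> Prop) :
  (forall i, crd x u 0 i != 0 -> P i) <-> (forall k, coord (b x) k u != 0 -> P (idx k)).
Proof.
split=> [h k uk|h i]; first by apply: h; rewrite crd_idx.
have [/idxP[k ->]|/crd_vtx ->] := eqVneq (vtx i) x; last by rewrite eqxx.
by rewrite crd_idx => /h.
Qed.

Let JW (W : subfamily V) : {set 'I_m} := [set i | (b (vtx i))`_(pos i) \in W (vtx i)]%SET.

Lemma chart_adapted (W : subfamily V) :
  (forall x u, u \in W x <-> forall j, coord (b x) j u != 0 -> (b x)`_j \in W x) ->
  adapted F W vtx hgt [set: 'I_m]%SET (JW W) crd dcr.
Proof.
move=> WP; have bF_lt i d k : \dim (fil (F (vtx i)) k) = d -> (k <= len (F (vtx i)))%N ->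
    forall u, u \in fil (F (vtx i)) k <-> forall j, crd (vtx i) u 0 j != 0 -> (pos j < d)%N.
  move=> dk kF u; rewrite crd_supp bF // dk.
  by split=> h j /h; rewrite pos_idx.
split.
- exact: hgt_inj.
- exact: finset.subsetT.
- move=> x u; rewrite /dcr lfunE /= /chart_dcr.
  under eq_bigr => k _ do rewrite crd_idx.
  by rewrite -(coord_basis (bb x)) ?memvf.
- move=> x r; apply/rowP => i; rewrite !pjrE !inE mulr1.
  have [/idxP[k ->]|ix] := eqVneq (vtx i) x; last by rewrite crd_vtx // mulr0.
  rewrite crd_idx mulr1 /dcr lfunE /= /chart_dcr linear_sum /=.
  rewrite (bigD1 k) //= linearZ /= coord_free ?(basis_free (bb _)) // eqxx mulr1 big1 ?addr0 // => l lk.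
  by rewrite linearZ /= coord_free ?(basis_free (bb _)) // (negPf lk) mulr0.
- move=> x k kF; exists (\dim (fil (F x) k) * #|vertex Q|)%N => u.
  rewrite crd_supp bF //; split=> h j /h; by rewrite hgt_lt pos_idx.
- move=> i _; have [|k kF dk] := @dim_fil_attained K _ (F (vtx i)) (pos i).+1; first exact: ltn_ord.
  exists k => // u; rewrite (bF_lt _ _ _ dk kF).
  split=> h j uj; have := h j uj;
    (have [ji|/crd_vtx j0] := eqVneq (vtx j) (vtx i); last by rewrite j0 eqxx in uj);
    by rewrite hgt_leq // ltnS.
- move=> i _; have [|k kF dk] := @dim_fil_attained K _ (F (vtx i)) (pos i); first exact/ltnW/ltn_ord.
  exists k => // u; rewrite (bF_lt _ _ _ dk kF).
  split=> h j uj; have := h j uj;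
    (have [ji|/crd_vtx j0] := eqVneq (vtx j) (vtx i); last by rewrite j0 eqxx in uj);
    by rewrite hgt_ltn.
have JWE x (k : 'I_(\dim {: V x})) : (idx k \in JW W) = ((b x)`_k \in W x).
  by rewrite inE vtx_idx pos_idx.
move=> x u; rewrite WP; split=> [h|h k uk].
  apply/rowP => i; rewrite pjrE.
  have [/idxP[k ->]|ix] := eqVneq (vtx i) x; last by rewrite crd_vtx // mul0r.
  rewrite crd_idx JWE; have [->|/h ->] := eqVneq (coord (b x) k u) 0; first by rewrite mul0r.
  by rewrite mulr1.
move: uk; rewrite -crd_idx -h pjrE JWE.
by case: (_ \in _); rewrite // mulr0 eqxx.
Qed.

End Charts.

Lemma chart_exists (K : numFieldType) (Q : quiver) (V : vertex Q -> vectType K)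
    (F : forall x, filtration (V x)) (S T : subfamily V) : (forall x, T x <= S x)%VS ->
  exists m (col : 'I_m -> vertex Q) ht (crd : forall x, 'Hom(V x, 'rV[K]_m)) dcr
    (JS JT : {set 'I_m}), [/\ JT \subset JS,
      adapted F S col ht [set: 'I_m]%SET JS crd dcr & adapted F T col ht [set: 'I_m]%SET JT crd dcr].
Proof.
move=> TS; pose b x := sval (cid (adapted_basis (F x) (TS x))).
have bb x : basis_of fullv (b x) by have [] := svalP (cid (adapted_basis (F x) (TS x))).
have bF x k : (k <= len (F x))%N -> forall u, u \in fil (F x) k <->
    forall j, coord (b x) j u != 0 -> (j < \dim (fil (F x) k))%N.
  by have [_ + _] := svalP (cid (adapted_basis (F x) (TS x))); apply.
have bW x : forall W, W \in [:: S x; T x] -> forall u, u \in W <->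
    forall j, coord (b x) j u != 0 -> (b x)`_j \in W.
  by have [_ _] := svalP (cid (adapted_basis (F x) (TS x))).
do 7 eexists; split; last 2 first.
- by apply: (chart_adapted bb bF) => x; apply: bW; rewrite inE eqxx.
- by apply: (chart_adapted bb bF) => x; apply: bW; rewrite !inE eqxx orbT.
by apply/fintype.subsetP => i; rewrite !inE; apply: (subvP (TS _)).
Qed.

(** * Charts of subfamilies *)

Section SubCharts.
Context {K : numFieldType} {Q : quiver} (V : vertex Q -> vectType K).
Variables (F : forall x, filtration (V x)) (S : subfamily V).
Context {m : nat} (col : 'I_m -> vertex Q) (ht : 'I_m -> nat) (A J J' : {set 'I_m}).
Variable crd : forall x, 'Hom(V x, 'rV[K]_m).
Variable dcr : forall x, 'Hom('rV[K]_m, V x).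
Hypothesis ad : adapted F S col ht A J crd dcr.
Hypothesis J'J : J' \subset J.

Definition crd_sub x : 'Hom(restricted_family S x, 'rV[K]_m) :=
  (crd x \o linfun (vsval : subvs_of (S x) -> V x))%VF.

Definition dcr_sub x : 'Hom('rV[K]_m, restricted_family S x) :=
  (linfun (vsproj (S x)) \o dcr x \o linfun (mulmxr (pj J)))%VF.

Lemma crd_subE x (u : restricted_family S x) : crd_sub x u = crd x (vsval u).
Proof. by rewrite comp_lfunE lfunE. Qed.

Lemma extendedE (T : subfamily (restricted_family S)) x (u : subvs_of (S x)) :
  vsval u \in extended T x = (u \in T x).
Proof.
apply/memv_imgP/idP => [[t tT]|uT]; last by exists u => //; rewrite lfunE.
by rewrite lfunE => /val_inj ->.
Qed.

Lemma extended_sub (T : subfamily (restricted_family S)) x : (extended T x <= S x)%VS.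
Proof. by apply/subvP => _ /memv_imgP[t _ ->]; rewrite lfunE subvsP. Qed.

(** The induced filtrations are intersections with S, so the heights stay the same and only the
    ambient index set shrinks from [A] to [J]. *)
Lemma adapted_restricted (T : subfamily (restricted_family S)) :
  adapted F (extended T) col ht A J' crd dcr ->
  adapted (restricted_filtrations S F) T col ht J J' crd_sub dcr_sub.
Proof.
move=> adT.
have dcrS x (r : 'rV[K]_m) : crd x (dcr x (r *m pj J)) = r *m pj J *m ev col x.
  by rewrite (ad_crdK ad) -[r *m _ *m pj A]mulmxA pj_sub ?(ad_sub ad).
have dcrS_in x (r : 'rV[K]_m) : dcr x (r *m pj J) \in S x.
  by apply/(ad_S ad); rewrite dcrS -!mulmxA pj_ev [pj J *m (pj J *m _)]mulmxA pjI finset.setIid.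
have dcr_subE x r : vsval (dcr_sub x r) = dcr x (r *m pj J).
  by rewrite /dcr_sub !comp_lfunE !lfunE /= vsprojK ?dcrS_in.
have ind x k (u : restricted_family S x) :
    u \in fil (restricted_filtrations S F x) k <-> vsval u \in fil (F x) k.
  by rewrite -memv_preim lfunE.
split=> [||x u|x r|x k kF|i iJ|i iJ|x u].
- exact: ad_inj ad.
- exact: J'J.
- apply: val_inj; rewrite /= dcr_subE crd_subE.
  by rewrite ((ad_S ad _).1 (subvsP u)) (ad_dcrK ad).
- by rewrite crd_subE dcr_subE dcrS.
- have [c cE] := ad_fil ad kF; exists c => u.
  by rewrite ind cE crd_subE.
- have [k kF kE] := ad_fil_le ad (fintype.subsetP (ad_sub ad) i iJ); exists k => // u.
  by rewrite ind kE crd_subE.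
- have [k kF kE] := ad_fil_lt ad (fintype.subsetP (ad_sub ad) i iJ); exists k => // u.
  by rewrite ind kE crd_subE.
by rewrite crd_subE -(ad_S adT) extendedE.
Qed.

Definition coordinate_sub x : {vspace restricted_family S x} :=
  lker (linfun (mulmxr (1%:M - pj J')) \o crd_sub x)%VF.

Lemma mem_coordinate_sub x (u : restricted_family S x) :
  u \in coordinate_sub x <-> crd x (vsval u) *m pj J' = crd x (vsval u).
Proof.
rewrite memv_ker comp_lfunE lfunE /= crd_subE mulmxBr mulmx1 subr_eq0 eq_sym.
by split=> /eqP.
Qed.

Lemma adapted_coordinate : adapted F (extended coordinate_sub) col ht A J' crd dcr.
Proof.
case: (ad) => inj sub dcrK crdK filc le lt _; split=> // [|x u].
  exact: fintype.subset_trans J'J sub.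
split=> [uT|uJ].
  have uS := subvP (extended_sub _ x) _ uT.
  have uE : vsval (Subvs uS) = u by [].
  by move: uT; rewrite -{1}uE extendedE => /mem_coordinate_sub.
have uS : u \in S x.
  by apply/(ad_S ad); rewrite -uJ -mulmxA pj_sub.
have uE : vsval (Subvs uS) = u by [].
by rewrite -uE extendedE; apply/mem_coordinate_sub.
Qed.

End SubCharts.

(** * The criterion *)

Section ExpectedDimension.
Context {K : numFieldType} {Q : quiver} (V : vertex Q -> vectType K).
Variables (F : forall x, filtration (V x)) (S : subfamily V).
Context {m : nat} (col : 'I_m -> vertex Q) (ht : 'I_m -> nat) (A J : {set 'I_m}).
Variable crd : forall x, 'Hom(V x, 'rV[K]_m).
Variable dcr : forall x, 'Hom('rV[K]_m, V x).
Hypothesis ad : adapted F S col ht A J crd dcr.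

Lemma adapted_full : adapted F (fun x => fullv) col ht A A crd dcr.
Proof.
have crdA' := crdA ad; case: ad => inj _ dcrK crdK filc le lt _; split=> // x u.
by rewrite memvf crdA'.
Qed.

Lemma card_Hm (J1 J2 : {set 'I_m}) :
  #|Hm col J1 J2| = (\sum_a #|Jx col J1 (source a)| * #|Jx col J2 (target a)|)%N.
Proof.
rewrite -sum1_card; under [RHS]eq_bigr => a _ do rewrite -cardsX -sum1_card.
rewrite pair_big_dep; apply: eq_bigl => -[a [i j]] /=.
change (Hm col J1 J2 (a, (i, j)) = ((i, j) \in finset.setX (Jx col J1 (source a)) (Jx col J2 (target a)))).
rewrite finset.in_setX !inE /Hm /=.
by case: (i \in J1); case: (j \in J2); rewrite ?andbF.
Qed.

Lemma edimE : edim F S = #|Rm col ht J (A :\: J)|%:Z - #|Hm col J (A :\: J)|%:Z.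
Proof.
rewrite /edim (dim_OmegaE ad); congr (_ - _).
rewrite card_Hm (big_morph Posz PoszD (erefl 0)); apply: eq_bigr => a _.
rewrite PoszM (dim_S ad) (dim_S ad) (dim_S adapted_full); congr (_ * _).
have JA : Jx col J (target a) \subset Jx col A (target a).
  by apply/fintype.subsetP => i; rewrite !inE => /andP[/(fintype.subsetP (ad_sub ad)) -> ->].
rewrite subzn ?subset_leq_card //; congr Posz; rewrite -(finset.setIidPr JA) -cardsD.
by congr #|pred_of_set _|; apply/setP => i; rewrite !inE; case: (i \in J); case: (i \in A); case: (_ == _).
Qed.

End ExpectedDimension.

Section Criterion.
Context {K : numClosedFieldType} {Q : quiver} (V : vertex Q -> vectType K).
Variables (F : forall x, filtration (V x)) (S : subfamily V).

Theorem intersecting_criterion : intersecting F S <->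
  (0 <= edim F S /\
   forall T : subfamily (restricted_family S),
     strictly_intersecting (restricted_filtrations S F) T ->
     strictly_intersecting F (extended T)).
Proof.
split=> [SV|[edim_ge0 TV]].
  split.
    have [m [col [ht [crd [dcr [JS [_ [_ ad _]]]]]]]] := chart_exists F (fun x => subvv (S x)).
    rewrite (edimE ad) subr_ge0 lez_nat; exact/dense_card/(intersecting_dense ad).
  move=> T [TS [x Tx]]; split; last first.
    exists x => Tfull; apply: Tx; apply/vspaceP => u; rewrite memvf.
    by rewrite -extendedE Tfull memvf.
  have [m [col [ht [crd [dcr [JS [JT [JTS adS adT]]]]]]]] :=
    chart_exists F (extended_sub T).
  apply: (dense_intersecting adT).
  apply: (dense_trans JTS (finset.subsetT _)).
    exact: (intersecting_dense (adapted_restricted adS JTS adT)).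
  exact: (intersecting_dense adS).
have [m [col [ht [crd [dcr [J [_ [_ ad _]]]]]]]] := chart_exists F (fun x => subvv (S x)).
set A := [set: 'I_m]%SET in ad; pose B := A :\: J.
apply: (dense_intersecting ad); apply: contrapT => nd.
(* A single surjective delta would give density by [surj_dense]. *)
have ns : @nowhere_surj K Q m col ht J B.
  move=> w; rewrite ltnNge; apply/negP => le; apply: nd; exact: surj_dense le.
have [T0 [T0J dT0 le1 lt2]] := nowhere_surj_subspace (ad_inj ad) (disjD J A) ns.
have [T0E|T0n] := eqVneq T0 J.
  (* If [T0] is all of [J], the strict inequality contradicts (A) directly. *)
  by move: edim_ge0; rewrite (edimE ad) subr_ge0 lez_nat -/B leqNgt -{1 2}T0E lt2.
have adT := adapted_coordinate ad T0J.
have adT' := adapted_restricted ad T0J adT.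
have [TV' _] : strictly_intersecting F (extended (coordinate_sub S T0 crd)).
  apply: TV; split; first exact: (dense_intersecting adT').
  have : T0 \proper J by rewrite finset.properEneq T0n.
  case/properP => _ [i iJ iT]; exists (col i) => full.
  have := congr1 (fun W : {vspace _} => \dim W) full.
  rewrite (dim_S adT') (dim_S (adapted_full adT')) => e.
  have : (#|Jx col T0 (col i)| < #|Jx col J (col i)|)%N.
    apply: proper_card; apply/properP; split.
      by apply/fintype.subsetP => j; rewrite !inE => /andP[/(fintype.subsetP T0J) -> ->].
    by exists i; rewrite !inE ?iJ ?eqxx // (negPf iT).
  by rewrite e ltnn.
have := dense_card (intersecting_dense adT TV').
have JA : J \subset A by apply: finset.subsetT.
(* Additivity along T0, J, A: the inequality in S and the strict one in V/S add up to a negative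
   expected dimension, against the density given by (B). *)
rewrite (card_Rm_split _ _ _ T0J JA) (card_Hm_split _ _ T0J JA) leqNgt.
by move=> /negP; apply; rewrite -addnS; apply: leq_add.
Qed.

End Criterion.

Theorem theorem1p1 (R : realType) (Q : quiver)
    (V : vertex Q -> vectType R[i])
    (F : forall x : vertex Q, filtration (V x)) (S : subfamily V) :
  intersecting F S <->
  (0 <= edim F S /\
   forall T : subfamily (restricted_family S),
     strictly_intersecting (restricted_filtrations S F) T ->
     strictly_intersecting F (extended T)).
Proof. exact: intersecting_criterion. Qed.
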